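(* In the two-group factor model described in the context, fix $\mathbf w\in\mathbb R^k$ and assume that, conditionally on $\mathbf W=\mathbf w$, all of the following hold: (1) $\sup_{1\le i\le m<\infty}\|\mathbf L_{mi}\|_2^2<1$; (2) there exist an even integer $Q>2$ and $\gamma>0$ with $\frac{\gamma}{2+\gamma}+\frac2Q<1$ and $\sum_{d=1}^\infty d^{Q-2}\alpha(d)^{\gamma/(Q+\gamma)}<\infty$; (3) for all $t\in[0,1]$ and $r\in\{0,1\}$ the limit $F_r(t)=\lim_{m\to\infty}F_{m,r}(t)$ exists; (4) $\tau_*>0$, $\tau_*=\sup\{t\in(0,1):G(t)>t/q\}$, and $\tau_*$ is not an accumulation point of $\{t\in(0,1):G(t)=t/q\}$; (5) for all $s,t\in[a,b]$ and $r_0,r_1\in\{0,1\}$ the limits $\lim_{m}\frac{\pi_{r_0}^{(m)}\pi_{r_1}^{(m)}}{m}\sum_{i=1}^m\gamma_{mir_0}(t)\gamma_{mir_1}(s)$ and $\lim_{m}\frac{\pi_{r_0}^{(m)}\pi_{r_1}^{(m)}}{m}\sum_{i\ne j}\tilde\rho\big(\gamma_{mir_0}(t),\gamma_{mjr_1}(s),\Gamma^{(m)}_{ij}\big)$ both exist; (6) $F_0$ and $F_1$ are differentiable at $\tau_*$; (7) $\lim_{m\to\infty}\sup_{t\in[a,b]}\big|\sqrt m\,(F_{m,r}(t)-F_r(t))\big|=0$ for $r\in\{0,1\}$. Then, conditionally on $\mathbf W=\mathbf w$, $$\sqrt m\Big(\frac{V_m}{m}-F_0(\tau_* )\Big)\xrightarrow{d}\mathcal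 N(0,\sigma_R^2)\quad\text{as }m\to\infty,$$ where $$\sigma_R^2=(1+\beta)^2c^{(0,0)}(\tau_*,\tau_* )+\beta^2c^{(1,1)}(\tau_*,\tau_* )+2\beta(1+\beta)c^{(1,0)}(\tau_*,\tau_* ),\qquad \beta=\frac{F_0'(\tau_* )}{1/q-G'(\tau_* )}.$$
   Context: Notation: $\Phi$ is the standard normal CDF, $\bar\Phi=1-\Phi$. Fix $q\in(0,1)$, $\mu_A>0$ and an integer $k\ge0$. Model. For each $m\ge1$: $\pi_1^{(m)}\in(0,1)$, $\pi_0^{(m)}=1-\pi_1^{(m)}$; $H_{m1},\dots,H_{mm}$ are i.i.d. Bernoulli$(\pi_1^{(m)})$ ($H_{mi}=1$ iff hypothesis $i$ is nonnull); $\mathbf L_{mi}\in\mathbb R^k$ ($1\le i\le m$) are deterministic; $(\varepsilon_{m1},\dots,\varepsilon_{mm})\sim\mathcal N(0,\Sigma^{(m)})$ with $\Sigma^{(m)}_{ii}>0$ and $\|\mathbf L_{mi}\|_2^2+\Sigma^{(m)}_{ii}=1$; $\mathbf W\sim\mathcal N(0,I_k)$ is a single latent factor not depending on $m$. The $H$'s, the $\varepsilon$'s and $\mathbf W$ are independent of each other. $\Gamma^{(m)}$ is the correlation matrix corresponding to $\Sigma^{(m)}$. The $p$-values are $P_{mi}=\bar\Phi(\mu_AH_{mi}+\mathbf L_{mi}^{\mathsf T}\mathbf W+\varepsilon_{mi})$. Benjamini-Hochberg (BH) at level $q$: with sorted $p$-values $P_{m(1)}\le\dots\le P_{m(m)}$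 and $P_{m(0)}=0$, let $R_m=\max\{j\in\{0,\dots,m\}:P_{m(j)}\le jq/m\}$, $\tau_{\mathrm{BH},m}=P_{m(R_m)}$, and $V_m=\sum_{i=1}^mI\{P_{mi}\le\tau_{\mathrm{BH},m},H_{mi}=0\}$ (number of false discoveries; $V_m/m$ is the false positive ratio). Everything below is conditional on $\mathbf W=\mathbf w$ (i.e. with $\mathbf W$ replaced by the fixed vector $\mathbf w$). Mixing coefficients: $\xi_{mi}=(\varepsilon_{mi},H_{mi})$, $\mathcal A_1^n(m)=\sigma(\xi_{mi}:1\le i\le n)$, $\mathcal A_{n+d}^\infty(m)=\sigma(\xi_{mi}:n+d\le i\le m)$, and $\alpha(d)=\sup_{n,m}\sup\{|P(A_0\cap A_1)-P(A_0)P(A_1)|:A_0\in\mathcal A_1^n(m),A_1\in\mathcal A_{n+d}^\infty(m)\}$. Subdistributions: for $r\in\{0,1\}$, $t\in[0,1]$, $\gamma_{mir}(t)=\Pr(P_{mi}\le t\mid H_{mi}=r,\mathbf W=\mathbf w)=\bar\Phi\Big(\frac{\bar\Phi^{-1}(t)-\mu_Ar-\mathbf L_{mi}^{\mathsf T}\mathbf w}{\sqrt{1-\|\mathbf L_{mi}\|_2^2}}\Big)$, $F_{m,r}(t)=\frac{\pi_r^{(m)}}m\sum_{i=1}^m\gamma_{mir}(t)$, $F_r=\lim_mF_{m,r}$ (pointwise), $G=F_0+F_1$, $\hat F_{m,r}(t)=\frac1m\sum_{i=1}^mI\{H_{mi}=r\}I\{P_{mi}\le t\}$. Simes point: $\tau_*=\sup\{t\in(0,1):G(t)\ge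 t/q\}$, with $\sup\emptyset=0$. Interval $[a,b]$: a fixed interval with $a\in(0,q)$, $b\in(q,1)$, $G(a)>a/q$, and such that $\tau_*$ is the unique $t\in(a,b)$ with $G(t)=t/q$ (such an interval exists under hypotheses (1), (3), (4)). Covariances: for $t,s\in[0,1]$, $|\rho|\le1$, $\tilde\rho(t,s,\rho)=\Pr(Z_1\ge\bar\Phi^{-1}(t),Z_2\ge\bar\Phi^{-1}(s))-ts$ where $(Z_1,Z_2)$ is centered bivariate normal with unit variances and correlation $\rho$. $W_{m,r}(t)=\sqrt m(\hat F_{m,r}(t)-F_{m,r}(t))$, $c_m^{(r_0,r_1)}(t,s)=\mathrm{cov}(W_{m,r_0}(t),W_{m,r_1}(s))$ (conditionally on $\mathbf W=\mathbf w$), and $c^{(r_0,r_1)}(t,s)=\lim_{m\to\infty}c_m^{(r_0,r_1)}(t,s)$, which exists under hypotheses (3) and (5). $\mathcal N(0,0)$ denotes the point mass at $0$.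
   Formalization: The formal theorem additionally assumes 1/q − G'(τ* ) ≠ 0, so that the quotient β = F_0'(τ* )/(1/q − G'(τ* )) is defined; hypotheses (1)–(7) do not exclude a tangential crossing where this denominator vanishes. *)

(* Defs.v *)
From HB Require Import structures.
From mathcomp Require Import all_boot all_order all_algebra.
From mathcomp Require Import all_classical all_reals all_analysis.
Import Order.TTheory GRing.Theory Num.Theory.
Import numFieldNormedType.Exports.

Set Implicit Arguments.
Unset Strict Implicit.
Unset Printing Implicit Defensive.

Local Open Scope classical_set_scope.
Local Open Scope ring_scope.

Section normal_laws.
Context {R : realType}.

(* [Phi] is taken on the extended line so that [Phibar_inv] can have the values
   +oo at 0 and -oo at 1. *)
Definition Phi (x : \bar R) : R := fine (normal_prob 0 1 [set y : R | (y%:E <= x)%E]).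
Definition Phibar (x : \bar R) : R := 1 - Phi x.

(* Phibar is a decreasing bijection from \bar R onto [0, 1]: the infimum is the
   inverse image when 0 < t < 1, inf set0 = +oo when t = 0, -oo when t = 1. *)
Definition Phibar_inv (t : R) : \bar R :=
  ereal_inf [set x%:E | x in [set x : R | Phibar x%:E <= t]].

(* The library's [normal_prob] takes a standard deviation, and is not the point
   mass when that is 0; this law takes the variance. *)
Definition centered_normal (v : R) : set R -> \bar R :=
  if v == 0 then \d_(0 : R) else normal_prob 0 (Num.sqrt v).

(* Joint law of (Z1, rho Z1 + sqrt (1 - rho^2) Z2), with Z1, Z2 i.i.d. N(0, 1);
   |rho| = 1 is allowed. *)
Definition bivariate_normal (rho : R) : set (R * R) -> \bar R :=
  pushforward (normal_prob (0 : R) 1 \x normal_prob (0 : R) 1)%E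
    (fun z : R * R => (z.1, rho * z.1 + Num.sqrt (1 - rho ^+ 2) * z.2)).

Definition rho_tilde (t s rho : R) : R :=
  fine (bivariate_normal rho
    [set z | (Phibar_inv t <= z.1%:E)%E /\ (Phibar_inv s <= z.2%:E)%E]) - t * s.

Definition dotv k (u v : 'rV[R]_k) : R := \sum_j u 0 j * v 0 j.
Definition sqnorm2 k (u : 'rV[R]_k) : R := dotv u u.

Definition corr_mx n (S : 'M[R]_n) : 'M[R]_n :=
  \matrix_(i, j) (S i j / Num.sqrt (S i i * S j j)).

End normal_laws.

Section random_variables.
Context d (T : measurableType d) (R : realType) (P : probability T R).

Definition has_law d' (E : measurableType d') (X : T -> E) (mu : set E -> \bar R) :=
  forall A, measurable A -> P (X @^-1` A) = mu A.

(* X ~ N(0, S), where S may be singular. *)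
Definition gaussian_vector n (S : 'M[R]_n) (X : 'I_n -> T -> R) :=
  [/\ S^T = S,
      forall c : 'rV_n, 0 <= (c *m S *m c^T) 0 0 &
      forall c : 'rV_n,
        has_law (fun x => \sum_i c 0 i * X i x) (centered_normal ((c *m S *m c^T) 0 0))].

Definition sigma_of d' (E : measurableType d') (I : Type) (J : set I)
    (X : I -> T -> E) : set (set T) :=
  <<s \bigcup_(i in J) preimage_set_system setT (X i) measurable >>.

Definition mutually_independent (I : finType) (F : I -> set (set T)) :=
  forall (J : {set I}) (A : I -> set T), (forall i, i \in J -> F i (A i)) ->
    P (\bigcap_(i in [set` J]) A i) = (\prod_(i in J) P (A i))%E.

Definition cvg_in_law (X : nat -> T -> R) (mu : set R -> \bar R) :=
  forall x : R, {for x, continuous (fun y : R => mu `]-oo, y]%classic)} ->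
    P [set u | X n u <= x] @[n --> \oo] --> mu `]-oo, x]%classic.

End random_variables.

(* Row m of each triangular array is indexed by 'I_m, so 'I_m's i stands for the
   index i + 1 of the usual 1-based numbering. *)
Record factor_model d (T : measurableType d) (R : realType) (P : probability T R)
    (k : nat) := FactorModel {
  effect : R ;
  nonnull_prob : nat -> R ;
  loading : forall m, 'I_m -> 'rV[R]_k ;
  noise_cov : forall m, 'M[R]_m ;
  nonnull : forall m, 'I_m -> {RV P >-> bool} ;
  noise : forall m, 'I_m -> {RV P >-> R} ;
  factor : 'I_k -> {RV P >-> R} ;
  effect_gt0 : 0 < effect ;
  nonnull_prob01 : forall m, (0 < m)%N -> 0 < nonnull_prob m < 1 ;
  nonnull_law : forall m (i : 'I_m),
    has_law P (nonnull i) (bernoulli_prob (nonnull_prob m)) ;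
  nonnull_indep : forall m,
    mutually_independent P (fun i : 'I_m => sigma_of [set i] (@nonnull m)) ;
  noise_law : forall m, gaussian_vector P (noise_cov m) (@noise m) ;
  noise_var_gt0 : forall m (i : 'I_m), 0 < noise_cov m i i ;
  unit_variance : forall m (i : 'I_m), sqnorm2 (loading i) + noise_cov m i i = 1 ;
  factor_law : gaussian_vector P 1%:M factor ;
  blocks_indep : forall m, mutually_independent P (fun b : 'I_3 =>
    tnth [tuple sigma_of setT (@nonnull m); sigma_of setT (@noise m);
                sigma_of setT factor] b)
}.

Section two_group_factor_model.
Context d (T : measurableType d) (R : realType) (P : probability T R) (k : nat).
Context (M : factor_model P k).

Definition group_prob m (r : bool) : R :=
  if r then nonnull_prob M m else 1 - nonnull_prob M m.

(* The p-value given that the latent factor equals w; the unconditional p-value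
   at u is [pvalue w i u] with w = (factor M 0 u, ..., factor M (k - 1) u). *)
Definition pvalue (w : 'rV[R]_k) m (i : 'I_m) (u : T) : R :=
  Phibar (effect M * (nonnull M i u)%:R + dotv (loading M i) w + noise M i u)%:E.

Definition mix_pair m (i : 'I_m) (u : T) : R * bool := (noise M i u, nonnull M i u).

Definition alpha (dist : nat) : R :=
  sup [set x | exists n m (A0 A1 : set T),
    [/\ (0 < n)%N,
        sigma_of [set i : 'I_m | (i.+1 <= n)%N] (@mix_pair m) A0,
        sigma_of [set i : 'I_m | (n + dist <= i.+1)%N] (@mix_pair m) A1 &
        x = `|fine (P (A0 `&` A1)) - fine (P A0) * fine (P A1)| ]].

Section given_factor.
Variable w : 'rV[R]_k.

Definition gamma m (i : 'I_m) (r : bool) (t : R) : R :=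
  Phibar ((Phibar_inv t - (effect M * r%:R + dotv (loading M i) w)%:E) *
          ((Num.sqrt (1 - sqnorm2 (loading M i)))^-1)%:E)%E.

Definition subdist m (r : bool) (t : R) : R :=
  group_prob m r / m%:R * \sum_(i < m) gamma i r t.

Definition lim_subdist (r : bool) (t : R) : R := limn (fun m => subdist m r t).

Definition lim_dist (t : R) : R := lim_subdist false t + lim_subdist true t.

Definition emp_subdist m (r : bool) (t : R) (u : T) : R :=
  m%:R^-1 * \sum_(i < m) ((nonnull M i u == r) && (pvalue w i u <= t))%:R.

Definition emp_process m (r : bool) (t : R) (u : T) : R :=
  Num.sqrt m%:R * (emp_subdist m r t u - subdist m r t).

Definition emp_cov m (r0 r1 : bool) (t s : R) : R :=
  fine (covariance P (emp_process m r0 t) (emp_process m r1 s)).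

Definition lim_cov (r0 r1 : bool) (t s : R) : R :=
  limn (fun m => emp_cov m r0 r1 t s).

Section level.
Variable q : R.

(* P_(j) for j = 0, ..., m, with P_(0) = 0. *)
Definition sorted_pvalue m (u : T) (j : nat) : R :=
  nth 0 (0 :: sort <=%R [seq pvalue w i u | i <- enum 'I_m]) j.

Definition bh_count m (u : T) : nat :=
  \max_(j < m.+1 | sorted_pvalue m u j <= j%:R * q / m%:R) j.

Definition bh_threshold m (u : T) : R := sorted_pvalue m u (bh_count m u).

Definition false_discoveries m (u : T) : nat :=
  #|[set i : 'I_m | (pvalue w i u <= bh_threshold m u) && ~~ nonnull M i u]|.

(* The library's convention sup set0 = 0 is the one wanted here. *)
Definition simes_point : R :=
  sup [set t | 0 < t < 1 /\ lim_dist t >= t / q].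

Definition beta_slope : R :=
  derive1 (lim_subdist false : R -> R^o) simes_point /
  (q^-1 - derive1 (lim_dist : R -> R^o) simes_point).

Definition fp_variance : R :=
  let c r0 r1 := lim_cov r0 r1 simes_point simes_point in
  (1 + beta_slope) ^+ 2 * c false false + beta_slope ^+ 2 * c true true
  + 2 * beta_slope * (1 + beta_slope) * c true false.

End level.
End given_factor.
End two_group_factor_model.

(* Main.v *)
Require Import Defs.
From HB Require Import structures.
From mathcomp Require Import all_boot all_order all_algebra.
From mathcomp Require Import all_classical all_reals all_analysis.
From mathcomp Require Import measurable_realfun.
From mathcomp Require Import ring lra zify.
Import Order.TTheory GRing.Theory Num.Theory.
Import numFieldNormedType.Exports.

Set Implicit Arguments.
Unset Strict Implicit.
Unset Printing Implicit Defensive.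

Local Open Scope classical_set_scope.
Local Open Scope ring_scope.

(** Because [{i | P_i <= t}] grows with [t] and the step-up threshold is the last crossing of the
    empirical distribution with the line [t / q], the false positive ratio, which is the empirical null
    subdistribution at the threshold, is squeezed between its values at deterministic points on either
    side of the crossing.  On the scale [tau + x / sqrt m], and up to a small error at the points [x] of
    any finite grid, the empirical subdistribution of group [r] is
    [F_r tau + (W_r tau + F_r' tau * x) / sqrt m] with [W_r] its empirical process.  Hence the crossing
    is at [x = (W_0 tau + W_1 tau) / kappa] where [kappa = q^-1 - G' tau > 0], and
    [sqrt m (V_m / m - F_0 tau) = (1 + beta) W_0 tau + beta W_1 tau + o_P(1)].  No functional limit
    theorem is needed: the increments of [W_r] at distance [O(1 / sqrt m)] vanish in L2, and a crossing
    beyond [tau + J / sqrt m] is excluded by Chebyshev's inequality on a grid, with a bound of the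
    order of the tail of the sum of [j^-2].

    The linear part is a normalized sum over a strongly mixing row.  Its central limit theorem is
    Lindeberg's replacement with the test function [Phi ((a - y) / sqrt C)], where [C] is the variance
    still to come; this function solves the heat equation in [(C, y)], so the Gaussian side needs no
    auxiliary variables.  The limiting covariances come from the joint law of pairs of noise variables:
    quadrant probabilities are limits of expectations of trigonometric polynomials, which the variances
    of linear combinations determine. *)

(** * Bounded random variables *)

(** Dependence shapes the Lindeberg part. The partial variances of a mixing row need not increase,
    so the variance [C] still to come could become negative; an extra Gaussian variance [eps ^+ 2]
    and a lower bound on variance increments keep it above [eps ^+ 2 / 2]. Within step [i],
    derivatives of the test function are moved back to [i - l] and [i - 2 * l]: the gaps decouple
    them from the current variable, and the products left in the window have mean half the variance
    increment, up to mixing errors. The window is of order [l * delta ^+ 2], so decoupling costs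
    [l * alpha l] per unit of variance; hence the mixing hypothesis is used in the form that
    [k * alpha k] is summable. The lag [l] is fixed before [m] grows.

    The limiting variance may be 0. Distribution functions are therefore recovered by smoothing at
    scale [eta ^+ 2] and shifting by [eta], which also handles a point mass away from its atom.

    Only late crossings need a probabilistic exclusion: for an early threshold, the lower bound
    comes from maximality of the step-up rule and the upper bound is trivial. *)

Section bounded_expectation.
Context d (T : measurableType d) (R : realType) (P : probability T R).
Implicit Types f g : T -> R.

(** Bounded measurable functions are integrable and closed under products, so for them expectation
    is a real number and linearity has no further side conditions. *)
Definition bmf f := measurable_fun [set: T] f /\ exists K : R, forall x, `|f x| <= K.

Definition Er f : R := \int[P]_x f x.

Lemma bmf_cst c : bmf (fun=> c).
Proof. by split => //; exists `|c|. Qed.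

Lemma bmfD f g : bmf f -> bmf g -> bmf (fun x => f x + g x).
Proof.
move=> [mf [K hK]] [mg [L hL]]; split; first exact: measurable_funD.
by exists (K + L) => x; rewrite (le_trans (ler_normD _ _))// lerD.
Qed.

Lemma bmfM f g : bmf f -> bmf g -> bmf (fun x => f x * g x).
Proof.
move=> [mf [K hK]] [mg [L hL]]; split; first exact: measurable_funM.
by exists (K * L) => x; rewrite normrM ler_pM.
Qed.

Lemma bmfZ c f : bmf f -> bmf (fun x => c * f x).
Proof. by move=> bf; apply: bmfM => //; exact: bmf_cst. Qed.

Lemma bmfN f : bmf f -> bmf (fun x => - f x).
Proof. by move=> bf; under eq_fun do rewrite -mulN1r; exact: bmfZ. Qed.

Lemma bmfB f g : bmf f -> bmf g -> bmf (fun x => f x - g x).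
Proof. by move=> bf bg; apply: bmfD => //; exact: bmfN. Qed.

Lemma bmfX n f : bmf f -> bmf (fun x => f x ^+ n).
Proof.
move=> bf; elim: n => [|n ih].
  by under eq_fun do rewrite expr0; exact: bmf_cst.
by under eq_fun do rewrite exprS; exact: bmfM.
Qed.

Lemma bmf_sum (I : Type) (s : seq I) (p : pred I) (F : I -> T -> R) :
  (forall i, bmf (F i)) -> bmf (fun x => \sum_(i <- s | p i) F i x).
Proof.
move=> bF; elim: s => [|i s ih].
  by under eq_fun do rewrite big_nil; exact: bmf_cst.
under eq_fun do rewrite big_cons; case: (p i) => //.
exact: bmfD.
Qed.

Lemma bmf_indic (A : set T) : measurable A -> bmf (\1_A : T -> R).
Proof.
move=> mA; split; first exact: measurable_indic.
by exists 1 => x; rewrite indicE; case: (_ \in _); rewrite ?normr0 ?normr1.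
Qed.

Lemma bmf_bool (b : T -> bool) : measurable [set x | b x] ->
  bmf (fun x => (b x)%:R : R).
Proof.
move=> mb; rewrite (_ : (fun _ => _) = \1_[set x | b x]); first exact: bmf_indic.
apply/funext => x; rewrite indicE; congr (_%:R).
by congr nat_of_bool; apply/idP/idP => [h|/set_mem//]; rewrite inE.
Qed.

Lemma bmf_comp (h : R -> R) f : measurable_fun [set: R] h ->
  (exists K : R, forall y, `|h y| <= K) -> measurable_fun [set: T] f ->
  bmf (fun x => h (f x)).
Proof.
move=> mh [K hK] mf; split; first exact: measurableT_comp.
by exists K.
Qed.

Lemma bmf_integrable f : bmf f -> P.-integrable [set: T] (EFin \o f).
Proof.
move=> [mf [K hK]]; apply: measurable_bounded_integrable => //.
  by rewrite [ltLHS](_ : _ = 1%E) ?ltry//; exact: probability_setT.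
exists K; split; first by rewrite num_real.
by move=> M KM x _; exact: le_trans (hK x) (ltW KM).
Qed.

Lemma eq_Er f g : f =1 g -> Er f = Er g.
Proof. by move=> fg; apply: eq_Rintegral => x _; rewrite fg. Qed.

Lemma Er_cst c : Er (fun=> c) = c.
Proof. rewrite /Er Rintegral_cst// [X in fine X](_ : _ = 1%E) ?mulr1//.
exact: probability_setT. Qed.

Lemma ErD f g : bmf f -> bmf g -> Er (fun x => f x + g x) = Er f + Er g.
Proof. by move=> bf bg; apply: RintegralD => //; exact: bmf_integrable. Qed.

Lemma ErB f g : bmf f -> bmf g -> Er (fun x => f x - g x) = Er f - Er g.
Proof. by move=> bf bg; apply: RintegralB => //; exact: bmf_integrable. Qed.

Lemma ErZ c f : bmf f -> Er (fun x => c * f x) = c * Er f.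
Proof. by move=> bf; apply: RintegralZl => //; exact: bmf_integrable. Qed.

Lemma ErN f : bmf f -> Er (fun x => - f x) = - Er f.
Proof.
move=> bf; rewrite -mulN1r -ErZ//; apply: eq_Er => x; exact/esym/mulN1r.
Qed.

Lemma Er_sum (I : Type) (s : seq I) (p : pred I) (F : I -> T -> R) :
  (forall i, bmf (F i)) ->
  Er (fun x => \sum_(i <- s | p i) F i x) = \sum_(i <- s | p i) Er (F i).
Proof.
move=> bF; elim: s => [|i s ih].
  by rewrite big_nil -[RHS](Er_cst 0); apply: eq_Er => x; rewrite big_nil.
rewrite big_cons -ih; case: ifP => pi; last first.
  by apply: eq_Er => x; rewrite big_cons pi.
by rewrite -ErD//; [apply: eq_Er => x; rewrite big_cons pi|exact: bmf_sum].
Qed.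

Lemma Er_ge0 f : (forall x, 0 <= f x) -> 0 <= Er f.
Proof. by move=> f0; exact: Rintegral_ge0. Qed.

Lemma le_Er f g : bmf f -> bmf g -> (forall x, f x <= g x) -> Er f <= Er g.
Proof.
by move=> bf bg fg; apply: le_Rintegral => //; exact: bmf_integrable.
Qed.

Lemma norm_Er_le f K : bmf f -> (forall x, `|f x| <= K) -> `|Er f| <= K.
Proof.
move=> bf fK; rewrite ler_norml -(Er_cst (- K)) -{2}(Er_cst K).
by apply/andP; split; apply: le_Er => //; try exact: bmf_cst;
  move=> x; have := fK x; rewrite ler_norml => /andP[].
Qed.

Lemma norm_Er_norm f : bmf f -> `|Er f| <= Er (fun x => `|f x|).
Proof. by move=> bf; apply: le_normr_Rintegral => //; exact: bmf_integrable. Qed.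

Lemma bmf_norm f : bmf f -> bmf (fun x => `|f x|).
Proof.
move=> [mf [K hK]]; split; first exact: measurableT_comp.
by exists K => x; rewrite normr_id.
Qed.

Lemma Er_indic (A : set T) : measurable A -> Er (\1_A) = fine (P A).
Proof.
by move=> mA; rewrite /Er /Rintegral integral_indic// setIT.
Qed.

Lemma Er_bool (b : T -> bool) : measurable [set x | b x] ->
  Er (fun x => (b x)%:R) = fine (P [set x | b x]).
Proof.
move=> mb; rewrite -Er_indic//; apply: eq_Er => x; rewrite indicE.
by congr (nat_of_bool _)%:R; apply/idP/idP => [h|/set_mem//]; rewrite inE.
Qed.

Lemma expectationE f : bmf f -> ('E_P[f] = (Er f)%:E)%E.
Proof.
move=> bf; rewrite unlock /Er /Rintegral fineK//.
exact/integrable_fin_num/bmf_integrable.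
Qed.

Definition cov f g := Er (fun x => f x * g x) - Er f * Er g.

Lemma covC f g : cov f g = cov g f.
Proof.
by rewrite /cov [Er f * _]mulrC; congr (_ - _); apply: eq_Er => x; rewrite mulrC.
Qed.

Lemma covDl f g h : bmf f -> bmf g -> bmf h ->
  cov (fun x => f x + g x) h = cov f h + cov g h.
Proof.
move=> bf bg bh; rewrite /cov ErD//.
under eq_Er do rewrite mulrDl.
by rewrite ErD; [ring|exact: bmfM|exact: bmfM].
Qed.

Lemma covZl c f h : bmf f -> bmf h -> cov (fun x => c * f x) h = c * cov f h.
Proof.
move=> bf bh; rewrite /cov ErZ//.
under eq_Er do rewrite -mulrA.
by rewrite ErZ; [ring|exact: bmfM].
Qed.

Lemma covBl f g h : bmf f -> bmf g -> bmf h ->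
  cov (fun x => f x - g x) h = cov f h - cov g h.
Proof.
move=> bf bg bh; rewrite covDl//; last exact: bmfN.
congr (_ + _); rewrite -mulN1r -covZl//.
by congr cov; apply/funext => x; rewrite mulN1r.
Qed.

Lemma cov_cstl c f : bmf f -> cov (fun=> c) f = 0.
Proof. by move=> bf; rewrite /cov ErZ// Er_cst subrr. Qed.

Lemma cov_suml (I : Type) (s : seq I) (p : pred I) (F : I -> T -> R) h :
  (forall i, bmf (F i)) -> bmf h ->
  cov (fun x => \sum_(i <- s | p i) F i x) h = \sum_(i <- s | p i) cov (F i) h.
Proof.
move=> bF bh; rewrite /cov Er_sum// mulr_suml sumrB -Er_sum; last first.
  by move=> i; exact: bmfM.
by under eq_Er do rewrite mulr_suml.
Qed.

Lemma cov_sumr (I : Type) (s : seq I) (p : pred I) (F : I -> T -> R) h :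
  (forall i, bmf (F i)) -> bmf h ->
  cov h (fun x => \sum_(i <- s | p i) F i x) = \sum_(i <- s | p i) cov h (F i).
Proof.
move=> bF bh; rewrite covC cov_suml//.
by apply: eq_bigr => i _; rewrite covC.
Qed.

(** The bridge from the extended-real covariance that defines [emp_cov] to the real-valued [cov] of
    all later computations. *)
Lemma covarianceE_cov f g : bmf f -> bmf g ->
  (covariance P f g = (cov f g)%:E)%E.
Proof.
move=> bf bg; rewrite unlock.
rewrite [X in ('E_P[X])%E](_ : _ = fun x => (f x - Er f) * (g x - Er g)); last first.
  by apply/funext => x; rewrite /= !fctE !expectationE.
have b1 : bmf (fun x => f x - Er f) by apply: bmfB => //; exact: bmf_cst.
have b2 : bmf (fun x => g x - Er g) by apply: bmfB => //; exact: bmf_cst.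
rewrite expectationE; last exact: bmfM.
congr (_%:E); rewrite /cov.
transitivity (Er (fun x => f x * g x - (Er g * f x + (Er f * g x - Er f * Er g)))).
  by apply: eq_Er => x; ring.
rewrite ErB ?ErD ?ErB ?ErZ ?Er_cst//; first ring.
all: repeat (apply: bmfM || apply: bmfB || apply: bmfD || apply: bmf_cst) => //.
Qed.

Lemma chebyshev_Er f (c : R) : bmf f -> 0 < c ->
  fine (P [set x | c <= `|f x|]) <= Er (fun x => f x ^+ 2) / c ^+ 2.
Proof.
move=> bf c0.
have mf : measurable [set x | c <= `|f x|].
  rewrite -[X in measurable X]setTI (_ : [set x | _] = (Num.norm \o f) @^-1` `[c, +oo[).
    by apply: measurableT_comp => //; exact: bf.1.
  by apply/seteqP; split => x /=; rewrite in_itv/= andbT.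
rewrite ler_pdivlMr ?exprn_gt0// -Er_indic// mulrC -ErZ; last exact: bmf_indic.
apply: le_Er; [apply: bmfZ; exact: bmf_indic|exact: bmfX|move=> x].
rewrite indicE; case: (boolP (_ \in _)) => [|_]; last by rewrite mulr0 sqr_ge0.
by rewrite inE/= mulr1 => h; rewrite -(real_normK (num_real (f x))) lerXn2r// nnegrE// ltW.
Qed.

End bounded_expectation.

(** * Covariances of bounded variables from covariances of events *)

Section covariance_inequality.
Context d (T : measurableType d) (R : realType) (P : probability T R).
Implicit Types f g : T -> R.

Local Notation bmf := (@bmf _ T R).
Local Notation Er := (Er P).
Local Notation cov := (cov P).

Lemma norm_cov_le f g a b : bmf f -> bmf g ->
  (forall x, `|f x| <= a) -> (forall x, `|g x| <= b) -> `|cov f g| <= 2 * a * b.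
Proof.
move=> bf bg fa gb; rewrite /cov (le_trans (ler_normB _ _))//.
have h1 : `|Er (fun x => f x * g x)| <= a * b.
  apply: norm_Er_le => [|x]; first exact: bmfM.
  by rewrite normrM ler_pM.
have h2 : `|Er f * Er g| <= a * b.
  by rewrite normrM ler_pM// norm_Er_le.
by move: h1 h2; lra.
Qed.

Lemma sum_lt_nat_gt (y : R) n : n%:R <= y -> \sum_(k < n) (k%:R < y)%R%:R = n%:R :> R.
Proof.
move=> ny; rewrite (eq_bigr (fun=> 1)) => [|k _]; first by rewrite sumr_const card_ord.
by rewrite (lt_le_trans _ ny)// ltr_nat.
Qed.

(** The sum counts the naturals below [y], hence it is the ceiling of [y]. *)
Lemma sum_lt_nat_bounds (y : R) n : 0 <= y <= n%:R ->
  y <= \sum_(k < n) (k%:R < y)%R%:R <= y + 1.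
Proof.
elim: n => [|n ih] /andP[y0 yn].
  by rewrite big_ord0; move: y0 yn => /=; lra.
rewrite big_ord_recr/=; have [ny|yn'] := ltP n%:R y.
  rewrite sum_lt_nat_gt ?(ltW ny)//; move: yn ny; rewrite -natr1 /=; lra.
by rewrite addr0 ih// y0.
Qed.

(* Averaging indicators of rays approximates a bounded variable uniformly, which carries the mixing
   bound over from events to variables. *)
Definition staircase n f : T -> R := fun x => n%:R^-1 * \sum_(k < n) (k%:R < n%:R * f x)%R%:R.

Lemma bmf_ray s f : bmf f -> bmf (fun x => (s < f x)%R%:R).
Proof.
move=> [mf _]; apply: bmf_bool; rewrite -[X in measurable X]setTI.
rewrite (_ : [set x | _] = f @^-1` `]s, +oo[); first exact: mf.
by apply/seteqP; split => x /=; rewrite in_itv/= andbT.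
Qed.

Lemma bmf_staircase n f : bmf f -> bmf (staircase n f).
Proof.
move=> bf; apply: bmfZ; apply: bmf_sum => k; apply: (@bmf_ray _ (fun x => n%:R * f x)).
exact: bmfZ.
Qed.

Lemma staircase_approx n f x : (0 < n)%N -> 0 <= f x <= 1 ->
  `|f x - staircase n f x| <= n%:R^-1.
Proof.
move=> n0 /andP[f0 f1]; have n0' : 0 < n%:R :> R by rewrite ltr0n.
have /andP[h1 h2] : n%:R * f x <= \sum_(k < n) (k%:R < n%:R * f x)%R%:R <= n%:R * f x + 1.
  apply: sum_lt_nat_bounds; rewrite mulr_ge0//= ?ler0n// ler_piMr// ler0n.
rewrite /staircase ler_norml; apply/andP; split.
  rewrite lerBrDr -(ler_pM2l n0') mulrDr mulVKf ?gt_eqF// mulrN divff ?gt_eqF//.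
  by move: h2; lra.
rewrite lerBlDr -(ler_pM2l n0') mulrDr mulVKf ?gt_eqF// divff ?gt_eqF//.
by move: h1; lra.
Qed.

(** The covariance of two staircases is an average of [n.+1 ^+ 2] covariances of rays, so it
    inherits the bound [al] with no loss; passing to the staircases costs [4 / n.+1], which
    vanishes. *)
Lemma cov01_mixing f g (al : R) : bmf f -> bmf g ->
  (forall x, 0 <= f x <= 1) -> (forall x, 0 <= g x <= 1) ->
  (forall s t, `|cov (fun x => (s < f x)%R%:R) (fun x => (t < g x)%R%:R)| <= al) ->
  `|cov f g| <= al.
Proof.
move=> bf bg f01 g01 H.
have key n : `|cov f g| <= al + 4 * n.+1%:R^-1.
  set F := staircase n.+1 f; set G := staircase n.+1 g.
  have bF : bmf F by exact: bmf_staircase.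
  have bG : bmf G by exact: bmf_staircase.
  have fF x : `|f x - F x| <= n.+1%:R^-1 by exact: staircase_approx.
  have gG x : `|g x - G x| <= n.+1%:R^-1 by exact: staircase_approx.
  have -> : cov f g = cov (fun x => f x - F x) g + (cov F (fun x => g x - G x) + cov F G).
    by rewrite covBl// (covC P F (fun x => g x - G x)) (covBl P bg bG bF) (covC P G F) (covC P g
      F); ring.
  have f1 x : `|f x| <= 1 by have /andP[? ?] := f01 x; rewrite ger0_norm.
  have g1 x : `|g x| <= 1 by have /andP[? ?] := g01 x; rewrite ger0_norm.
  have F1 x : `|F x| <= 1.
    rewrite ger0_norm; last by rewrite mulr_ge0// sumr_ge0// => ? _; rewrite ler0n.
    rewrite /F /staircase ler_pdivrMl ?ltr0n// mulr1.
    apply: le_trans (_ : \sum_(k < n.+1) 1 <= _); last by rewrite sumr_const card_ord.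
    by apply: ler_sum => i _; case: (_ < _).
  have h1 : `|cov (fun x => f x - F x) g| <= 2 * n.+1%:R^-1 * 1.
    by apply: norm_cov_le => //; exact: bmfB.
  have h2 : `|cov F (fun x => g x - G x)| <= 2 * 1 * n.+1%:R^-1.
    by apply: norm_cov_le => //; exact: bmfB.
  have h3 : `|cov F G| <= al.
    have bf' (k : 'I_n.+1) : bmf (fun x => (k%:R < n.+1%:R * f x)%R%:R).
      by apply: (@bmf_ray _ (fun x => n.+1%:R * f x)); exact: bmfZ.
    have bg' (k : 'I_n.+1) : bmf (fun x => (k%:R < n.+1%:R * g x)%R%:R).
      by apply: (@bmf_ray _ (fun x => n.+1%:R * g x)); exact: bmfZ.
    rewrite /F /G /staircase covZl; [|exact: bmf_sum|exact: bmfZ (bmf_sum _ _ bg')].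
    rewrite covC covZl; [|exact: bmf_sum|exact: bmf_sum].
    rewrite covC cov_suml//; last exact: bmf_sum.
    rewrite mulrA -expr2 normrM ger0_norm ?exprn_ge0// exprVn ler_pdivrMl ?exprn_gt0 ?ltr0n//.
    apply: le_trans (ler_norm_sum _ _ _) _.
    apply: le_trans (_ : \sum_(i < n.+1) n.+1%:R * al <= _); last first.
      by rewrite sumr_const card_ord -[leLHS]mulr_natl mulrA expr2.
    apply: ler_sum => i _; rewrite cov_sumr//.
    apply: le_trans (ler_norm_sum _ _ _) _.
    apply: le_trans (_ : \sum_(i < n.+1) al <= _); last first.
      by rewrite sumr_const card_ord -[leLHS]mulr_natl.
    apply: ler_sum => j _.
    have e (h : T -> R) (k : nat) : (fun x => (k%:R < n.+1%:R * h x)%R%:R : R) =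
        (fun x => (n.+1%:R^-1 * k%:R < h x)%R%:R).
      by apply/funext => x; rewrite ltr_pdivrMl// ltr0n.
    by rewrite !e; exact: H.
  rewrite (le_trans (ler_normD _ _))// (le_trans (lerD (lexx _) (ler_normD _ _)))//.
  by move: h1 h2 h3; set iN := n.+1%:R^-1; clearbody iN; lra.
apply/ler_addgt0Pr => e e0.
have [n hn] : exists n : nat, 4 / e < n%:R.
  by exists (Num.truncn (4 / e)).+1; apply: truncnS_gt.
apply: le_trans (key n) _; rewrite lerD2l ler_pdivrMr ?ltr0n//.
rewrite mulrC -ler_pdivrMr// ltW// (lt_le_trans hn)// ler_nat; exact: leqnSn.
Qed.

(** The factor [4 * a * b] is [(2 * a) * (2 * b)]: affine maps carry [[- a, a]] and [[- b, b]] to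
    [[0, 1]], and a ray of the image is a ray of the original. *)
Lemma cov_mixing f g (a b al : R) : 0 < a -> 0 < b -> bmf f -> bmf g ->
  (forall x, `|f x| <= a) -> (forall x, `|g x| <= b) ->
  (forall s t, `|cov (fun x => (s < f x)%R%:R) (fun x => (t < g x)%R%:R)| <= al) ->
  `|cov f g| <= 4 * a * b * al.
Proof.
move=> a0 b0 bf bg fa gb H.
have aux (h : T -> R) (c : R) : 0 < c -> bmf h -> (forall x, `|h x| <= c) ->
    [/\ bmf (fun x => (2 * c)^-1 * (h x + c)),
       forall x, 0 <= (2 * c)^-1 * (h x + c) <= 1,
       (forall x, h x = 2 * c * ((2 * c)^-1 * (h x + c)) - c) &
       forall s x, (s < (2 * c)^-1 * (h x + c)) = (2 * c * s - c < h x)].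
  move=> c0 bh hc; have c2 : 0 < 2 * c by rewrite mulr_gt0.
  split.
  - by apply: bmfZ; apply: bmfD => //; exact: bmf_cst.
  - move=> x; have := hc x; rewrite ler_norml => /andP[h1 h2].
    rewrite mulr_ge0/= ?invr_ge0 ?(ltW c2)//; last by move: h1; lra.
    by rewrite ler_pdivrMl//; move: h2; lra.
  - by move=> x; rewrite mulVKf ?gt_eqF// addrK.
  - by move=> s x; rewrite ltr_pdivlMl// ltrBlDr.
have [bF F01 Fe Fr] := aux f a a0 bf fa.
have [bG G01 Ge Gr] := aux g b b0 bg gb.
set F := fun x => (2 * a)^-1 * (f x + a) in bF F01 Fe Fr.
set G := fun x => (2 * b)^-1 * (g x + b) in bG G01 Ge Gr.
have h : `|cov F G| <= al.
  apply: cov01_mixing => // s t.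
  rewrite (_ : (fun x => (s < F x)%R%:R) = fun x => (2 * a * s - a < f x)%R%:R); last first.
    by apply/funext => x; rewrite -Fr.
  rewrite (_ : (fun x => (t < G x)%R%:R) = fun x => (2 * b * t - b < g x)%R%:R); last first.
    by apply/funext => x; rewrite -Gr.
  exact: H.
have -> : cov f g = 2 * a * (2 * b * cov F G).
  rewrite (_ : f = fun x => 2 * a * F x - a); last by apply/funext.
  rewrite (_ : g = fun x => 2 * b * G x - b); last by apply/funext.
  have bG' : bmf (fun x => 2 * b * G x) by exact: bmfZ.
  rewrite covBl; [|exact: bmfZ|exact: bmf_cst|by apply: bmfB => //; exact: bmf_cst].
  rewrite cov_cstl ?subr0; last by apply: bmfB => //; exact: bmf_cst.
  rewrite covZl//; last by apply: bmfB => //; exact: bmf_cst.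
  rewrite [in LHS]covC covBl//; last exact: bmf_cst.
  by rewrite cov_cstl// subr0 covZl// covC.
have a2 : 0 < 2 * a by rewrite mulr_gt0.
have b2 : 0 < 2 * b by rewrite mulr_gt0.
rewrite normrM (gtr0_norm a2) normrM (gtr0_norm b2).
by rewrite (_ : 4 * a * b * al = 2 * a * (2 * b * al)) ?ler_pM2l//; ring.
Qed.

End covariance_inequality.

(** * Gaussian smoothing *)

Section normal_calculus.
Context {R : realType}.
Implicit Types x y u : R.

Local Notation mu := (@lebesgue_measure R).
Local Notation phi := (normal_pdf (0 : R) 1).

(** [dphi] and [ddphi] are the first two derivatives of the standard normal density. *)
Definition dphi u := - (u * phi u).
Definition ddphi u := (u ^+ 2 - 1) * phi u.

Lemma phiE x : phi x = normal_peak 1 * expR (- (x ^+ 2 / 2)).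
Proof. by rewrite normal_pdfE ?oner_neq0// /normal_fun subr0 expr1n mulNr. Qed.

Lemma phi_gt0 x : 0 < phi x.
Proof. by rewrite phiE mulr_gt0 ?expR_gt0// normal_peak_gt0// oner_neq0. Qed.

Lemma is_derive_phi x : is_derive x 1 phi (dphi x).
Proof.
rewrite (_ : phi = fun x => normal_peak 1 * expR (- (x ^+ 2 / 2))); last first.
  by apply/funext => y; rewrite phiE.
rewrite /dphi phiE.
have h : is_derive x (1 : R) (fun x : R => - (x ^+ 2 / 2)) (- x).
  by apply: is_derive_eq; rewrite /GRing.scale/=; field.
apply: is_derive_eq; rewrite /GRing.scale/=; ring.
Qed.

Lemma is_derive_dphi x : is_derive x 1 dphi (ddphi x).
Proof.
have := is_derive_phi x => h.
apply: is_derive_eq; rewrite /GRing.scale/= /ddphi /dphi; ring.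
Qed.

(** With the exponential split into two equal factors, [u ^+ 2] times one factor is at most 4
    because [expR x >= 1 + x]; so [1 + u ^+ 4] against both is at most [1 + 4 * 4 = 17]. *)
Lemma pow_phi_bounded n u : (n <= 4)%N -> `|u| ^+ n * phi u <= 17 * normal_peak 1.
Proof.
move=> n4; rewrite phiE mulrCA mulrC ler_pM2r ?normal_peak_gt0 ?oner_neq0//.
have h1 : `|u| ^+ n <= 1 + u ^+ 4.
  have [u1|u1] := leP `|u| 1.
    by rewrite (@le_trans _ _ 1)// ?exprn_ile1// lerDl exprn_even_ge0.
  rewrite (le_trans (ler_weXn2l (ltW u1) n4))// -normrX ger0_norm ?exprn_even_ge0//.
  by rewrite lerDr.
have h2 : (1 + u ^+ 4) * expR (- (u ^+ 2 / 2)) <= 17.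
  have -> : - (u ^+ 2 / 2) = - (u ^+ 2 / 4) + - (u ^+ 2 / 4) by field.
  have e1 : expR (- (u ^+ 2 / 4)) <= 1 by rewrite -[leRHS]expR0 ler_expR oppr_le0 divr_ge0 ?sqr_ge0.
  have e2 : u ^+ 2 * expR (- (u ^+ 2 / 4)) <= 4.
    rewrite expRN ler_pdivrMr ?expR_gt0//.
    have := expR_ge1Dx (u ^+ 2 / 4); lra.
  have e0 : 0 <= expR (- (u ^+ 2 / 4)) by exact: expR_ge0.
  rewrite expRD; set e := expR _ in e0 e1 e2 *.
  have u2 : 0 <= u ^+ 2 by exact: sqr_ge0.
  have -> : (1 + u ^+ 4) * (e * e) = e * e + (u ^+ 2 * e) * (u ^+ 2 * e) by ring.
  have : e * e <= 1 * 1 by apply: ler_pM.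
  have : (u ^+ 2 * e) * (u ^+ 2 * e) <= 4 * 4 by apply: ler_pM => //; exact: mulr_ge0.
  lra.
by apply: le_trans h2; rewrite ler_pM2r ?expR_gt0.
Qed.

Lemma mvt_bound (f df : R -> R) (B x y : R) :
  (forall z, Num.min x y <= z <= Num.max x y -> is_derive z 1 f (df z)) ->
  (forall z, Num.min x y <= z <= Num.max x y -> `|df z| <= B) ->
  `|f y - f x| <= B * `|y - x|.
Proof.
move=> fdf dfB.
wlog xy : x y fdf dfB / x <= y.
  move=> h; have [xy|/ltW yx] := leP x y; first exact: h.
  by rewrite distrC [X in _ * X]distrC; apply: h => // z; rewrite minC maxC;
    [exact: fdf|exact: dfB].
move: fdf dfB; rewrite min_l// max_r// => fdf dfB.
have [c cxy ->] : exists2 c, c \in `[x, y]%R & f y - f x = df c * (y - x).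
  apply: MVT_segment => // [z|].
    by rewrite in_itv/= => /andP[/ltW xz /ltW zy]; apply: fdf; rewrite xz.
  apply: derivable_within_continuous => z; rewrite in_itv/= => zxy.
  by case: (fdf z zxy).
by rewrite normrM ler_wpM2r// dfB.
Qed.

Lemma mvt_boundT (f df : R -> R) (B x y : R) :
  (forall z : R, is_derive z 1 f (df z)) -> (forall z, `|df z| <= B) ->
  `|f y - f x| <= B * `|y - x|.
Proof. by move=> h1 h2; apply: mvt_bound => z _. Qed.

Lemma Phi_Rint x : Phi x%:E = \int[mu]_(t in `]-oo, x]) phi t.
Proof.
rewrite /Phi /normal_prob /Rintegral; congr (fine (integral _ _ _)).
Qed.

Lemma is_derive_Rint_normal (s x : R) : s != 0 ->
  is_derive x 1 (fun x => \int[mu]_(t in `]-oo, x]) normal_pdf 0 s t)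
    (normal_pdf 0 s x).
Proof.
move=> s0.
have [d1 d2] : derivable (fun x => \int[mu]_(t in `]-oo, x]) normal_pdf 0 s t) x 1 /\
  derive1 (fun x => \int[mu]_(t in `]-oo, x]) normal_pdf 0 s t) x = normal_pdf 0 s x.
  apply: (@continuous_FTC1 _ _ _ _ (x + 1)) => //.
  - by rewrite ltrDl.
  - apply: (integrableS _ _ (subsetT _)) => //; exact: integrable_normal_pdf.
  - exact: ltNyr.
  - exact: continuous_normal_pdf.
by apply: DeriveDef; [exact: d1 | rewrite -derive1E; exact: d2].
Qed.

Lemma is_derive_Phi x : is_derive x 1 (fun x => Phi x%:E) (phi x).
Proof.
rewrite (_ : (fun x => Phi x%:E) = fun x => \int[mu]_(t in `]-oo, x]) phi t).
  by apply: is_derive_Rint_normal; exact: oner_neq0.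
by apply/funext => y; rewrite Phi_Rint.
Qed.

Lemma Phi_lt x y : x < y -> Phi x%:E < Phi y%:E.
Proof.
move=> xy.
have [c cxy h] : exists2 c, c \in `]x, y[%R & Phi y%:E - Phi x%:E = phi c * (y - x).
  apply: (@MVT _ (fun x => Phi x%:E)) => // [z _|]; first exact: is_derive_Phi.
  by apply: derivable_within_continuous => z _; case: (is_derive_Phi z).
by rewrite -subr_gt0 h mulr_gt0 ?phi_gt0// subr_gt0.
Qed.

Lemma Phi_le x y : (Phi x%:E <= Phi y%:E) = (x <= y).
Proof.
have [xy|xy] := leP x y; last by rewrite leNgt Phi_lt.
by move: xy; rewrite le_eqVlt => /predU1P[->|/Phi_lt/ltW//]; exact: lexx.
Qed.

Lemma Phi_prob x : (Phi x%:E)%:E = normal_prob (0 : R) 1 `]-oo, x].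
Proof.
rewrite /Phi fineK ?fin_num_measure//; last first.
  rewrite (_ : [set y | _] = `]-oo, x]%classic)//.
Qed.

Lemma Phi_ge0 x : 0 <= Phi x%:E.
Proof. by rewrite /Phi fine_ge0. Qed.

Lemma Phi_le1 x : Phi x%:E <= 1.
Proof. by rewrite -lee_fin Phi_prob probability_le1. Qed.

Lemma continuous_Phi : continuous (fun x => Phi x%:E).
Proof.
move=> x; apply: differentiable_continuous; apply/derivable1_diffP.
by case: (is_derive_Phi x).
Qed.

(* The library's [cdf] lemmas ask for a random variable on [measurableTypeR R]. *)
Let id_real : measurableTypeR R -> R := idfun.

HB.instance Definition _ := @isMeasurableFun.Build _ _ _ _ id_real (@measurable_id _ _ setT).

Lemma cvg_normal_cdf_y (s : R) :
  \int[mu]_(t in `]-oo, x]) normal_pdf 0 s t @[x --> +oo] --> (1 : R).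
Proof.
apply: (@fine_cvg _ _ _ _ (fun x => normal_prob 0 s `]-oo, x]) 1).
have := (@cvg_cdfy1 _ _ _ (normal_prob 0 s) (id_real : {RV (normal_prob (0 : R) s) >-> R})).
by apply: cvg_trans; apply: near_eq_cvg; apply: nearW.
Qed.

Lemma cvg_normal_cdf_Ny (s : R) :
  \int[mu]_(t in `]-oo, x]) normal_pdf 0 s t @[x --> -oo] --> (0 : R).
Proof.
apply: (@fine_cvg _ _ _ _ (fun x => normal_prob 0 s `]-oo, x]) 0).
have := (@cvg_cdfNy0 _ _ _ (normal_prob 0 s) (id_real : {RV (normal_prob (0 : R) s) >-> R})).
by apply: cvg_trans; apply: near_eq_cvg; apply: nearW.
Qed.

Lemma cvg_Phi_y : Phi x%:E @[x --> +oo] --> (1 : R).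
Proof. by under eq_fun do rewrite Phi_Rint; exact: cvg_normal_cdf_y. Qed.

Lemma cvg_Phi_Ny : Phi x%:E @[x --> -oo] --> (0 : R).
Proof. by under eq_fun do rewrite Phi_Rint; exact: cvg_normal_cdf_Ny. Qed.

Lemma Phi_lt1 x : Phi x%:E < 1.
Proof. by rewrite (lt_le_trans _ (Phi_le1 (x + 1)))// Phi_lt// ltrDl. Qed.

(** The two sides have the same derivative and both vanish at minus infinity, so their constant
    difference [D] is 0; this takes the place of a change of variables. *)
Lemma normal_cdf_scale (s x : R) : 0 < s ->
  \int[mu]_(t in `]-oo, x]) normal_pdf 0 s t = Phi (x / s)%:E.
Proof.
move=> s0; have s0' : s != 0 by rewrite gt_eqF.
pose D y := \int[mu]_(t in `]-oo, y]) normal_pdf 0 s t - Phi (y / s)%:E.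
have D0 y : is_derive y 1 D 0.
  have h1 := is_derive_Rint_normal y s0'.
  have h2 : is_derive y 1 (fun y => Phi (y / s)%:E) (s^-1 * phi (y / s)).
    have h := is_derive_Phi (y / s).
    have h' : is_derive y (1 : R) (fun y : R => y / s) s^-1.
      by apply: is_derive_eq; rewrite /GRing.scale/=; ring.
    by have := @is_derive1_comp _ (fun x => Phi x%:E) (fun y => y / s) y _ _ h h'; rewrite mulrC.
  rewrite /D; apply: is_derive_eq.
  rewrite phiE normal_pdfE// /normal_fun subr0 /normal_peak expr1n mul1r.
  rewrite -mulr_natr -[X in Num.sqrt X]mulrA sqrtrM ?sqr_ge0// sqrtr_sqr gtr0_norm//
    -[pi *+ 2]mulr_natr.
  rewrite invfM mulrA [_ / s]mulrC; apply/eqP; rewrite subr_eq0; apply/eqP.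
  by congr (_ * expR _); field.
have Dc y z : D y = D z.
  apply/eqP; rewrite -subr_eq0 -normr_le0.
  by rewrite (le_trans (mvt_boundT _ _ D0 (B := 0) _))// ?mul0r// => ?; rewrite normr0.
have DNy : D y @[y --> -oo] --> (0 : R).
  rewrite -[X in _ --> X](subr0 0); apply: cvgB; first exact: cvg_normal_cdf_Ny.
  apply: (@cvg_comp _ _ _ (fun y => y / s) (fun y => Phi y%:E) _ (-oo)); last exact: cvg_Phi_Ny.
  by apply: gt0_cvgMlNy; [rewrite invr_gt0|exact: cvg_id].
have : D x = 0.
  have h : D y @[y --> -oo] --> D x by under eq_fun do rewrite (Dc _ x); exact: cvg_cst.
  exact: (cvg_unique _ h DNy).
by move/eqP; rewrite subr_eq0 => /eqP.
Qed.

Lemma normal_prob_itv (s x : R) : 0 < s ->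
  normal_prob 0 s `]-oo, x] = (Phi (x / s)%:E)%:E.
Proof.
move=> s0; rewrite -normal_cdf_scale// /Rintegral fineK//.
exact: (@fin_num_measure _ _ _ (normal_prob 0 s)).
Qed.

(* [gauss_smooth C y] is the law of [N(0, C)] evaluated at [`]-oo, y]]; it solves the heat equation
   [dC = dyy / 2], which is what makes Lindeberg's replacement telescope without any convolution. *)
Definition gauss_smooth (C y : R) := Phi (y / Num.sqrt C)%:E.
Definition gauss_smooth1 (C y : R) := phi (y / Num.sqrt C) / Num.sqrt C.
Definition gauss_smooth2 (C y : R) := dphi (y / Num.sqrt C) / C.
Definition gauss_smooth3 (C y : R) := ddphi (y / Num.sqrt C) / (C * Num.sqrt C).

Lemma is_derive_scale_comp (f df : R -> R) (th y : R) : is_derive (y * th) 1 f (df (y * th)) ->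
  is_derive y 1 (fun y => f (y * th)) (df (y * th) * th).
Proof.
move=> h; have h' : is_derive y (1 : R) (fun y : R => y * th) th.
  by apply: is_derive_eq; rewrite /GRing.scale/=; ring.
exact: (@is_derive1_comp _ f (fun y => y * th) y _ _ h h').
Qed.

Lemma is_derive_smooth0 (C y : R) : 0 < C -> is_derive y 1 (gauss_smooth C) (gauss_smooth1 C y).
Proof. by move=> C0; exact: is_derive_scale_comp (is_derive_Phi _). Qed.

Lemma is_derive_smooth1 (C y : R) : 0 < C -> is_derive y 1 (gauss_smooth1 C) (gauss_smooth2 C y).
Proof.
move=> C0; have h := is_derive_scale_comp (is_derive_phi (y / Num.sqrt C)).
rewrite /gauss_smooth1; apply: is_derive_eq; rewrite /GRing.scale/= /gauss_smooth2.
have e : C^-1 = (Num.sqrt C)^-1 * (Num.sqrt C)^-1 by rewrite -invfM -expr2 sqr_sqrtr// ltW.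
by rewrite e; ring.
Qed.

Lemma is_derive_smooth2 (C y : R) : 0 < C -> is_derive y 1 (gauss_smooth2 C) (gauss_smooth3 C y).
Proof.
move=> C0; have h := is_derive_scale_comp (is_derive_dphi (y / Num.sqrt C)).
rewrite /gauss_smooth2; apply: is_derive_eq; rewrite /GRing.scale/= /gauss_smooth3.
by field; rewrite !gt_eqF// sqrtr_gt0.
Qed.

Lemma is_derive_div_sqrt (C y : R) : 0 < C ->
  is_derive C 1 (fun C => y / Num.sqrt C) (- (y / Num.sqrt C) / (2 * C)).
Proof.
move=> C0; have s0 : 0 < Num.sqrt C by rewrite sqrtr_gt0.
have h := is_derive1_sqrt C0.
have h' : is_derive C 1 (fun C => (Num.sqrt C)^-1) (- (Num.sqrt C) ^- 2 *: (2 * Num.sqrt C)^-1).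
  by apply: is_deriveV; rewrite gt_eqF.
apply: is_derive_eq; rewrite /GRing.scale/=.
have e : C^-1 = (Num.sqrt C)^-1 * (Num.sqrt C)^-1 by rewrite -invfM -expr2 sqr_sqrtr// ltW.
rewrite !invfM e; field; rewrite gt_eqF//.
Qed.

Lemma is_derive_smooth_time (C y : R) : 0 < C ->
  is_derive C 1 (gauss_smooth ^~ y) (gauss_smooth2 C y / 2).
Proof.
move=> C0; have h := is_derive_Phi (y / Num.sqrt C).
have := @is_derive1_comp _ (fun x => Phi x%:E) (fun C => y / Num.sqrt C) C _ _ h
  (is_derive_div_sqrt y C0).
move=> h2; apply: is_derive_eq; rewrite /gauss_smooth2 /dphi; field.
by rewrite !gt_eqF ?sqrtr_gt0.
Qed.

(** The mixed derivative, which controls the error of a first-order expansion in the variance. *)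
Lemma is_derive_smooth2_time (C y : R) : 0 < C ->
  is_derive C 1 (gauss_smooth2 ^~ y)
   (- ((y / Num.sqrt C) * ddphi (y / Num.sqrt C) / 2 + dphi (y / Num.sqrt C)) / C ^+ 2).
Proof.
move=> C0; have h := is_derive_dphi (y / Num.sqrt C).
have h1 := @is_derive1_comp _ dphi (fun C => y / Num.sqrt C) C _ _ h (is_derive_div_sqrt y C0).
have h2 : is_derive C (1 : R) (fun C : R => C^-1) (- C ^- 2 *: 1).
  by apply: is_deriveV; rewrite gt_eqF.
rewrite /gauss_smooth2; apply: is_derive_eq; rewrite /GRing.scale/=; field.
by rewrite !gt_eqF ?sqrtr_gt0.
Qed.

Lemma derivable_measurable (f df : R -> R) :
  (forall x : R, is_derive x 1 f (df x)) -> measurable_fun [set: R] f.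
Proof.
move=> fdf; apply: continuous_measurable_fun => x.
by apply: differentiable_continuous; apply/derivable1_diffP; case: (fdf x).
Qed.

Lemma measurable_smooth (C : R) : 0 < C ->
  [/\ measurable_fun [set: R] (gauss_smooth C), measurable_fun [set: R] (gauss_smooth1 C) &
      measurable_fun [set: R] (gauss_smooth2 C)].
Proof.
move=> C0; split; apply: derivable_measurable => x.
- exact: is_derive_smooth0.
- exact: is_derive_smooth1.
- exact: is_derive_smooth2.
Qed.

Lemma dphi_ddphi_bounded u :
  [/\ phi u <= 17 * normal_peak 1, `|dphi u| <= 17 * normal_peak 1,
      `|ddphi u| <= 34 * normal_peak 1 & `|u * ddphi u| <= 34 * normal_peak 1].
Proof.
have b n (n4 : (n <= 4)%N) := pow_phi_bounded u n4.
have p0 := phi_gt0 u.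
have := b 0 isT; have := b 1 isT; have := b 2 isT; have := b 3 isT.
rewrite expr0 expr1 mul1r => b3 b2 b1 b0; split => //.
- by rewrite normrN normrM (gtr0_norm p0).
- rewrite normrM (gtr0_norm p0) (le_trans (ler_wpM2r (ltW p0) (ler_normB _ _)))//.
  by rewrite normr1 normrX mulrDl mul1r; lra.
- rewrite mulrA normrM (gtr0_norm p0) mulrBr mulr1 -exprS.
  rewrite (le_trans (ler_wpM2r (ltW p0) (ler_normB _ _)))//.
  by rewrite normrX mulrDl; lra.
Qed.

(** Each quantity is a bounded function of [y / Num.sqrt C] times a negative power of [C], largest
    at [C = c]; [p] dominates the four numerators, and the constant is the sum of the four values at
    [c]. *)
Lemma smooth_bounded (c : R) : 0 < c -> exists K : R, 0 < K /\ forall C y : R, c <= C ->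
  [/\ `|gauss_smooth1 C y| <= K, `|gauss_smooth2 C y| <= K, `|gauss_smooth3 C y| <= K &
    `|- ((y / Num.sqrt C) * ddphi (y / Num.sqrt C) / 2 + dphi (y / Num.sqrt C)) / C ^+ 2| <= K].
Proof.
move=> c0; have sc0 : 0 < Num.sqrt c by rewrite sqrtr_gt0.
set p := 34 * (normal_peak 1 : R); have p0 : 0 < p by rewrite mulr_gt0// normal_peak_gt0//
  oner_neq0.
exists (p / Num.sqrt c + p / c + p / (c * Num.sqrt c) + p / c ^+ 2).
have h1 : 0 < p / Num.sqrt c by rewrite divr_gt0.
have h2 : 0 < p / c by rewrite divr_gt0.
have h3 : 0 < p / (c * Num.sqrt c) by rewrite divr_gt0// mulr_gt0.
have h4 : 0 < p / c ^+ 2 by rewrite divr_gt0// exprn_gt0.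
split => [|C y cC]; first by rewrite !addr_gt0.
have C0 : 0 < C by exact: lt_le_trans cC.
have sC0 : 0 < Num.sqrt C by rewrite sqrtr_gt0.
have sC : Num.sqrt c <= Num.sqrt C by rewrite ler_wsqrtr.
have [b0 b1 b2 b3] := dphi_ddphi_bounded (y / Num.sqrt C).
have p17 : 17 * normal_peak 1 <= p.
  by rewrite ler_wpM2r ?normal_peak_ge0// ler_nat.
have gen (N D E : R) : `|N| <= p -> 0 < D -> D <= E -> `|N / E| <= p / D.
  move=> Np D0 DE; rewrite normrM normfV (gtr0_norm (lt_le_trans D0 DE)).
  by apply: ler_pM; rewrite ?invr_ge0 ?(ltW (lt_le_trans D0 DE))// lef_pV2// posrE (lt_le_trans D0).
split.
- apply: le_trans (gen _ _ _ _ sc0 sC) _; last by lra.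
  by rewrite gtr0_norm ?phi_gt0// (le_trans b0).
- apply: le_trans (gen _ _ _ _ c0 cC) _; last by lra.
  exact: le_trans p17.
- apply: le_trans (gen _ (c * Num.sqrt c) _ b2 _ _) _; [by rewrite mulr_gt0|by rewrite ler_pM//
  ltW|lra].
- apply: le_trans (gen _ (c ^+ 2) _ _ _ _) _; [|by rewrite exprn_gt0|by rewrite lerXn2r//
  nnegrE ltW|lra].
  rewrite normrN (le_trans (ler_normD _ _))// normrM (_ : `|2^-1| = 2^-1 :> R);
    last by rewrite ger0_norm.
  by move: b1 b3; rewrite /p; lra.
Qed.

(** Each remainder in space has as derivative the remainder for the next derivative, so repeated
    mean value inequalities replace Taylor's formula. The last clause is first order in the
    variance, with the time derivative replaced by [gauss_smooth2 / 2] through the heat equation. *)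
Lemma smooth_taylor (c : R) : 0 < c -> exists K : R, 0 < K /\ forall C y : R, c <= C ->
  [/\ `|gauss_smooth1 C y| <= K /\ `|gauss_smooth2 C y| <= K,
      forall u, `|gauss_smooth2 C (y + u) - gauss_smooth2 C y| <= K * `|u|,
      forall u, `|gauss_smooth1 C (y + u) - gauss_smooth1 C y - u * gauss_smooth2 C y| <= K * `|u|
        ^+ 2,
      forall u, `|gauss_smooth C (y + u) - gauss_smooth C y - u * gauss_smooth1 C y
                   - u ^+ 2 / 2 * gauss_smooth2 C y| <= K * `|u| ^+ 3 &
      forall C', c <= C' ->
        `|gauss_smooth C' y - gauss_smooth C y - (C' - C) / 2 * gauss_smooth2 C y| <= K * `|C' - C|
          ^+ 2].
Proof.
move=> c0; have [K [K0 HK]] := smooth_bounded c0.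
exists K; split => // C y cC; have C0 : 0 < C by exact: lt_le_trans cC.
have btw (u z : R) : Num.min 0 u <= z <= Num.max 0 u -> `|z| <= `|u|.
  by have [u0|u0] := leP 0 u; move=> /andP[z1 z2]; rewrite ?(ger0_norm u0) ?(ltr0_norm u0)
    ler_norml; lra.
have shift (f df : R -> R) (z : R) : (forall x : R, is_derive x 1 f (df x)) ->
    is_derive z 1 (fun t => f (y + t)) (df (y + z)).
  move=> h; have h1 := h (y + z).
  have h' : is_derive z (1 : R) (fun t : R => y + t) 1.
    by apply: is_derive_eq; rewrite /GRing.scale/=; ring.
  by have := @is_derive1_comp _ f (fun t => y + t) z _ _ h1 h'; rewrite mulr1.
have T2 u : `|gauss_smooth2 C (y + u) - gauss_smooth2 C y| <= K * `|u|.
  rewrite -{2}(addrK y u) [u + y]addrC; apply: mvt_boundT => z; first exact: is_derive_smooth2.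
  by have [] := HK C z cC.
have T1 u : `|gauss_smooth1 C (y + u) - gauss_smooth1 C y - u * gauss_smooth2 C y| <= K * `|u| ^+ 2.
  have := @mvt_bound (fun t => gauss_smooth1 C (y + t) - t * gauss_smooth2 C y)
    (fun t => gauss_smooth2 C (y + t) - gauss_smooth2 C y) (K * `|u|) 0 u.
  rewrite addr0 mul0r !subr0 (_ : K * `|u| ^+ 2 = K * `|u| * `|u|); last by ring.
  rewrite [X in `|X| <= _](_ : _ = gauss_smooth1 C (y + u) - gauss_smooth1 C y - u * gauss_smooth2
    C y); last by ring.
  apply.
    move=> z _; have h := shift _ _ z (fun x => is_derive_smooth1 x C0).
    by apply: is_derive_eq; rewrite /GRing.scale/=; ring.
  by move=> z /btw zu; rewrite (le_trans (T2 z))// ler_pM2l.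
split => //.
- by have [? ?] := HK C y cC.
- move=> u.
  have := @mvt_bound (fun t => gauss_smooth C (y + t) - t * gauss_smooth1 C y - t ^+ 2 / 2 *
    gauss_smooth2 C y)
    (fun t => gauss_smooth1 C (y + t) - gauss_smooth1 C y - t * gauss_smooth2 C y) (K * `|u| ^+ 2)
      0 u.
  rewrite addr0 expr0n/= !mul0r !subr0 -[K * _ * _]mulrA -exprSr.
  rewrite [X in `|X| <= _](_ : _ = gauss_smooth C (y + u) - gauss_smooth C y - u * gauss_smooth1 C
    y - u ^+ 2 / 2 * gauss_smooth2 C y); last by ring.
  apply.
    move=> z _; have h := shift _ _ z (fun x => is_derive_smooth0 x C0).
    by apply: is_derive_eq; rewrite /GRing.scale/=; field.
  by move=> z /btw zu; rewrite (le_trans (T1 z))// ler_pM2l// lerXn2r// nnegrE.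
- move=> C' cC'.
  have pos z : Num.min C C' <= z <= Num.max C C' -> c <= z /\ `|z - C| <= `|C' - C|.
    have [u0|u0] := leP C C'; move=> /andP[z1 z2]; split; try lra.
      by rewrite !ger0_norm; lra.
    by rewrite !ler0_norm; lra.
  have T2' z : Num.min C C' <= z <= Num.max C C' -> `|gauss_smooth2 z y - gauss_smooth2 C y| <= K *
    `|C' - C|.
    move=> zC; have [cz zC'] := pos z zC.
    apply: le_trans (_ : K * `|z - C| <= _); last by rewrite ler_pM2l.
    have pos' t : Num.min C z <= t <= Num.max C z -> c <= t.
      by have [u0|u0] := leP C z; move=> /andP[z1 z2]; lra.
    apply: (@mvt_bound (gauss_smooth2 ^~ y) (fun C => - ((y / Num.sqrt C) * ddphi (y / Num.sqrt C)
      / 2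
      + dphi (y / Num.sqrt C)) / C ^+ 2)) => t /pos' ct.
      by apply: is_derive_smooth2_time; exact: lt_le_trans ct.
    by have [] := HK t y ct.
  have := @mvt_bound (fun t => gauss_smooth t y - t / 2 * gauss_smooth2 C y)
    (fun t => (gauss_smooth2 t y - gauss_smooth2 C y) / 2) (K * `|C' - C|) C C'.
  rewrite [X in `|X| <= _](_ : _ = gauss_smooth C' y - gauss_smooth C y - (C' - C) / 2 *
    gauss_smooth2 C y); last by ring.
  rewrite (_ : K * `|C' - C| ^+ 2 = K * `|C' - C| * `|C' - C|); last by ring.
  apply.
    move=> z /pos [cz _]; have h := is_derive_smooth_time y (lt_le_trans c0 cz).
    by apply: is_derive_eq; rewrite /GRing.scale/=; field.
  move=> z /T2' h; rewrite normrM (_ : `|2^-1| = 2^-1 :> R); last by rewrite ger0_norm.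
  have := normr_ge0 (gauss_smooth2 z y - gauss_smooth2 C y); lra.
Qed.

End normal_calculus.

(** * Lindeberg's method for mixing rows *)

Section sub_sigma_measurable.
Context d (T : measurableType d) (R : realType).

(** Giving [T] the generated sigma-algebra as its measurable structure turns measurability with
    respect to the past or the future of a row into plain [measurable_fun], with its closure
    properties. *)
Definition gen_by {d'} {E : measurableType d'} (I : Type) (J : set I) (X : I -> T -> E) :=
  g_sigma_algebraType (\bigcup_(i in J) preimage_set_system [set: T] (X i) measurable).

Definition sm {d'} {E : measurableType d'} (I : Type) (J : set I) (X : I -> T -> E) (f : T -> R) :=
  measurable_fun [set: gen_by J X] (f : gen_by J X -> R).

Context d' (E : measurableType d') (I : Type) (X : I -> T -> E).

Lemma sm_preimage J f Y : sm J X f -> measurable Y -> sigma_of J X (f @^-1` Y).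
Proof.
move=> mf mY; have := mf measurableT Y mY; rewrite setTI; exact.
Qed.

Lemma sm_cst J c : sm J X (fun=> c).
Proof. exact: measurable_cst. Qed.

Lemma smD J f g : sm J X f -> sm J X g -> sm J X (fun x => f x + g x).
Proof. exact: measurable_funD. Qed.

Lemma smB J f g : sm J X f -> sm J X g -> sm J X (fun x => f x - g x).
Proof. exact: measurable_funB. Qed.

Lemma smM J f g : sm J X f -> sm J X g -> sm J X (fun x => f x * g x).
Proof. exact: measurable_funM. Qed.

Lemma sm_comp J (h : R -> R) f : measurable_fun [set: R] h -> sm J X f -> sm J X (fun x => h (f x)).
Proof. by move=> mh mf; exact: measurableT_comp mh mf. Qed.

Lemma sm_sum J (K : eqType) (s : seq K) (F : K -> T -> R) :
  (forall i, i \in s -> sm J X (F i)) -> sm J X (fun x => \sum_(i <- s) F i x).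
Proof.
elim: s => [|i s ih] H.
  by under eq_fun do rewrite big_nil; exact: sm_cst.
under eq_fun do rewrite big_cons; apply: smD; first by apply: H; rewrite mem_head.
by apply: ih => j js; apply: H; rewrite inE js orbT.
Qed.

Lemma sm_coord (J : set I) i (h : E -> R) : J i -> measurable_fun [set: E] h -> sm J X (fun x =>
  h (X i x)).
Proof.
move=> Ji mh _ Y mY; rewrite setTI; apply: sub_sigma_algebra.
exists i => //; exists (h @^-1` Y); last by rewrite setTI.
by rewrite -[X in measurable X]setTI; exact: mh.
Qed.

Lemma sm_measurable J f : (forall i, J i -> measurable_fun [set: T] (X i)) -> sm J X f ->
  measurable_fun [set: T] f.
Proof.
move=> mX mf _ Y mY; rewrite setTI.
have : sigma_of J X (f @^-1` Y) by exact: sm_preimage.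
apply: smallest_sub; first exact: sigma_algebra_measurable.
by move=> _ [i Ji [B mB <-]]; exact: mX.
Qed.

End sub_sigma_measurable.

Lemma ler_sum4 (R : realType) (x1 x2 x3 x4 b1 b2 b3 b4 : R) :
  x1 <= b1 -> x2 <= b2 -> x3 <= b3 -> x4 <= b4 ->
  x1 + x2 + (x3 + x4) <= b1 + (b2 + b4) + b3.
Proof. lra. Qed.

Section lindeberg_row.
Context d (T : measurableType d) (R : realType) (P : probability T R).

Local Notation bmf := (@bmf _ T R).
Local Notation Er := (Er P).
Local Notation cov := (cov P).

(** The past is the first [n] variables; as [j] counts from 0, [n + dist <= j.+1] says that the
    1-based position is at least [n + dist], as in [alpha]. *)
Definition row_mixing (x : nat -> T -> R) (al : nat -> R) :=
  forall n dist (A B : set T), (0 < n)%N ->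
    sigma_of [set j | (j < n)%N] x A -> sigma_of [set j | (n + dist <= j.+1)%N] x B ->
    `|fine (P (A `&` B)) - fine (P A) * fine (P B)| <= al dist.

Lemma cov_bool (A B : set T) : measurable A -> measurable B ->
  cov \1_A \1_B = fine (P (A `&` B)) - fine (P A) * fine (P B).
Proof.
move=> mA mB; rewrite /cov !Er_indic// -(@Er_indic _ _ _ P (A `&` B)); last exact: measurableI.
by congr (_ - _); apply: eq_Er => x; rewrite indicI.
Qed.

(** [A] pays for lags up to [l], of which there are few, and the small [t] for all longer lags. *)
Variables (x : nat -> T -> R) (al : nat -> R) (delta A t : R) (l : nat).
Hypotheses (delta0 : 0 < delta) (bx : forall i, bmf (x i)) (xd : forall i u, `|x i u| <= delta)
  (Ex0 : forall i, Er (x i) = 0) (al0 : forall n, 0 <= al n) (mix : row_mixing x al)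
  (hA : forall N, \sum_(1 <= k < N) al k <= A) (ht : forall N, \sum_(l.+1 <= k < N) al k <= t).

Lemma mixing_cov n dist f g (p q : R) : (0 < n)%N -> 0 < p -> 0 < q ->
  (forall u, `|f u| <= p) -> (forall u, `|g u| <= q) ->
  sm [set j | (j < n)%N] x f -> sm [set j | (n + dist <= j.+1)%N] x g ->
  `|cov f g| <= 4 * p * q * al dist.
Proof.
move=> n0 p0 q0 fp gq mf mg.
have bf : bmf f.
  by split; [apply: sm_measurable mf => i _; exact: (bx i).1|exists p].
have bg : bmf g.
  by split; [apply: sm_measurable mg => i _; exact: (bx i).1|exists q].
apply: cov_mixing => // s s'.
have ray (h : T -> R) (r : R) : [set u | (r < h u)%R] = h @^-1` `]r, +oo[.
  by apply/seteqP; split => u /=; rewrite in_itv/= andbT.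
have e (h : T -> R) (r : R) : (fun u => (r < h u)%R%:R : R) = \1_[set u | (r < h u)%R].
  apply/funext => u; rewrite indicE; congr (nat_of_bool _)%:R.
  by apply/idP/idP => [h1|/set_mem//]; rewrite inE.
have mray (h : T -> R) (r : R) : bmf h -> measurable [set u | (r < h u)%R].
  by move=> [mh _]; rewrite ray -[X in measurable X]setTI; exact: mh.
rewrite !e cov_bool; [|exact: mray|exact: mray].
by apply: (mix n0); rewrite ray; apply: sm_preimage.
Qed.

Definition psum n u := \sum_(0 <= j < n) x j u.
Definition psumv n := Er (fun u => psum n u ^+ 2).

Lemma psumS n u : psum n.+1 u = psum n u + x n u.
Proof. by rewrite /psum big_nat_recr. Qed.

Lemma bmf_psum n : bmf (psum n).
Proof. exact: bmf_sum. Qed.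

Lemma psum_diff_le n k u : (k <= n)%N -> `|psum n u - psum k u| <= (n - k)%:R * delta.
Proof.
move=> kn; rewrite -(subnKC kn); elim: (n - k)%N => [|p ih].
  by rewrite addn0 subrr normr0 mulr_ge0// ltW.
rewrite addnS psumS addrAC (le_trans (ler_normD _ _))//.
move: ih; rewrite !addKn subSn ?leq_addr// addKn -natr1 mulrDl mul1r => ih.
by rewrite lerD.
Qed.

Lemma sm_psum n (J : set nat) k : (forall j, (k <= j < n)%N -> J j) -> (k <= n)%N ->
  sm J x (fun u => psum n u - psum k u).
Proof.
move=> H kn; rewrite (_ : (fun _ => _) = fun u => \sum_(k <= j < n) x j u); last first.
  by apply/funext => u; rewrite /psum (big_cat_nat (leq0n k) kn)//= addrAC subrr add0r.
apply: sm_sum => j; rewrite mem_index_iota => /H Jj.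
by apply: (@sm_coord _ _ _ _ _ _ x J j id); [exact: Jj|exact: measurable_id].
Qed.

Lemma sm_psum0 n (J : set nat) : (forall j, (j < n)%N -> J j) -> sm J x (psum n).
Proof.
move=> H; have := @sm_psum n J 0 _ (leq0n _).
rewrite (_ : (fun _ => _) = psum n); first by apply => j /andP[_]; exact: H.
by apply/funext => u; rewrite /psum [X in _ - X]big_geq// subr0.
Qed.

Definition rate i n := \sum_(0 <= j < n) al (i - j).

Lemma rateE i n : (n <= i)%N -> rate i n = \sum_((i - n).+1 <= k < i.+1) al k.
Proof.
rewrite /rate; elim: n => [|n ih] ni; first by rewrite big_geq// subn0 big_geq.
rewrite big_nat_recr//= ih ?(ltnW ni)// [in RHS]big_ltn; last by lia.
by rewrite addrC subnSK.
Qed.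

Lemma sum_al_le p k N : (p <= k)%N -> \sum_(k <= j < N) al j <= \sum_(p <= j < N) al j.
Proof.
move=> pk; have [kN|Nk] := leqP k N; last by rewrite big_geq ?(ltnW Nk)// sumr_ge0.
by rewrite (big_cat_nat pk kN)//= lerDr sumr_ge0.
Qed.

Lemma rate_le_A i n : (n <= i)%N -> rate i n <= A.
Proof. by move=> ni; rewrite rateE// (le_trans _ (hA i.+1))// sum_al_le. Qed.

Lemma rate_le_t i n : (n + l <= i)%N -> rate i n <= t.
Proof.
move=> ni; rewrite rateE ?(leq_trans (leq_addr _ _) ni)//.
by rewrite (le_trans _ (ht i.+1))// sum_al_le// ltnS leq_subRL ?(leq_trans (leq_addr _ _) ni).
Qed.

Lemma t_ge0 : 0 <= t.
Proof. by apply: le_trans (ht 0); rewrite big_geq. Qed.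

Lemma A_ge0 : 0 <= A.
Proof. by apply: le_trans (hA 0); rewrite big_geq. Qed.

Lemma rate_lag i : rate i (i - l) <= t.
Proof.
have [li|il] := leqP l i; first by rewrite rate_le_t// subnK.
(* Here [i - l] is truncated to 0, so the rate is an empty sum. *)
by move: (ltnW il); rewrite -subn_eq0 /rate => /eqP ->; rewrite big_geq// t_ge0.
Qed.

Section telescoping.
Variables (a L : R) (f : R -> R).
Hypotheses (L0 : 0 < L) (mf : measurable_fun [set: R] f)
  (fL : forall y u, `|f (y + u) - f y| <= L * `|u|).

Lemma bmf_lip n : bmf (fun u => f (a + psum n u)).
Proof.
have m1 : measurable_fun [set: T] (fun u => a + psum n u).
  by apply: measurable_funD; [exact: measurable_cst|exact: (bmf_psum n).1].
split; first exact: measurableT_comp mf m1.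
exists (`|f a| + L * (n%:R * delta)) => u.
rewrite -[f (_ + _)](subrK (f a)) addrC (le_trans (ler_normD _ _))// lerD2l.
rewrite (le_trans (fL _ _))// ler_pM2l//.
have := @psum_diff_le n 0 u (leq0n _); rewrite subn0.
by rewrite [X in _ - X](_ : _ = 0) ?subr0// /psum big_geq.
Qed.

(* Replacing [f (psum n)] by the sum of its increments makes the factor [al (i - j)] appear, so that
   the total is a convergent series and not [n] times a mixing rate. *)
Lemma telescoping_cov n i : (n <= i)%N ->
  `|Er (fun u => f (a + psum n u) * x i u)| <= 4 * L * delta ^+ 2 * rate i n.
Proof.
elim: n => [|n ih] ni.
  rewrite (_ : Er _ = 0); first by rewrite normr0 !mulr_ge0 ?exprn_ge0 ?(ltW L0)// ?(ltW delta0)//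
    /rate big_geq.
  rewrite -[RHS](mulr0 (f a)) -(Ex0 i) -ErZ//.
  by apply: eq_Er => u; rewrite /psum big_geq// addr0.
have bD : bmf (fun u => f (a + psum n.+1 u) - f (a + psum n u)) by apply: bmfB; exact: bmf_lip.
(* As [x i] is centered, the new increment contributes a covariance, to which mixing at lag [i - n]
   applies. *)
have -> : Er (fun u => f (a + psum n.+1 u) * x i u) =
    cov (fun u => f (a + psum n.+1 u) - f (a + psum n u)) (x i) + Er (fun u =>
      f (a + psum n u) * x i u).
  rewrite /cov Ex0 mulr0 subr0 -ErD; last 2 first.
    - exact: bmfM.
    - by apply: bmfM => //; exact: bmf_lip.
  by apply: eq_Er => u; rewrite mulrBl subrK.
rewrite (le_trans (ler_normD _ _))// /rate big_nat_recr//= mulrDr addrC lerD//; first exact/ih/ltnW.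
apply: le_trans (_ : 4 * (L * delta) * delta * al (i - n) <= _); last by rewrite expr2 !mulrA.
apply: (@mixing_cov n.+1) => //; first exact: mulr_gt0.
- by move=> u; rewrite psumS addrA (le_trans (fL _ _))// ler_pM2l.
- apply: smB; apply: sm_comp => //; apply: smD; try exact: sm_cst; apply: sm_psum0 => j //=.
  by move=> jn; rewrite ltnS ltnW.
- apply: (@sm_coord _ _ _ _ _ _ x _ i id); [rewrite /=; lia|exact: measurable_id].
Qed.

End telescoping.

Lemma Er_psum_x n i : (n <= i)%N ->
  `|Er (fun u => psum n u * x i u)| <= 4 * delta ^+ 2 * rate i n.
Proof.
move=> ni; have := @telescoping_cov 0 1 id ltr01 (@measurable_id _ _ _) _ n i ni.
rewrite mulr1; under eq_Er do rewrite add0r.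
by apply=> y u; rewrite addrC addKr mul1r.
Qed.

(** The increment carries the cross term with the whole past; it is this, not the variance of [x i]
    alone, that the second-order terms of one replacement step reproduce. *)
Lemma psumvS i : psumv i.+1 - psumv i = Er (fun u => x i u ^+ 2) + 2 * Er (fun u =>
  psum i u * x i u).
Proof.
rewrite /psumv -ErZ; last by apply: bmfM => //; exact: bmf_psum.
rewrite -ErB; try by apply: bmfX; exact: bmf_psum.
rewrite -ErD; [|exact: bmfX|by apply: bmfZ; apply: bmfM => //; exact: bmf_psum].
by apply: eq_Er => u; rewrite psumS; ring.
Qed.

Lemma x2_le i u : `|x i u ^+ 2| <= delta ^+ 2.
Proof. by rewrite normrX lerXn2r// nnegrE// ltW. Qed.

Lemma psumvS_le i : `|psumv i.+1 - psumv i| <= delta ^+ 2 * (1 + 8 * A).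
Proof.
rewrite psumvS (le_trans (ler_normD _ _))// mulrDr mulr1 lerD//.
  by apply: norm_Er_le; [exact: bmfX|exact: x2_le].
rewrite normrM ger0_norm//.
have := Er_psum_x (leqnn i); have := rate_le_A (leqnn i) => h1 h2.
have d2 : 0 <= delta ^+ 2 by rewrite sqr_ge0.
have := ler_wpM2l d2 h1; lra.
Qed.

(** Dependence can make the partial variances decrease, but only through cross terms between the
    first [n] variables and later ones: at most [l] later indices are close to [n] and cost [A], the
    others cost [t]. *)
Lemma psumv_incr_ge n m : (n <= m)%N ->
  - (8 * delta ^+ 2 * (l%:R * A + m%:R * t)) <= psumv m - psumv n.
Proof.
move=> nm.
have d2 : 0 <= delta ^+ 2 by rewrite sqr_ge0.
have bS n' := bmf_psum n'.
have -> : psumv m - psumv n = Er (fun u => (psum m u - psum n u) ^+ 2) +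
    2 * Er (fun u => psum n u * (psum m u - psum n u)).
  rewrite /psumv -ErB; try exact: bmfX.
  rewrite -ErZ; last by apply: bmfM => //; exact: bmfB.
  rewrite -ErD; [|by apply: bmfX; exact: bmfB|by apply: bmfZ; apply: bmfM => //; exact: bmfB].
  by apply: eq_Er => u; ring.
have h1 : 0 <= Er (fun u => (psum m u - psum n u) ^+ 2) by apply: Er_ge0 => u; exact: sqr_ge0.
suff : `|Er (fun u => psum n u * (psum m u - psum n u))| <= 4 * delta ^+ 2 * (l%:R * A + m%:R * t).
  rewrite ler_norml => /andP[]; lra.
have -> : Er (fun u => psum n u * (psum m u - psum n u)) = \sum_(n <= i < m) Er (fun u =>
  psum n u * x i u).
  rewrite -Er_sum; last by move=> i; exact: bmfM.
  apply: eq_Er => u; rewrite -mulr_sumr; congr (_ * _).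
  by rewrite /psum (big_cat_nat (leq0n n) nm)//= addrAC subrr add0r.
rewrite (le_trans (ler_norm_sum _ _ _))//.
apply: le_trans (_ : \sum_(n <= i < m) 4 * delta ^+ 2 * ((i < n + l)%N%:R * A + t) <= _).
  rewrite big_seq [leRHS]big_seq; apply: ler_sum => i; rewrite mem_index_iota => /andP[ni im].
  rewrite (le_trans (Er_psum_x ni))// ler_wpM2l ?mulr_ge0 ?(ltW delta0)//.
  have [il|il] := ltnP i (n + l); first by rewrite mul1r (le_trans (rate_le_A ni))// lerDl t_ge0.
  by rewrite mul0r add0r rate_le_t.
rewrite -mulr_sumr ler_wpM2l ?mulr_ge0 ?(ltW delta0)// big_split/= lerD//.
  rewrite -mulr_suml ler_wpM2r ?A_ge0// -natr_sum ler_nat.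
  rewrite -big_mkcond/= sum1_count.
  have : (count (fun i => (i < n + l)%N) (index_iota n m) <= size (iota n l))%N.
    rewrite -size_filter; apply: uniq_leq_size; first by rewrite filter_uniq// iota_uniq.
    by move=> i; rewrite mem_filter mem_iota mem_index_iota => /andP[-> /andP[-> _]].
  by rewrite size_iota.
rewrite sumr_const_nat -[leLHS]mulr_natl ler_wpM2r ?t_ge0// ler_nat; exact: leq_subr.
Qed.

Lemma bmf_smooth (h : R -> R) (K a : R) n : measurable_fun [set: R] h -> (forall y, `|h y| <= K) ->
  bmf (fun u => h (a + psum n u)).
Proof.
move=> mh hK; apply: bmf_comp => //; first by exists K.
by apply: measurable_funD; [exact: measurable_cst|exact: (bmf_psum n).1].
Qed.

Section step.
Variables (c K a eps : R) (m : nat).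
Hypotheses (c0 : 0 < c) (K0 : 0 < K)
  (HK : forall C y : R, c <= C ->
  [/\ `|gauss_smooth1 C y| <= K /\ `|gauss_smooth2 C y| <= K,
      forall u, `|gauss_smooth2 C (y + u) - gauss_smooth2 C y| <= K * `|u|,
      forall u, `|gauss_smooth1 C (y + u) - gauss_smooth1 C y - u * gauss_smooth2 C y| <= K * `|u|
        ^+ 2,
      forall u, `|gauss_smooth C (y + u) - gauss_smooth C y - u * gauss_smooth1 C y
                   - u ^+ 2 / 2 * gauss_smooth2 C y| <= K * `|u| ^+ 3 &
      forall C', c <= C' ->
        `|gauss_smooth C' y - gauss_smooth C y - (C' - C) / 2 * gauss_smooth2 C y| <= K * `|C' - C|
          ^+ 2])
  (H1 : forall C y u : R, c <= C -> `|gauss_smooth1 C (y + u) - gauss_smooth1 C y| <= K * `|u|).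

(** In order: the cubic remainder in space; the quadratic remainder in variance; moving the first
    derivative back to [i - l] and its correction to [i - 2 * l]; moving the second derivative to
    [i - 2 * l]; two expectations that are small by the decay beyond lag [l]; the covariance across
    the gap. *)
Definition step_error :=
  K * delta ^+ 3 + K * (delta ^+ 2 * (1 + 8 * A)) ^+ 2 + 2 * K * l%:R ^+ 2 * delta ^+ 3 +
  (delta ^+ 2 + delta ^+ 2 * (1 + 8 * A)) * K * (l%:R * delta) +
  8 * K * delta ^+ 2 * t + 4 * K * (l.+1%:R * delta ^+ 2) * al l.+1.

(** The main terms are [g1] at [i - l] against [x i], and [g2] at [i - 2 * l] against [Z - v / 2].
    The window [Z] involves no variable before [i - l], so the second gap separates it from [g2],
    and its mean is [v / 2] up to cross terms beyond lag [l]. *)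
Lemma lindeberg_step C i : c <= C -> c <= C - (psumv i.+1 - psumv i) ->
  `|Er (fun u => gauss_smooth (C - (psumv i.+1 - psumv i)) (a + psum i.+1 u))
    - Er (fun u => gauss_smooth C (a + psum i u))| <= step_error.
Proof.
move=> cC cC'; set v := psumv i.+1 - psumv i; set C' := C - v in cC' *.
have C'0 : 0 < C' by exact: lt_le_trans cC'.
have C0 : 0 < C by exact: lt_le_trans cC.
have vb : `|v| <= delta ^+ 2 * (1 + 8 * A) by exact: psumvS_le.
have d2 : 0 <= delta ^+ 2 by rewrite sqr_ge0.
have ld0 : 0 <= l%:R * delta by rewrite mulr_ge0// ltW.
pose g := gauss_smooth C'; pose g1 := gauss_smooth1 C'; pose g2 := gauss_smooth2 C'.
have [mg mg1 mg2] := measurable_smooth C'0.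
have [mgC _ _] := measurable_smooth C0.
have g1K y : `|g1 y| <= K by have [[]] := HK y cC'.
have g2K y : `|g2 y| <= K by have [[]] := HK y cC'.
have gK (CC y : R) : `|gauss_smooth CC y| <= 1 by rewrite ger0_norm ?Phi_ge0// Phi_le1.
pose Y n u := a + psum n u.
pose p := (i - l)%N; pose p' := (i - 2 * l)%N.
pose D u := psum i u - psum p u.
pose Z u := x i u * D u + x i u ^+ 2 / 2.
have bg1 n : bmf (fun u => g1 (Y n u)) by apply: bmf_smooth g1K.
have bg2 n : bmf (fun u => g2 (Y n u)) by apply: bmf_smooth g2K.
have bg n : bmf (fun u => g (Y n u)) by apply: bmf_smooth (gK C').
have bgC n : bmf (fun u => gauss_smooth C (Y n u)) by apply: bmf_smooth (gK C).
have bD : bmf D by apply: bmfB; exact: bmf_psum.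
have bx2 : bmf (fun u => x i u ^+ 2 / 2) by apply: bmfM; [exact: bmfX|exact: bmf_cst].
have bZ : bmf Z by apply: bmfD => //; exact: bmfM.
have pi : (p <= i)%N by rewrite /p; clear; lia.
have p'i : (p' <= i)%N by rewrite /p'; clear; lia.
have p'p : (p' <= p)%N by rewrite /p' /p; clear; lia.
have Dl u : `|D u| <= l%:R * delta.
  rewrite (le_trans (psum_diff_le u pi))// ler_wpM2r ?(ltW delta0)// ler_nat /p; clear; lia.
have Dl2 u : `|psum p u - psum p' u| <= l%:R * delta.
  rewrite (le_trans (psum_diff_le u p'p))// ler_wpM2r ?(ltW delta0)// ler_nat /p /p'; clear; lia.
have Dl3 u : `|psum i u - psum p' u| <= 2 * (l%:R * delta).
  rewrite (le_trans (psum_diff_le u p'i))// mulrA ler_wpM2r ?(ltW delta0)// -natrM ler_nat /p';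
    clear; lia.
(* What is left after removing the main terms; it is bounded pointwise, through the five differences
   [E1] to [E5]. *)
pose Rem u := (g (Y i.+1 u) - gauss_smooth C (Y i u)) - (g1 (Y p u) * x i u + g2 (Y p' u) * (Z u -
  v / 2)).
have RemE u : `|Rem u| <= K * delta ^+ 3 + K * (delta ^+ 2 * (1 + 8 * A)) ^+ 2
    + 2 * K * l%:R ^+ 2 * delta ^+ 3 + (delta ^+ 2 + delta ^+ 2 * (1 + 8 * A)) * K * (l%:R * delta).
  have [_ _ _ e1 e2] := HK (Y i u) cC'.
  have {e1} := e1 (x i u); have {e2} := e2 C cC.
  have [_ _ e3 _ _] := HK (Y p u) cC'; have {e3} := e3 (D u).
  have [_ e4 _ _ _] := HK (Y p' u) cC'.
  have := e4 (psum p u - psum p' u); have {e4} := e4 (psum i u - psum p' u).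
  have shift q r : Y r u + (psum q u - psum r u) = Y q u by rewrite /Y; ring.
  have shiftD : Y p u + D u = Y i u by exact: shift.
  rewrite shiftD !shift.
  have -> : Y i u + x i u = Y i.+1 u by rewrite /Y psumS addrA.
  rewrite (_ : C - C' = v); last by rewrite /C'; ring.
  rewrite -/g -/g1 -/g2.
  set E5 := g2 (Y i u) - g2 (Y p' u); set E4 := g2 (Y p u) - g2 (Y p' u).
  set E3 := g1 (Y i u) - _ - _; set E2 := gauss_smooth C _ - _ - _;
    set E1 := g (Y i.+1 u) - _ - _ - _.
  move=> b5 b4 b3 b2 b1.
  have -> : Rem u = E1 - E2 + (x i u * E3 + x i u * (D u * E4)) + (x i u ^+ 2 / 2 - v / 2) * E5.
    by rewrite /Rem /E1 /E2 /E3 /E4 /E5 /Z; field.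
  have xi := xd i u.
  have {}b1 : `|E1| <= K * delta ^+ 3.
    by rewrite (le_trans b1)// ler_pM2l// lerXn2r// nnegrE// ltW.
  have {}b2 : `|E2| <= K * (delta ^+ 2 * (1 + 8 * A)) ^+ 2.
    by rewrite (le_trans b2)// ler_pM2l// lerXn2r// nnegrE// mulr_ge0// addr_ge0// mulr_ge0// A_ge0.
  have {}b3 : `|x i u * E3| <= delta * (K * (l%:R * delta) ^+ 2).
    by rewrite normrM ler_pM// (le_trans b3)// ler_pM2l// lerXn2r// nnegrE.
  have {}b4 : `|x i u * (D u * E4)| <= delta * (l%:R * delta * (K * (l%:R * delta))).
    by rewrite !normrM ler_pM ?mulr_ge0// ler_pM// (le_trans b4)// ler_pM2l.
  have {}b5 : `|(x i u ^+ 2 / 2 - v / 2) * E5| <=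
      (delta ^+ 2 + delta ^+ 2 * (1 + 8 * A)) / 2 * (K * (2 * (l%:R * delta))).
    rewrite normrM; apply: ler_pM => //; last by rewrite (le_trans b5)// ler_pM2l.
    rewrite -mulrBl normrM (_ : `|2^-1| = 2^-1 :> R); last by rewrite ger0_norm.
    rewrite ler_wpM2r//.
    by rewrite (le_trans (ler_normB _ _))// lerD// x2_le.
  rewrite (le_trans (ler_normD _ _))// (le_trans (lerD (ler_normD _ _) (lexx _)))//.
  rewrite (le_trans (lerD (lerD (ler_normB _ _) (ler_normD _ _)) (lexx _)))//.
  move: b1 b2 b3 b4 b5.
  have -> : delta * (K * (l%:R * delta) ^+ 2) = K * l%:R ^+ 2 * delta ^+ 3 by ring.
  have -> : delta * (l%:R * delta * (K * (l%:R * delta))) = K * l%:R ^+ 2 * delta ^+ 3 by ring.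
  have -> : (delta ^+ 2 + delta ^+ 2 * (1 + 8 * A)) / 2 * (K * (2 * (l%:R * delta)))
    = (delta ^+ 2 + delta ^+ 2 * (1 + 8 * A)) * K * (l%:R * delta) by field.
  have -> : 2 * K * l%:R ^+ 2 * delta ^+ 3 = K * l%:R ^+ 2 * delta ^+ 3 + K * l%:R ^+ 2 * delta ^+
    3 by ring.
  by lra.
have bRem : bmf Rem.
  apply: bmfB; first by apply: bmfB.
  apply: bmfD; first exact: bmfM.
  by apply: bmfM => //; apply: bmfB => //; exact: bmf_cst.
have bv : bmf (fun u => Z u - v / 2) by apply: bmfB => //; exact: bmf_cst.
have dec : Er (fun u => g (Y i.+1 u)) - Er (fun u => gauss_smooth C (Y i u)) =
    Er Rem + Er (fun u => g1 (Y p u) * x i u) +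
    (cov (fun u => g2 (Y p' u)) Z + Er (fun u => g2 (Y p' u)) * (Er Z - v / 2)).
  rewrite -ErB//.
  transitivity (Er (fun u => Rem u + (g1 (Y p u) * x i u + g2 (Y p' u) * (Z u - v / 2)))).
    by apply: eq_Er => u; rewrite /Rem subrK.
  rewrite ErD//; last by apply: bmfD; exact: bmfM.
  have -> : Er (fun u => g1 (Y p u) * x i u + g2 (Y p' u) * (Z u - v / 2)) =
      Er (fun u => g1 (Y p u) * x i u) + Er (fun u => g2 (Y p' u) * (Z u - v / 2)).
    by apply: ErD; exact: bmfM.
  have -> : Er (fun u => g2 (Y p' u) * (Z u - v / 2)) =
      Er (fun u => g2 (Y p' u) * Z u) - v / 2 * Er (fun u => g2 (Y p' u)).
    rewrite -ErZ// -ErB; [|exact: bmfM|exact: bmfZ].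
    by apply: eq_Er => u; ring.
  by rewrite /cov; ring.
rewrite dec.
have r1 := norm_Er_le P bRem RemE.
have r2 : `|Er (fun u => g1 (Y p u) * x i u)| <= 4 * K * delta ^+ 2 * t.
  have := @telescoping_cov a K g1 K0 mg1 (fun y u => H1 y u cC') p i pi.
  by move=> h; rewrite (le_trans h)// ler_wpM2l ?rate_lag// !mulr_ge0// ltW.
have r3 : `|cov (fun u => g2 (Y p' u)) Z| <= 4 * K * (l.+1%:R * delta ^+ 2) * al l.+1.
  have l0 : 0 < l.+1%:R * delta ^+ 2 by rewrite mulr_gt0// exprn_gt0.
  (* Mixing needs a nonempty past; with [p' = 0] the factor is constant and the covariance is 0. *)
  have [p'0|p'0] := posnP p'.
    rewrite (_ : (fun u => _) = fun=> g2 a); last first.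
      by apply/funext => u; rewrite /Y p'0 /psum big_geq// addr0.
    by rewrite cov_cstl// normr0 !mulr_ge0// ltW.
  apply: (mixing_cov p'0) => //.
  - move=> u; rewrite /Z (_ : l.+1%:R * delta ^+ 2 = delta * (l%:R * delta) + delta ^+ 2);
    last first.
      by rewrite -[l.+1%:R]natr1; ring.
    rewrite (le_trans (ler_normD _ _))// lerD//; first by rewrite normrM ler_pM.
    rewrite normrM (_ : `|2^-1| = 2^-1 :> R); last by rewrite ger0_norm.
    by rewrite (le_trans (ler_pM _ _ (x2_le i u) (lexx _)))// ler_piMr// invf_le1 ?ler1n.
  - apply: sm_comp => //; apply: smD; first exact: sm_cst.
    by apply: sm_psum0 => j.
  - have sxi : sm [set j | (p' + l.+1 <= j.+1)%N] x (x i).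
      apply: (@sm_coord _ _ _ _ _ _ x _ i id); [move: p'0; rewrite /= /p'; clear;
        lia|exact: measurable_id].
    apply: smD.
      apply: smM => //; apply: sm_psum => // j /=; move: p'0; rewrite /p /p'; clear; lia.
    apply: smM; last exact: sm_cst.
    exact: (smM sxi sxi).
have r4 : `|Er (fun u => g2 (Y p' u)) * (Er Z - v / 2)| <= K * (4 * delta ^+ 2 * t).
  rewrite normrM; apply: ler_pM => //; first exact: norm_Er_le.
  (* By [psumvS], half the variance increment is the mean of [Z] plus the cross term with the
     variables before [p]. *)
  have -> : Er Z - v / 2 = - Er (fun u => psum p u * x i u).
    rewrite /v psumvS /Z ErD//; last exact: bmfM.
    have -> : Er (fun u => x i u * D u) = Er (fun u => psum i u * x i u) - Er (fun u =>
      psum p u * x i u).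
      rewrite -ErB; try by apply: bmfM => //; exact: bmf_psum.
      by apply: eq_Er => u; rewrite /D; ring.
    have -> : Er (fun u => x i u ^+ 2 / 2) = Er (fun u => x i u ^+ 2) / 2.
      by rewrite mulrC -ErZ; [apply: eq_Er => u; rewrite mulrC|exact: bmfX].
    by field.
  rewrite normrN (le_trans (Er_psum_x pi))// ler_wpM2l ?rate_lag// mulr_ge0//.
rewrite (le_trans (ler_normD _ _))// (le_trans (lerD (ler_normD _ _) (ler_normD _ _)))//.
rewrite /step_error.
have -> : 8 * K * delta ^+ 2 * t = 4 * K * delta ^+ 2 * t + K * (4 * delta ^+ 2 * t) by ring.
exact: ler_sum4 r1 r2 r3 r4.
Qed.

(** The variance parameter drops at each step by the increment of [psumv], so the steps lead from
    the Gaussian value at [n = 0] to the smoothed law of the sum at [n = m], with errors that add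
    up. *)
Lemma lindeberg_sum :
  (forall n, (n <= m)%N -> c <= eps ^+ 2 + psumv m - psumv n) ->
  `|Er (fun u => gauss_smooth (eps ^+ 2) (a + psum m u)) - gauss_smooth (eps ^+ 2 + psumv m) a|
    <= m%:R * step_error.
Proof.
move=> Hc; pose G n := Er (fun u => gauss_smooth (eps ^+ 2 + psumv m - psumv n) (a + psum n u)).
have v0 : psumv 0 = 0.
  rewrite /psumv -[RHS](Er_cst P 0); apply: eq_Er => u.
  by rewrite /psum big_geq// expr0n.
have -> : gauss_smooth (eps ^+ 2 + psumv m) a = G 0.
  rewrite /G v0 subr0 -[LHS](Er_cst P); apply: eq_Er => u.
  by rewrite /psum big_geq// addr0.
have -> : Er (fun u => gauss_smooth (eps ^+ 2) (a + psum m u)) = G m by rewrite /G addrK.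
suff H n : (n <= m)%N -> `|G n - G 0| <= n%:R * step_error by exact: H.
elim: n => [|n ih] nm; first by rewrite subrr normr0 mul0r.
have hstep : `|G n.+1 - G n| <= step_error.
  have := @lindeberg_step (eps ^+ 2 + psumv m - psumv n) n (Hc n (ltnW nm)).
  rewrite (_ : eps ^+ 2 + psumv m - psumv n - (psumv n.+1 - psumv n) = eps ^+ 2 + psumv m - psumv
    n.+1); last by ring.
  by apply; exact: Hc.
have {}ih := ih (ltnW nm).
move: (G n.+1) (G n) (G 0) step_error hstep ih => x1 x2 x3 E h1 h2.
rewrite -natr1 mulrDl mul1r (_ : x1 - x3 = (x2 - x3) + (x1 - x2)); last by ring.
by rewrite (le_trans (ler_normD _ _))// lerD.
Qed.

End step.
End lindeberg_row.

Lemma quarter_split (R : realType) (E p q z : R) : p <= E / 4 -> q <= E / 4 -> - (q + p) <= z ->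
  E / 2 <= E + z.
Proof. lra. Qed.

Lemma quarter_add (R : realType) (e x y : R) : x <= e / 4 -> y <= e / 4 -> x + y <= e / 2.
Proof. lra. Qed.

(** * Central limit theorem for mixing arrays, against smoothed test functions *)

Section clt.
Context d (T : measurableType d) (R : realType) (P : probability T R).

Local Notation bmf := (@bmf _ T R).
Local Notation Er := (Er P).

Lemma sigma_of_sub d1 (E1 : measurableType d1) d2 (E2 : measurableType d2) (I : Type) (J : set I)
    (x : I -> T -> E1) (X : I -> T -> E2) :
  (forall i Y, J i -> measurable Y -> sigma_of J X (x i @^-1` Y)) -> sigma_of J x `<=` sigma_of J X.
Proof.
move=> H; apply: smallest_sub; first exact: smallest_sigma_algebra.
by move=> _ [i Ji [Y mY <-]]; rewrite setTI; exact: H.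
Qed.

Lemma row_mixing_scale (c : R) (X : nat -> T -> R) al : row_mixing P X al ->
  row_mixing P (fun i u => c * X i u) al.
Proof.
move=> mX n dist A B n0 mA mB; apply: (mX n) => //.
  apply: sigma_of_sub mA => i Y Ji mY; apply: sm_preimage => //.
  by apply: (@sm_coord _ _ _ _ _ _ X _ i ( *%R c)) => //; exact: mulrl_measurable.
apply: sigma_of_sub mB => i Y Ji mY; apply: sm_preimage => //.
by apply: (@sm_coord _ _ _ _ _ _ X _ i ( *%R c)) => //; exact: mulrl_measurable.
Qed.

Variables (X : nat -> nat -> T -> R) (al : nat -> R) (B sig2 : R).
Hypotheses (B0 : 0 < B) (bX : forall m i, bmf (X m i)) (XB : forall m i u, `|X m i u| <= B)
  (EX0 : forall m i, Er (X m i) = 0) (al0 : forall n, 0 <= al n)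
  (mix : forall m, row_mixing P (X m) al)
  (hal : cvgn (series (fun k => k%:R * al k)))
  (hvar : Er (fun u => (\sum_(0 <= j < m) X m j u) ^+ 2) / m%:R @[m --> \oo] --> sig2).

Lemma al_tail (e : R) : 0 < e -> exists l : nat, forall N, \sum_(l.+1 <= k < N) k%:R * al k <= e.
Proof.
move=> e0; have /cauchy_cvgP/cauchy_seriesP := hal.
move=> /(_ e e0) [[A1 A2]] [[N1 _ h1] [N2 _ h2]] h.
exists (maxn N1 N2) => N.
have [NN|NN] := leqP (maxn N1 N2).+1 N; last by rewrite big_geq ?(ltW e0)// ltnW.
have := h ((maxn N1 N2).+1, N).
rewrite /= => hh; apply/ltW; apply: le_lt_trans (hh _); first exact: ler_norm.
split; [apply: h1|apply: h2] => /=; rewrite ?(leq_trans (leq_maxl _ _) (leqnSn _))//.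
by rewrite (leq_trans (leq_maxr N1 N2))// ltnW.
Qed.

Lemma al_le_kal l N : \sum_(l.+1 <= k < N) al k <= \sum_(l.+1 <= k < N) k%:R * al k.
Proof.
rewrite big_seq [leRHS]big_seq; apply: ler_sum => k; rewrite mem_index_iota => /andP[lk _].
by rewrite ler_peMl// ler1n (leq_trans _ lk).
Qed.

Lemma al_sum_bounded : exists A : R, forall N, \sum_(1 <= k < N) al k <= A.
Proof.
have [l hl] := al_tail ltr01.
exists (\sum_(1 <= k < l.+1) al k + 1) => N.
have [lN|lN] := leqP l.+1 N.
  by rewrite (big_cat_nat (ltn0Sn l) lN)//= lerD2l (le_trans (al_le_kal _ _)).
rewrite (le_trans (@sum_al_le _ _ al0 _ _ _ (leqnn 1)))// -[leLHS]addr0 lerD//.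
have [N1|N1] := leqP 1 N; last by rewrite big_geq ?sumr_ge0// ltnW.
by rewrite [leRHS](big_cat_nat N1 (ltnW lN))//= lerDl sumr_ge0.
Qed.

Lemma sqrt_nat_large (eta : R) : 0 < eta -> exists m0 : nat, forall m, (m0 <= m)%N ->
  (0 < m)%N /\ B / Num.sqrt m%:R <= eta.
Proof.
move=> e0; have [n hn] : exists n : nat, (B / eta) ^+ 2 < n%:R.
  by exists (Num.truncn ((B / eta) ^+ 2)).+1; apply: truncnS_gt.
exists n.+1 => m nm; have m0 : (0 < m)%N by exact: leq_trans nm.
have s0 : 0 < Num.sqrt m%:R :> R by rewrite sqrtr_gt0 ltr0n.
split => //; rewrite ler_pdivrMr// mulrC -ler_pdivrMr// -(@ler_pXn2r _ 2)// ?nnegrE ?(ltW s0)//.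
  by rewrite sqr_sqrtr ?ler0n// (le_trans (ltW hn))// ler_nat ltnW.
by rewrite divr_ge0// ltW.
Qed.

(** All terms carry [delta ^+ 2], which times [m] stays constant. Those with one more [delta] vanish
    as [m] grows for fixed [l]; the rest are small by the choice of [l], and [12 = 8 + 4] adds their
    coefficients. *)
Lemma step_error_le (K A t e : R) l (delta : R) : 0 < K -> 0 <= A -> 0 < delta <= 1 ->
  t <= e -> l.+1%:R * al l.+1 <= e ->
  step_error al delta A t l K <= delta ^+ 2 * (delta * (K * (1 + (1 + 8 * A) ^+ 2 + 2 * l%:R ^+ 2 +
    (2 + 8 * A) * l%:R)) + 12 * K * e).
Proof.
move=> K0 A0 /andP[d0 d1] te le; rewrite /step_error.
have -> : K * delta ^+ 3 + K * (delta ^+ 2 * (1 + 8 * A)) ^+ 2 + 2 * K * l%:R ^+ 2 * delta ^+ 3 +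
    (delta ^+ 2 + delta ^+ 2 * (1 + 8 * A)) * K * (l%:R * delta) + 8 * K * delta ^+ 2 * t +
    4 * K * (l.+1%:R * delta ^+ 2) * al l.+1 =
  delta ^+ 2 * (delta * (K * (1 + delta * (1 + 8 * A) ^+ 2 + 2 * l%:R ^+ 2 +
    (2 + 8 * A) * l%:R)) + (8 * K * t + 4 * K * (l.+1%:R * al l.+1))) by ring.
rewrite ler_wpM2l ?sqr_ge0// lerD//.
  by rewrite ler_pM2l// ler_pM2l// !lerD2r lerD2l ler_piMl// sqr_ge0.
rewrite (_ : 12 * K * e = 8 * K * e + 4 * K * e); last by ring.
by rewrite lerD// ler_pM2l// mulr_gt0.
Qed.

Lemma sig2_ge0 : 0 <= sig2.
Proof.
rewrite -(cvg_lim (@Rhausdorff R) hvar); apply: limr_ge; first by apply/cvg_ex; exists sig2.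
by apply: nearW => m; rewrite mulr_ge0 ?invr_ge0//; apply: Er_ge0 => u; exact: sqr_ge0.
Qed.

Lemma clt_smooth (eps a : R) : 0 < eps ->
  Er (fun u => gauss_smooth (eps ^+ 2) (a + (Num.sqrt m%:R)^-1 * \sum_(0 <= j < m) X m j u))
    @[m --> \oo] --> gauss_smooth (eps ^+ 2 + sig2) a.
Proof.
move=> eps0; pose Vm m := Er (fun u => (\sum_(0 <= j < m) X m j u) ^+ 2) / m%:R.
have e20 : 0 < eps ^+ 2 by rewrite exprn_gt0.
have limV : gauss_smooth (eps ^+ 2 + Vm m) a @[m --> \oo] --> gauss_smooth (eps ^+ 2 + sig2) a.
  have C0 : 0 < eps ^+ 2 + sig2 by rewrite ltr_wpDr// sig2_ge0.
  have cont : {for eps ^+ 2 + sig2, continuous (fun C => gauss_smooth C a)}.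
    apply: differentiable_continuous; apply/derivable1_diffP.
    by case: (is_derive_smooth_time a C0).
  apply: (@cvg_comp _ _ _ (fun m => eps ^+ 2 + Vm m) (fun C => gauss_smooth C a)); last exact: cont.
  by apply: cvgD; [exact: cvg_cst|exact: hvar].
(* Half of [eps ^+ 2] is the floor for the remaining variance; two quarters are left for its
   possible decrease. *)
pose c := eps ^+ 2 / 2; have c0 : 0 < c by rewrite divr_gt0.
have [K1 [K10 HK1]] := smooth_taylor c0.
have [K [K0 HK H1]] : exists K : R, [/\ 0 < K, (forall C y : R, c <= C ->
  [/\ `|gauss_smooth1 C y| <= K /\ `|gauss_smooth2 C y| <= K,
      forall u, `|gauss_smooth2 C (y + u) - gauss_smooth2 C y| <= K * `|u|,
      forall u, `|gauss_smooth1 C (y + u) - gauss_smooth1 C y - u * gauss_smooth2 C y| <= K * `|u|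
        ^+ 2,
      forall u, `|gauss_smooth C (y + u) - gauss_smooth C y - u * gauss_smooth1 C y
                   - u ^+ 2 / 2 * gauss_smooth2 C y| <= K * `|u| ^+ 3 &
      forall C', c <= C' ->
        `|gauss_smooth C' y - gauss_smooth C y - (C' - C) / 2 * gauss_smooth2 C y| <= K * `|C' - C|
          ^+ 2]) &
  (forall C y u : R, c <= C -> `|gauss_smooth1 C (y + u) - gauss_smooth1 C y| <= K * `|u|)].
  exists K1; split => // C y u cC.
  rewrite -{2}(addrK y u) [u + y]addrC.
  apply: (mvt_boundT (f := gauss_smooth1 C) (df := gauss_smooth2 C)) => z.
    by apply: is_derive_smooth1; exact: lt_le_trans cC.
  by have [[]] := HK1 C z cC.
have [A hA] := al_sum_bounded.
have A0 : 0 <= A by apply: le_trans (hA 0%N); rewrite big_geq.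
apply/cvgrPdist_le => e e0.
have B20 : 0 < B ^+ 2 by rewrite exprn_gt0.
(* The first bound keeps the far-lag loss of variance, [8 * B ^+ 2 * e1], below [eps ^+ 2 / 4]; the
   second makes [12 * K * B ^+ 2 * e1] at most [e / 4]. *)
pose e1 := Num.min (eps ^+ 2 / (32 * B ^+ 2)) (e / (48 * K * B ^+ 2)).
have e10 : 0 < e1 by rewrite lt_min !divr_gt0// !mulr_gt0.
have [l hl] := al_tail e10.
have ht N : \sum_(l.+1 <= k < N) al k <= e1 by rewrite (le_trans (al_le_kal _ _)).
have hl1 : l.+1%:R * al l.+1 <= e1 by have := hl l.+2; rewrite big_nat1.
pose M := K * (1 + (1 + 8 * A) ^+ 2 + 2 * l%:R ^+ 2 + (2 + 8 * A) * l%:R).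
have M0 : 0 < M.
  rewrite mulr_gt0// ltr_wpDr//; first by rewrite mulr_ge0// addr_ge0// mulr_ge0.
  by rewrite ltr_wpDr ?mulr_ge0 ?sqr_ge0// ltr_wpDr ?sqr_ge0.
(* In order: the condition [delta <= 1] of [step_error_le], the share [e / 4] of the terms of order
   [delta ^+ 3], and a near-lag loss of variance of at most [eps ^+ 2 / 4]. *)
pose eta := Num.min 1 (Num.min (e / (4 * B ^+ 2 * M)) (eps ^+ 2 / (32 * (l%:R * A + 1)))).
have lA0 : 0 < l%:R * A + 1 by rewrite ltr_wpDl// mulr_ge0.
have eta0 : 0 < eta.
  by rewrite !lt_min ltr01/=; apply/andP; split; apply: divr_gt0 => //; do ?[apply: mulr_gt0 => //].
have [m0 hm0] := sqrt_nat_large eta0.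
move/cvgrPdist_le : limV => /(_ (e / 2)); rewrite divr_gt0// => /(_ isT) [m1 _ hm1].
exists (maxn m0 m1) => // m /=; rewrite geq_max => /andP[/hm0[mp hdelta] /hm1 hV].
set delta := B / Num.sqrt m%:R in hdelta.
have s0 : 0 < Num.sqrt m%:R :> R by rewrite sqrtr_gt0 ltr0n.
have d0 : 0 < delta by rewrite divr_gt0.
move: hdelta; rewrite !le_min => /and3P[d1 d2 d3].
have md2 : m%:R * delta ^+ 2 = B ^+ 2.
  by rewrite /delta expr_div_n sqr_sqrtr ?ler0n// mulrC divfK// pnatr_eq0 -lt0n.
pose x i u := (Num.sqrt m%:R)^-1 * X m i u.
have bx i : bmf (x i) by exact: bmfZ.
have xd i u : `|x i u| <= delta.
  by rewrite /x /delta normrM normfV (gtr0_norm s0) mulrC ler_pM2r ?invr_gt0.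
have Ex0 i : Er (x i) = 0 by rewrite ErZ// EX0 mulr0.
have mixx : row_mixing P x al by exact: row_mixing_scale.
have psumE n u : psum x n u = (Num.sqrt m%:R)^-1 * \sum_(0 <= j < n) X m j u
  by rewrite /psum -mulr_sumr.
have VE : psumv P x m = Vm m.
  rewrite /psumv /Vm.
  transitivity (Er (fun u => m%:R^-1 * (\sum_(0 <= j < m) X m j u) ^+ 2)).
    by apply: eq_Er => u; rewrite psumE exprMn exprVn sqr_sqrtr ?ler0n.
  by rewrite ErZ; [rewrite mulrC|apply: bmfX; exact: bmf_sum].
have Hc n : (n <= m)%N -> c <= eps ^+ 2 + psumv P x m - psumv P x n.
  move=> nm; have := psumv_incr_ge d0 bx xd Ex0 al0 mixx hA ht nm.
  have -> : 8 * delta ^+ 2 * (l%:R * A + m%:R * e1) = 8 * (delta ^+ 2 * (l%:R * A)) + 8 * B ^+ 2 *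
    e1.
    by rewrite -md2; ring.
  have h1 : 8 * B ^+ 2 * e1 <= eps ^+ 2 / 4.
    apply: le_trans (_ : 8 * B ^+ 2 * (eps ^+ 2 / (32 * B ^+ 2)) <= _).
      by rewrite ler_pM2l ?mulr_gt0// /e1 ge_min lexx.
    by rewrite le_eqVlt; apply/orP; left; apply/eqP; field; rewrite gt_eqF.
  have h2 : 8 * (delta ^+ 2 * (l%:R * A)) <= eps ^+ 2 / 4.
    apply: le_trans (_ : 8 * (eps ^+ 2 / (32 * (l%:R * A + 1)) * (l%:R * A + 1)) <= _).
      rewrite ler_pM2l//; apply: ler_pM; rewrite ?sqr_ge0 ?mulr_ge0//; last by rewrite lerDl.
      by apply: le_trans d3; rewrite expr2 ler_piMl// ltW.
    have q0 : l%:R * A + 1 != 0 by rewrite gt_eqF.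
    move: q0; set q := l%:R * A + 1; move: q => q q0.
    by rewrite le_eqVlt; apply/orP; left; apply/eqP; field.
  by move=> h3; rewrite -addrA; exact: quarter_split h1 h2 h3.
have := lindeberg_sum d0 bx xd Ex0 al0 mixx hA ht a c0 K0 HK H1 Hc.
rewrite VE => hlind.
have herr : m%:R * step_error al delta A e1 l K <= e / 2.
  apply: le_trans (_ : m%:R * (delta ^+ 2 * (delta * M + 12 * K * e1)) <= _).
    by rewrite ler_pM2l ?ltr0n// step_error_le// d0.
  rewrite mulrA md2 mulrDr.
  have h1 : B ^+ 2 * (delta * M) <= e / 4.
    apply: le_trans (_ : B ^+ 2 * (e / (4 * B ^+ 2 * M) * M) <= _).
      by rewrite ler_pM2l// ler_pM2r.
    by rewrite le_eqVlt; apply/orP; left; apply/eqP; field; rewrite !gt_eqF.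
  have h2 : B ^+ 2 * (12 * K * e1) <= e / 4.
    apply: le_trans (_ : B ^+ 2 * (12 * K * (e / (48 * K * B ^+ 2))) <= _).
      by rewrite ler_pM2l// ler_pM2l ?mulr_gt0// /e1 ge_min lexx orbT.
    by rewrite le_eqVlt; apply/orP; left; apply/eqP; field; rewrite !gt_eqF.
  exact: quarter_add h1 h2.
have -> : Er (fun u => gauss_smooth (eps ^+ 2) (a + (Num.sqrt m%:R)^-1 * \sum_(0 <= j < m) X m j
  u)) =
    Er (fun u => gauss_smooth (eps ^+ 2) (a + psum x m u)) by apply: eq_Er => u; rewrite psumE.
rewrite (splitr e) (le_trans (ler_distD (gauss_smooth (eps ^+ 2 + Vm m) a) _ _))// lerD//.
by rewrite distrC (le_trans hlind).
Qed.

End clt.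

Lemma sandwich_arith (R : realType) (F e p q1 q2 S1 S2 u l : R) :
  `|S1 - q1| <= e / 2 -> `|S2 - q2| <= e / 2 -> p <= q1 + u -> q2 - l <= p ->
  S1 + u <= F + e / 2 -> F - e / 2 <= S2 - l -> `|F - p| <= e.
Proof.
by rewrite !ler_norml => /andP[? ?] /andP[? ?] ? ? ? ?; apply/andP; split; lra.
Qed.

(** * From smoothed test functions to convergence in law *)

Section limit_law.
Context d (T : measurableType d) (R : realType) (P : probability T R).

Local Notation bmf := (@bmf _ T R).
Local Notation Er := (Er P).

Lemma bmf_smooth_shift (C a : R) (Y : T -> R) : 0 < C -> measurable_fun [set: T] Y ->
  bmf (fun u => gauss_smooth C (a - Y u)).
Proof.
move=> C0 mY; have [mg _ _] := measurable_smooth C0.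
apply: bmf_comp => //; last by apply: measurable_funB => //; exact: measurable_cst.
by exists 1 => y; rewrite ger0_norm ?Phi_ge0// Phi_le1.
Qed.

(** On the exceptional event the test function changes by at most 1, elsewhere the mean value
    inequality costs [K] times the distance; with probability and distance both at most
    [e / 2 / (1 + K)] the total is [e / 2]. *)
Lemma smooth_slutsky (Y Z : nat -> T -> R) (sig2 : R) :
  (forall m, measurable_fun [set: T] (Y m)) -> (forall m, measurable_fun [set: T] (Z m)) ->
  (forall e : R, 0 < e -> \forall m \near \oo, exists A : set T,
    [/\ measurable A, fine (P A) <= e & forall u, ~ A u -> `|Y m u - Z m u| <= e]) ->
  (forall eps a : R, 0 < eps -> Er (fun u => gauss_smooth (eps ^+ 2) (a - Y m u)) @[m --> \oo]
    --> gauss_smooth (eps ^+ 2 + sig2) a) ->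
  forall eps a : R, 0 < eps -> Er (fun u => gauss_smooth (eps ^+ 2) (a - Z m u)) @[m --> \oo]
    --> gauss_smooth (eps ^+ 2 + sig2) a.
Proof.
move=> mY mZ YZ hY eps a eps0; have e20 : 0 < eps ^+ 2 by rewrite exprn_gt0.
have [K [K0 HK]] := smooth_bounded e20.
apply/cvgrPdist_le => /= e e0.
have c0 : 0 < e / 2 / (1 + K) by rewrite !divr_gt0// addr_gt0.
have := hY eps a eps0 => /cvgrPdist_le /(_ (e / 2)); rewrite divr_gt0// => /(_ isT) near1.
have near2 := YZ _ c0.
near=> m.
have [A [mA PA hA]] : exists A : set T, [/\ measurable A, fine (P A) <= e / 2 / (1 + K) &
  forall u, ~ A u -> `|Y m u - Z m u| <= e / 2 / (1 + K)] by near: m.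
rewrite (splitr e) (le_trans (ler_distD (Er (fun u => gauss_smooth (eps ^+ 2) (a - Y m u))) _ _))//
  lerD//.
  by near: m.
have b1 := bmf_smooth_shift a e20 (mY m); have b2 := bmf_smooth_shift a e20 (mZ m).
rewrite -ErB// (le_trans (norm_Er_norm _ _))//; first exact: bmfB.
have bA := @bmf_indic _ _ R _ mA.
apply: le_trans (_ : Er (fun u => \1_A u + K * (e / 2 / (1 + K))) <= _).
  apply: le_Er; [by apply: bmf_norm; exact: bmfB|by apply: bmfD => //; exact: bmf_cst|move=> u].
  have [Au|nAu] := pselect (A u).
    rewrite indicE mem_set//=; apply: le_trans (_ : 1 <= _); last by rewrite lerDl mulr_ge0// ltW.
    by rewrite ler_norml; have := Phi_ge0 ((a - Y m u) / Num.sqrt (eps ^+ 2));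
      have := Phi_ge0 ((a - Z m u) / Num.sqrt (eps ^+ 2));
      have := Phi_le1 ((a - Y m u) / Num.sqrt (eps ^+ 2));
      have := Phi_le1 ((a - Z m u) / Num.sqrt (eps ^+ 2)); rewrite /gauss_smooth; lra.
  rewrite indicE memNset//= add0r.
  apply: le_trans (_ : K * `|(a - Y m u) - (a - Z m u)| <= _).
    apply: (mvt_boundT (f := gauss_smooth (eps ^+ 2)) (df := gauss_smooth1 (eps ^+ 2))) => z.
      exact: is_derive_smooth0.
    by have [] := HK _ z (lexx (eps ^+ 2)).
  rewrite ler_pM2l// (_ : _ - _ = - (Y m u - Z m u)); last by ring.
  by rewrite normrN hA.
rewrite ErD//; last exact: bmf_cst.
rewrite Er_indic// Er_cst; apply: le_trans (_ : e / 2 / (1 + K) + K * (e / 2 / (1 + K)) <= _).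
  by rewrite lerD2r.
by rewrite le_eqVlt; apply/orP; left; apply/eqP; field; rewrite gt_eqF// addr_gt0.
Unshelve. all: end_near. Qed.

Lemma Phi_large (e : R) : 0 < e -> exists N : nat, forall n, (N <= n)%N ->
  1 - e <= Phi (n%:R : R)%:E /\ Phi (- n%:R : R)%:E <= e.
Proof.
move=> e0.
have := @cvg_Phi_y R => /cvgrPdist_le /(_ e e0) [M1 [_ h1]].
have := @cvg_Phi_Ny R => /cvgrPdist_le /(_ e e0) [M2 [_ h2]].
exists (maxn (Num.truncn M1).+1 (Num.truncn (- M2)).+1) => n.
rewrite geq_max => /andP[n1 n2]; split.
  have : M1 < n%:R by rewrite (lt_le_trans (truncnS_gt M1))// ler_nat.
  by move=> /h1; rewrite ler_norml => /andP[_]; lra.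
have : - n%:R < M2 by rewrite ltrNl (lt_le_trans (truncnS_gt _))// ler_nat.
by move=> /h2; rewrite ler_norml => /andP[]; lra.
Qed.

Lemma gauss_smooth_limit (sig2 x s : R) : 0 < sig2 ->
  gauss_smooth (n.+1%:R^-1 ^+ 4 + sig2) (x + s * n.+1%:R^-1) @[n --> \oo] --> gauss_smooth sig2 x.
Proof.
move=> s0; rewrite /gauss_smooth.
have h0 := @cvg_harmonic R.
apply: (@cvg_comp _ _ _ (fun n => (x + s * n.+1%:R^-1) / Num.sqrt (n.+1%:R^-1 ^+ 4 + sig2)) (fun y
  => Phi y%:E)); last exact: continuous_Phi.
apply: cvgM.
  rewrite -[X in _ --> X]addr0; apply: cvgD; first exact: cvg_cst.
  by rewrite -(mulr0 s); apply: cvgM; [exact: cvg_cst|exact: h0].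
apply: cvgV; first by rewrite gt_eqF// sqrtr_gt0.
apply: (@cvg_comp _ _ _ _ Num.sqrt); last exact: sqrt_continuous.
suff h : n.+1%:R^-1 ^+ 4 + sig2 @[n --> \oo] --> (0 : R) ^+ 4 + sig2 by move: h;
  rewrite expr0n/= add0r.
by apply: cvgD; [apply: (@cvg_comp _ _ _ (fun n => n.+1%:R^-1) (fun y : R => y ^+ 4));
  [exact: h0|exact: exprn_continuous]|exact: cvg_cst].
Qed.

(** Smoothing at scale [eta ^+ 2] is of smaller order than the shift [eta], so at the shifted
    argument it differs from a step by a normal tail beyond [eta^-1]. When the variance is 0,
    continuity at [x] excludes the atom 0, and [eta] is taken at most half the absolute value of
    [x]. *)
Lemma centered_normal_sandwich (sig2 x e : R) : 0 <= sig2 ->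
  {for x, continuous (fun y : R => centered_normal sig2 `]-oo, y]%classic)} -> 0 < e ->
  exists eta : R, [/\ 0 < eta,
    gauss_smooth (eta ^+ 4 + sig2) (x + eta) + (1 - Phi (eta^-1)%:E) <=
      fine (centered_normal sig2 `]-oo, x]%classic) + e &
    fine (centered_normal sig2 `]-oo, x]%classic) - e <=
      gauss_smooth (eta ^+ 4 + sig2) (x - eta) - Phi (- eta^-1)%:E].
Proof.
move=> sg0 cx e0; have e20 : 0 < e / 2 by rewrite divr_gt0.
have [N hN] := Phi_large e20.
move: sg0; rewrite le_eqVlt => /predU1P[sg|sg0]; last first.
  have F : fine (centered_normal sig2 `]-oo, x]%classic) = gauss_smooth sig2 x.
    by rewrite /centered_normal gt_eqF// normal_prob_itv// sqrtr_gt0.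
  rewrite F.
  have := @gauss_smooth_limit sig2 x 1 sg0 => /cvgrPdist_le /(_ _ e20) n1.
  have := @gauss_smooth_limit sig2 x (- 1) sg0 => /cvgrPdist_le /(_ _ e20) n2.
  have [n [hn1 hn2 nN]] : exists n : nat, [/\
     `|gauss_smooth sig2 x - gauss_smooth (n.+1%:R^-1 ^+ 4 + sig2) (x + 1 * n.+1%:R^-1)| <= e / 2,
     `|gauss_smooth sig2 x - gauss_smooth (n.+1%:R^-1 ^+ 4 + sig2) (x + -1 * n.+1%:R^-1)| <= e / 2 &
     (N <= n)%N].
    near \oo => n; exists n; split; near: n; [exact: n1|exact: n2|exact: nbhs_infty_ge].
  have [h1 h2] := hN n.+1 (leq_trans nN (leqnSn n)).
  exists n.+1%:R^-1; rewrite invrK; split; first by rewrite invr_gt0.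
    by move: hn1; rewrite mul1r ler_norml => /andP[]; lra.
  by move: hn2; rewrite mulN1r ler_norml => /andP[]; lra.
have F y : fine (centered_normal sig2 `]-oo, y]%classic) = (0 <= y)%R%:R.
  rewrite /centered_normal -sg eqxx /dirac indicE /=.
  congr (nat_of_bool _)%:R; apply/idP/idP; first by move/set_mem; rewrite /= in_itv.
  by move=> y0; rewrite mem_set//= in_itv.
(* Were [x] the atom, the distribution function would jump there from 0 to 1. *)
have x0 : x != 0.
  apply/eqP => x0; move: cx; rewrite x0 => cx.
  have : fine (centered_normal sig2 `]-oo, y]%classic) @[y --> (0 : R)] --> (1 : R).
    apply: fine_cvg; apply: cvg_trans cx _.
    rewrite -sg /centered_normal eqxx /dirac indicE mem_set//= in_itv/= lexx//.
  move=> /cvgrPdist_lt /(_ 1 ltr01) [r /= r0 hr].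
  have := hr (- (r / 2)); rewrite /ball_/= F opprK add0r ger0_norm; last by rewrite ltW// divr_gt0.
  rewrite ltr_pdivrMr// ltr_pMr// ltr1n => /(_ isT).
  by rewrite leNgt oppr_lt0 divr_gt0//= subr0 normr1 ltxx.
rewrite F.
have [n [nN nx]] : exists n : nat, (N <= n)%N /\ 2 / `|x| <= n.+1%:R.
  exists (maxn N (Num.truncn (2 / `|x|)).+1); rewrite leq_maxl; split => //.
  by rewrite (le_trans (ltW (truncnS_gt _)))// ler_nat ltnW// ltnS leq_maxr.
have [h1 h2] := hN n.+1 (leq_trans nN (leqnSn n)).
have n0 : 0 < n.+1%:R :> R by rewrite ltr0n.
have nx' : 2 * n.+1%:R^-1 <= `|x| by rewrite ler_pdivrMr// mulrC -ler_pdivrMr// normr_gt0.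
exists n.+1%:R^-1; rewrite invrK; split; first by rewrite invr_gt0.
all: rewrite -sg addr0 /gauss_smooth (_ : Num.sqrt _ = n.+1%:R^-1 ^+ 2);
  try by rewrite (_ : 4%N = (2 * 2)%N)// exprM sqrtr_sqr ger0_norm// sqr_ge0.
all: rewrite exprVn invrK.
all: have bnd (y : R) := Phi_ge0 y; have bnd1 (y : R) := Phi_le1 y.
  have [xp|xn] := leP 0 x; first by rewrite /=; have := bnd1 ((x + n.+1%:R^-1) * n.+1%:R ^+ 2); lra.
  apply: le_trans (_ : Phi (- n.+1%:R)%:E + (1 - Phi n.+1%:R%:E) <= _); last by rewrite /=; lra.
  rewrite lerD2r Phi_le; move: nx'; rewrite ltr0_norm// => nx'.
  apply: le_trans (_ : - n.+1%:R^-1 * n.+1%:R ^+ 2 <= _).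
    by rewrite ler_pM2r ?exprn_gt0//; move: nx'; set iN := n.+1%:R^-1; lra.
  by rewrite mulNr expr2 mulKf ?gt_eqF.
have [xp|xn] := leP 0 x; last by have := bnd ((x - n.+1%:R^-1) * n.+1%:R ^+ 2); rewrite /=; lra.
apply: le_trans (_ : Phi (n.+1%:R)%:E - Phi (- n.+1%:R)%:E <= _); first by rewrite /=; lra.
rewrite lerD2r Phi_le; move: nx'; rewrite ger0_norm// => nx'.
apply: le_trans (_ : n.+1%:R^-1 * n.+1%:R ^+ 2 <= _).
  by rewrite expr2 mulKf ?gt_eqF.
by rewrite ler_pM2r ?exprn_gt0//; move: nx'; set iN := n.+1%:R^-1; lra.
Unshelve. all: end_near. Qed.

(** The indicator of a ray lies between smoothed steps shifted by [eta] either way, up to the tails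
    of [Phi] at [eta^-1]; the smoothing variance is [(eta ^+ 2) ^+ 2]. *)
Lemma smooth_cvg_in_law (Z : nat -> T -> R) (sig2 : R) : 0 <= sig2 ->
  (forall m, measurable_fun [set: T] (Z m)) ->
  (forall eps a : R, 0 < eps -> Er (fun u => gauss_smooth (eps ^+ 2) (a - Z m u)) @[m --> \oo]
    --> gauss_smooth (eps ^+ 2 + sig2) a) ->
  cvg_in_law P Z (centered_normal sig2).
Proof.
move=> sg0 mZ hZ x cx.
have mZx m : measurable [set u | Z m u <= x].
  rewrite -[X in measurable X]setTI (_ : [set u | _] = Z m @^-1` `]-oo, x]); first exact: mZ.
  by apply/seteqP; split => u /=; rewrite in_itv.
have finF : centered_normal sig2 `]-oo, x]%classic \is a fin_num.
  rewrite /centered_normal; case: ifP => _; first exact: (@fin_num_measure _ _ _ (\d_(0 : R))).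
  exact: (@fin_num_measure _ _ _ (normal_prob 0 (Num.sqrt sig2))).
rewrite -(fineK finF); apply/fine_cvgP; split.
  by apply: nearW => m; exact: fin_num_measure.
apply/cvgrPdist_le => /= e e0; have e20 : 0 < e / 2 by rewrite divr_gt0.
have [eta [eta0 hU hL]] := centered_normal_sandwich sg0 cx e20.
have e40 : 0 < eta ^+ 2 by rewrite exprn_gt0.
have e42 : (eta ^+ 2) ^+ 2 = eta ^+ 4 by rewrite -exprM.
have := hZ (eta ^+ 2) (x + eta) e40 => /cvgrPdist_le /(_ _ e20) n1.
have := hZ (eta ^+ 2) (x - eta) e40 => /cvgrPdist_le /(_ _ e20) n2.
apply: filterS2 n1 n2 => m c1 c2.
have b a := bmf_smooth_shift a (exprn_gt0 2 e40) (mZ m).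
have bI := @bmf_indic _ _ R _ (mZx m).
have sq : Num.sqrt ((eta ^+ 2) ^+ 2) = eta ^+ 2 by rewrite sqrtr_sqr ger0_norm// ltW.
have ee : eta / eta ^+ 2 = eta^-1 by rewrite expr2 invfM mulrA divff ?mul1r// gt_eqF.
have up : fine (P [set u | Z m u <= x]) <=
    Er (fun u => gauss_smooth ((eta ^+ 2) ^+ 2) (x + eta - Z m u)) + (1 - Phi (eta^-1)%:E).
  rewrite -Er_indic// -(Er_cst P (1 - _)) -ErD//; last exact: bmf_cst.
  apply: le_Er => //; first by apply: bmfD => //; exact: bmf_cst.
  move=> u; rewrite indicE; case: (boolP (_ \in _)) => [|_].
    rewrite inE/= => h; rewrite addrCA lerDl subr_ge0 /gauss_smooth sq Phi_le -ee.
    by rewrite ler_pM2r ?invr_gt0// addrAC lerDr subr_ge0.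
  by rewrite addr_ge0 ?Phi_ge0// subr_ge0 Phi_le1.
have lo : Er (fun u => gauss_smooth ((eta ^+ 2) ^+ 2) (x - eta - Z m u)) - Phi (- eta^-1)%:E <=
    fine (P [set u | Z m u <= x]).
  rewrite lerBlDr -Er_indic// -(Er_cst P (Phi _)) -ErD//; last exact: bmf_cst.
  apply: le_Er => //; first by apply: bmfD => //; exact: bmf_cst.
  move=> u; rewrite indicE; case: (boolP (_ \in _)) => [_|].
    by rewrite (le_trans (Phi_le1 _))// lerDl Phi_ge0.
  move=> /negP; rewrite inE/= => /negP; rewrite -ltNge => h.
  rewrite add0r /gauss_smooth sq Phi_le -ee -mulNr.
  by rewrite ler_pM2r ?invr_gt0// addrAC gerDr subr_le0 ltW.
rewrite e42 in c1 c2 up lo.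
exact: sandwich_arith c1 c2 up lo hU hL.
Qed.

End limit_law.

(** * Gaussian pairs *)

Section normal_characteristic_function.
Context {R : realType}.
Local Notation mu := (@lebesgue_measure R).

Lemma derivable_LR (g dg : R -> R) (a b : R) : (forall x : R, is_derive x 1 g (dg x)) ->
  derivable_oo_LRcontinuous g a b.
Proof.
move=> gdg; have cg x : {for x, continuous g}.
  by apply: differentiable_continuous; apply/derivable1_diffP; case: (gdg x).
split; [by move=> x _; case: (gdg x)| |].
  by apply: cvg_at_right_filter; exact: cg.
by apply: cvg_at_left_filter; exact: cg.
Qed.

(** The fundamental theorem of calculus on [[- n.+1, n.+1]], with dominated convergence as the
    intervals grow. *)
Lemma Rintegral_derive_eq0 (g dg : R -> R) :
  (forall x : R, is_derive x 1 g (dg x)) -> continuous dg ->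
  mu.-integrable [set: R] (EFin \o dg) ->
  g n.+1%:R @[n --> \oo] --> (0 : R) -> g (- n.+1%:R) @[n --> \oo] --> (0 : R) ->
  \int[mu]_x dg x = 0.
Proof.
move=> gdg cdg idg g1 g2.
pose A n : set R := `[- n.+1%:R, n.+1%:R]%classic.
have IA n : (\int[mu]_x ((EFin \o dg) \_ (A n)) x = (g n.+1%:R - g (- n.+1%:R))%:E)%E.
  rewrite -integral_mkcond.
  rewrite (@continuous_FTC2 R dg g) ?EFinB//.
  - by rewrite (@lt_trans _ _ 0)// ?oppr_lt0 ltr0n.
  - by apply: continuous_subspaceT.
  - exact: derivable_LR gdg.
  - by move=> x _; rewrite derive1E; case: (gdg x).
have mdg : measurable_fun [set: R] (EFin \o dg).
  by apply/measurable_EFinP; exact: continuous_measurable_fun.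
have h1 n : measurable_fun [set: R] ((EFin \o dg) \_ (A n)).
  apply/(measurable_restrictT _ (measurable_itv _)).
  exact: measurable_funS mdg.
have h2 : {ae mu, forall x, setT x -> (fun n => ((EFin \o dg) \_ (A n)) x)
  @ \oo --> (EFin \o dg) x}.
  apply: aeW => x _; apply: cvg_near_cst.
  exists (Num.truncn `|x|) => // n /= xn.
  rewrite patchE mem_set// /A /= in_itv/= -ler_norml.
  by rewrite (le_trans (ltW (truncnS_gt _)))// ler_nat ltnS.
have h3 : mu.-integrable setT (abse \o (EFin \o dg)) by exact: integrable_abse.
have h4 : {ae mu, forall x n, setT x -> (`|((EFin \o dg) \_ (A n)) x| <= (abse \o (EFin \o dg))
  x)%E}.
  by apply: aeW => x n _; rewrite /= patchE; case: ifP => _ //; rewrite abse0.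
have [_ _] := @dominated_convergence _ _ _ mu setT measurableT _ _ _ h1 mdg h2 h3 h4.
have -> : (fun n => \int[mu]_x ((EFin \o dg) \_ (A n)) x)%E = (fun n =>
  (g n.+1%:R - g (- n.+1%:R))%:E).
  by apply/funext => n; exact: IA.
move=> hh.
have l2 : (g n.+1%:R - g (- n.+1%:R))%:E @[n --> \oo] --> (0%R : R)%:E.
  by apply: cvg_EFin; [exact: nearW|rewrite -[X in _ --> X](subr0 0); apply: cvgB].
rewrite /Rintegral; have -> // : (\int[mu]_x (dg x)%:E = 0)%E.
exact: (cvg_unique _ hh l2).
Qed.

Variable s : R.
Hypothesis s0 : 0 < s.
Local Notation pdf := (normal_pdf (0 : R) s).

Lemma normal_pdf0E x : pdf x = normal_peak s * expR (- (x ^+ 2 / (2 * s ^+ 2))).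
Proof.
by rewrite normal_pdfE ?gt_eqF// /normal_fun subr0 mulNr -[s ^+ 2 *+ 2]mulr_natl.
Qed.

Lemma is_derive_normal_pdf0 (x : R) : is_derive x 1 (fun x => pdf x) (- (x / s ^+ 2) * pdf x).
Proof.
rewrite (_ : (fun x => pdf x) = fun x => normal_peak s * expR (- (x ^+ 2 / (2 * s ^+ 2))));
  last first.
  by apply/funext => y; rewrite normal_pdf0E.
rewrite normal_pdf0E.
have h : is_derive x (1 : R) (fun x : R => - (x ^+ 2 / (2 * s ^+ 2))) (- (x / s ^+ 2)).
  by apply: is_derive_eq; rewrite /GRing.scale/=; field; rewrite gt_eqF.
apply: is_derive_eq; rewrite /GRing.scale/=; ring.
Qed.

(** Doubling the standard deviation leaves the exponent [3 * x ^+ 2 / (8 * s ^+ 2)] to absorb the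
    factor [|x|]. The bound supplies both the integrability of [x * pdf x] and the decay of the
    density at infinity. *)
Lemma abs_normal_pdf_le x : `|x| * pdf x <= 2 * (s + 1) ^+ 2 * normal_peak s / normal_peak (2 * s)
  * normal_pdf 0 (2 * s) x.
Proof.
have s2 : 0 < 2 * s by rewrite mulr_gt0.
have p0 : 0 < normal_peak (2 * s) by rewrite normal_peak_gt0// gt_eqF.
have ps0 : 0 < normal_peak s by rewrite normal_peak_gt0// gt_eqF.
rewrite (normal_pdfE 0 (lt0r_neq0 s2)) /normal_fun subr0 normal_pdf0E.
rewrite [leRHS]mulrA divfK ?gt_eqF//.
have -> : - (x ^+ 2 / (2 * s ^+ 2)) = - (3 * x ^+ 2 / (8 * s ^+ 2)) + - x ^+ 2 / ((2 * s) ^+ 2 *+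
  2).
  by field; rewrite gt_eqF.
rewrite expRD; set E := expR (- x ^+ 2 / _); set e1 := expR _.
rewrite (_ : `|x| * _ = (`|x| * e1) * (normal_peak s * E)); last by ring.
rewrite -[leRHS]mulrA ler_pM2r ?mulr_gt0 ?expR_gt0// /e1.
set z := 3 * x ^+ 2 / (8 * s ^+ 2).
rewrite expRN ler_pdivrMr ?expR_gt0//.
have h := expR_ge1Dx z.
apply: le_trans (_ : 2 * (s + 1) ^+ 2 * (1 + z) <= _); last by rewrite ler_wpM2l// mulr_ge0//
  sqr_ge0.
have sz : z * s ^+ 2 = 3 / 8 * x ^+ 2 by rewrite /z; field; rewrite gt_eqF.
have x2 : `|x| <= 1 / 2 * (1 + x ^+ 2).
  by rewrite -(real_normK (num_real x)); have := sqr_ge0 (`|x| - 1); rewrite sqrrB; lra.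
have z0 : 0 <= z by rewrite /z; apply: divr_ge0; apply: mulr_ge0 => //; exact: sqr_ge0.
rewrite (le_trans x2)//.
have : z * s ^+ 2 <= z * (s + 1) ^+ 2 by rewrite ler_wpM2l// lerXn2r ?nnegrE ?addr_ge0 ?(ltW s0)//
  lerDl.
have : 1 <= (s + 1) ^+ 2 by rewrite -[leLHS](expr1n _ 2) lerXn2r ?nnegrE ?addr_ge0 ?(ltW s0)//
  lerDr ltW.
rewrite sz; have := sqr_ge0 x; rewrite mulrDr mulr1.
rewrite [z * _]mulrC; set q := (s + 1) ^+ 2.
rewrite (_ : 2 * q * (1 + z) = 2 * q + 2 * (q * z)); last by ring.
set qz := q * z; lra.
Qed.

Lemma integrable_abs_normal_pdf : mu.-integrable [set: R] (EFin \o (fun x => `|x| * pdf x)).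
Proof.
pose c := 2 * (s + 1) ^+ 2 * normal_peak s / normal_peak (2 * s).
apply: (@le_integrable _ _ _ mu setT measurableT _ (EFin \o (fun x => c * normal_pdf 0 (2 * s) x))).
- apply/measurable_EFinP; apply: measurable_funM; last exact: measurable_normal_pdf.
  exact: normr_measurable.
- move=> x _ /=; rewrite lee_fin normrM normr_id (ger0_norm (normal_pdf_ge0 _ _ _)).
  by rewrite (le_trans (abs_normal_pdf_le x))// ler_norm.
- have := integrable_normal_pdf 0 (2 * s) => h.
  rewrite (_ : _ \o _ = (fun x => c%:E * (normal_pdf 0 (2 * s) x)%:E)%E); last by apply/funext.
  exact: integrableZl.
Qed.

(** The phase [ph] lets one family of cosines carry the real and the imaginary part of the
    characteristic function. *)
Definition cos_transform (ph a : R) := \int[mu]_x (cos (a * x + ph) * pdf x).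

Lemma integrable_trig_pdf (h : R -> R) (f : R -> R) : continuous h -> (forall y, `|h y| <= 1) ->
  measurable_fun [set: R] f -> mu.-integrable [set: R] (EFin \o f) ->
  mu.-integrable [set: R] (EFin \o (fun x => h x * f x)).
Proof.
move=> ch h1 mf fi; apply: (le_integrable measurableT _ _ fi).
  by apply/measurable_EFinP; apply: measurable_funM => //; exact: continuous_measurable_fun.
by move=> x _ /=; rewrite lee_fin normrM ler_piMl.
Qed.

Lemma norm_sin_le1 (y : R) : `|sin y| <= 1.
Proof. by rewrite ler_norml sin_geN1 sin_le1. Qed.

Lemma norm_cos_le1 (y : R) : `|cos y| <= 1.
Proof. by rewrite ler_norml cos_geN1 cos_le1. Qed.

Lemma continuous_affine_comp (h : R -> R) (a ph : R) : continuous h -> continuous (fun x =>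
  h (a * x + ph)).
Proof.
move=> ch x; apply: (@continuous_comp _ _ _ (fun x => a * x + ph) h); last exact: ch.
by apply: cvgD; [apply: cvgM; [exact: cvg_cst|exact: cvg_id]|exact: cvg_cst].
Qed.

Lemma is_derive_affine_comp (h dh : R -> R) (a ph x : R) : (forall x : R, is_derive x 1 h (dh x)) ->
  is_derive x 1 (fun x => h (a * x + ph)) (a * dh (a * x + ph)).
Proof.
move=> hd; have h1 := hd (a * x + ph).
have h2 : is_derive x (1 : R) (fun x : R => a * x + ph) a.
  by apply: is_derive_eq; rewrite /GRing.scale/=; ring.
by have := @is_derive1_comp _ h (fun x => a * x + ph) x _ _ h1 h2; rewrite mulrC.
Qed.

(** Stein's identity for the sine: the derivative of [sin (a * x + ph) * pdf x] integrates to 0. *)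
Lemma normal_stein_trig (ph a : R) :
  \int[mu]_x (sin (a * x + ph) * (x * pdf x)) = a * s ^+ 2 * cos_transform ph a.
Proof.
have ipdf := integrable_normal_pdf 0 s.
have mpdf : measurable_fun [set: R] pdf by exact: measurable_normal_pdf.
have cpdf : continuous pdf by apply: continuous_normal_pdf; rewrite gt_eqF.
have csin := @continuous_affine_comp _ a ph (@continuous_sin R).
have ccos := @continuous_affine_comp _ a ph (@continuous_cos R).
have mxpdf : measurable_fun [set: R] (fun x => x * pdf x) by exact: measurable_funM.
have ixpdf : mu.-integrable [set: R] (EFin \o (fun x => x * pdf x)).
  apply: (le_integrable measurableT _ _ integrable_abs_normal_pdf); first exact/measurable_EFinP.
  by move=> x _ /=; rewrite lee_fin !normrM normr_id.
have i1 := integrable_trig_pdf ccos (fun y => norm_cos_le1 _) mpdf ipdf.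
have i2 := integrable_trig_pdf csin (fun y => norm_sin_le1 _) mxpdf ixpdf.
pose g x := sin (a * x + ph) * pdf x.
pose dg x := a * (cos (a * x + ph) * pdf x) - s ^- 2 * (sin (a * x + ph) * (x * pdf x)).
have gdg (x : R) : is_derive x 1 g (dg x).
  have h1 := is_derive_affine_comp a ph x (@is_derive_sin R).
  have h2 := is_derive_normal_pdf0 x.
  apply: is_derive_eq; rewrite /GRing.scale/= /dg; ring.
have idg : mu.-integrable [set: R] (EFin \o dg).
  rewrite (_ : _ \o _ = (fun x => a%:E * (cos (a * x + ph) * pdf x)%:E -
     (s ^- 2)%:E * (sin (a * x + ph) * (x * pdf x))%:E)%E); last by apply/funext.
  by apply: integrableB => //; exact: integrableZl.
have cdg : continuous dg.
  move=> x; apply: cvgB; (apply: cvgM; first exact: cvg_cst); apply: cvgM.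
  - exact: ccos.
  - exact: cpdf.
  - exact: csin.
  - by apply: cvgM; [exact: cvg_id|exact: cpdf].
have gle x : x != 0 -> `|g x| <= 2 * (s + 1) ^+ 2 * normal_peak s / normal_peak (2 * s) *
  normal_peak (2 * s) * `|x|^-1.
  move=> x0; rewrite ler_pdivlMr ?normr_gt0// /g normrM [`|pdf x|]ger0_norm ?normal_pdf_ge0//.
  rewrite -[leLHS]mulrA [pdf x * `|x|]mulrC.
  apply: le_trans (_ : 1 * (`|x| * pdf x) <= _).
    by rewrite ler_wpM2r ?norm_sin_le1// mulr_ge0// normal_pdf_ge0.
  rewrite mul1r (le_trans (abs_normal_pdf_le x))// ler_wpM2l//.
    by rewrite !mulr_ge0 ?addr_ge0 ?(ltW s0) ?invr_ge0 ?normal_peak_ge0.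
  by apply: normal_pdf_ub; rewrite gt_eqF// mulr_gt0.
have lim (e : R) : `|e| = 1 -> g (e * n.+1%:R) @[n --> \oo] --> (0 : R).
  move=> e1; apply: norm_cvg0.
  set c := _ * normal_peak (2 * s) in gle.
  have cn : c * n.+1%:R^-1 @[n --> \oo] --> (0 : R).
    by rewrite -(mulr0 c); apply: cvgM; [exact: cvg_cst|exact: cvg_harmonic].
  apply: (@squeeze_cvgr _ _ _ _ (cst 0) _ _ _ _ _ cn); last exact: cvg_cst.
  apply: nearW => n; rewrite normr_ge0/=.
  have h : e * n.+1%:R != 0 by rewrite mulf_neq0 ?pnatr_eq0// -normr_gt0 e1.
  have e2 : `|e * n.+1%:R| = n.+1%:R by rewrite normrM e1 mul1r ger0_norm.
  by have := gle _ h; rewrite e2.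
have z := @Rintegral_derive_eq0 g dg gdg cdg idg.
have {}z : \int[mu]_x dg x = 0.
  apply: z.
    by have := lim 1; under eq_fun do rewrite mul1r; apply; rewrite normr1.
  by have := lim (- 1); under eq_fun do rewrite mulN1r; apply; rewrite normrN normr1.
move: z; rewrite /dg RintegralB//; last 2 first.
- by rewrite (_ : _ \o _ = (fun x => a%:E * (cos (a * x + ph) * pdf x)%:E)%E);
    [exact: integrableZl|apply/funext].
- by rewrite (_ : _ \o _ = (fun x => (s ^- 2)%:E * (sin (a * x + ph) * (x * pdf x))%:E)%E);
    [exact: integrableZl|apply/funext].
rewrite RintegralZl// RintegralZl// -/(cos_transform ph a).
move/eqP; rewrite subr_eq0 => /eqP e.
rewrite mulrAC e mulrC mulrA divff ?mul1r// sqrf_eq0 gt_eqF//.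
Qed.

(** Differentiation under the integral sign, dominated by [|x| * pdf x]; Stein's identity then
    closes the formula into a linear differential equation. *)
Lemma is_derive_cos_transform (ph a : R) :
  is_derive a 1 (cos_transform ph) (- (a * s ^+ 2) * cos_transform ph a).
Proof.
pose f (a x : R) : R := cos (a * x + ph) * pdf x.
have mpdf : measurable_fun [set: R] pdf by exact: measurable_normal_pdf.
have ipdf := integrable_normal_pdf 0 s.
have fd (b x : R) : is_derive b 1 (f ^~ x) (- (sin (b * x + ph) * (x * pdf x))).
  have h1 := is_derive_affine_comp x ph b (@is_derive_cos R).
  rewrite (_ : f ^~ x = fun b => cos (x * b + ph) * pdf x); last first.
    by apply/funext => b'; rewrite /f [x * b']mulrC.
  apply: is_derive_eq; rewrite /GRing.scale/= [x * b]mulrC; ring.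
have intf b : `]a - 1, a + 1[%classic b -> mu.-integrable setT (EFin \o f b).
  move=> _; apply: integrable_trig_pdf => //; last by move=> y; exact: norm_cos_le1.
  exact: continuous_affine_comp (@continuous_cos R).
have aI : `]a - 1, a + 1[%classic a by rewrite /= in_itv/= ltrBlDr ltrDl ltr01.
have df b x : `]a - 1, a + 1[%classic b -> [set: R] x -> derivable (f ^~ x) b 1.
  by move=> _ _; case: (fd b x).
have G0 x : 0 <= `|x| * pdf x by rewrite mulr_ge0 ?normal_pdf_ge0.
have Gub b x : `]a - 1, a + 1[%classic b -> [set: R] x -> `|partial1of2 f b x| <= `|x| * pdf x.
  move=> _ _; rewrite partial1of2E; have -> := @derive_val _ _ _ _ _ _ _ (fd b x).
  rewrite normrN !normrM [`|pdf x|]ger0_norm ?normal_pdf_ge0//.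
  by rewrite ler_piMl ?norm_sin_le1// mulr_ge0 ?normal_pdf_ge0.
have d1 := @derivable_under_integral R _ _ mu f setT measurableT a (a - 1) (a + 1) aI intf df _ G0
  integrable_abs_normal_pdf Gub.
have d2 := @differentiation_under_integral R _ _ mu f setT measurableT a (a - 1) (a + 1) aI intf df
  _ G0 integrable_abs_normal_pdf Gub.
apply: DeriveDef; first exact: d1.
rewrite -derive1E d2 mulNr -normal_stein_trig.
transitivity (\int[mu]_x (- 1 * (sin (a * x + ph) * (x * pdf x)))).
  apply: eq_Rintegral => x _; rewrite partial1of2E mulN1r.
  exact: (@derive_val _ _ _ _ _ _ _ (fd a x)).
rewrite RintegralZl ?mulN1r//.
apply: integrable_trig_pdf => //; last first.
- apply: (le_integrable measurableT _ _ integrable_abs_normal_pdf).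
    by apply/measurable_EFinP; exact: measurable_funM.
  by move=> x _ /=; rewrite lee_fin !normrM normr_id.
- exact: measurable_funM.
- by move=> y; exact: norm_sin_le1.
- exact: continuous_affine_comp (@continuous_sin R).
Qed.

(** Multiplying by the integrating factor [expR (a ^+ 2 * s ^+ 2 / 2)] gives a constant function of
    the frequency, read off at 0. *)
Lemma cos_transformE (ph a : R) : cos_transform ph a = expR (- (a ^+ 2 * s ^+ 2 / 2)) * cos ph.
Proof.
pose D b := cos_transform ph b * expR (b ^+ 2 * s ^+ 2 / 2).
have D0 (b : R) : is_derive b 1 D 0.
  have h1 := is_derive_cos_transform ph b.
  have h2 : is_derive b (1 : R) (fun b : R => b ^+ 2 * s ^+ 2 / 2) (b * s ^+ 2).
    by apply: is_derive_eq; rewrite /GRing.scale/=; field.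
  apply: is_derive_eq; rewrite /GRing.scale/=; ring.
have Dc : D a = D 0.
  apply/eqP; rewrite -subr_eq0 -normr_le0.
  by rewrite (le_trans (mvt_boundT _ _ D0 (B := 0) _))// ?mul0r// => ?; rewrite normr0.
have : D 0 = cos ph.
  rewrite /D expr0n/= !mul0r expR0 mulr1 /cos_transform.
  transitivity (\int[mu]_x (cos ph * pdf x)).
    by apply: eq_Rintegral => x _; rewrite mul0r add0r.
  rewrite RintegralZl//; last exact: integrable_normal_pdf.
  by rewrite /Rintegral integral_normal_pdf mulr1.
move=> D0E; rewrite -D0E -Dc /D mulrCA -expRD addrC subrr expR0 mulr1//.
Qed.

End normal_characteristic_function.

(** * Trigonometric polynomials approximating half-lines *)

Section sign_approximation.
Context {R : realType}.
Implicit Types y x s : R.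

(* Iterating [smoothstep], which fixes -1, 0 and 1 and pushes the rest of [-1, 1] to the sign, keeps
   trigonometric polynomials trigonometric polynomials. *)
Definition smoothstep y : R := (3 * y - y ^+ 3) / 2.

Lemma smoothstepN y : smoothstep (- y) = - smoothstep y.
Proof. rewrite /smoothstep; ring. Qed.

Lemma iter_smoothstepN n y : iter n smoothstep (- y) = - iter n smoothstep y.
Proof. by elim: n => //= n ->; rewrite smoothstepN. Qed.

(** [smoothstep y - y] is [y * (1 - y ^+ 2) / 2], and [1 - smoothstep y] is
    [(1 - y) ^+ 2 * (2 + y) / 2]. *)
Lemma smoothstep_01 y : 0 <= y <= 1 -> y <= smoothstep y <= 1.
Proof.
move=> /andP[y0 y1]; rewrite /smoothstep.
have h1 : 0 <= y * (1 - y ^+ 2) by rewrite mulr_ge0// subr_ge0 exprn_ile1.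
have h2 : 0 <= (1 - y) ^+ 2 * (2 + y) by rewrite mulr_ge0 ?sqr_ge0// addr_ge0.
apply/andP; split.
  by rewrite ler_pdivlMr//; move: h1; rewrite (_ : y * (1 - y ^+ 2) = y - y ^+ 3); [lra|ring].
rewrite ler_pdivrMr//; move: h2.
by rewrite (_ : (1 - y) ^+ 2 * (2 + y) = 2 - 3 * y + y ^+ 3); [lra|ring].
Qed.

Lemma iter_smoothstep_01 n y : 0 <= y <= 1 -> y <= iter n smoothstep y <= 1.
Proof.
move=> y01; elim: n => [|n /andP[ih1 ih2]] /=; first by rewrite lexx; case/andP: y01.
have /andP[y0 _] := y01.
have z01 : 0 <= iter n smoothstep y <= 1 by rewrite ih2 (le_trans y0).
by have /andP[h1 h2] := smoothstep_01 z01; rewrite (le_trans ih1).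
Qed.

Lemma iter_smoothstep_norm n y : `|y| <= 1 -> `|iter n smoothstep y| <= 1.
Proof.
move=> y1; have [y0|y0] := leP 0 y.
  have yy : 0 <= y <= 1 by rewrite y0 -(ger0_norm y0).
  by have /andP[h1 h2] := iter_smoothstep_01 n yy; rewrite ger0_norm// (le_trans y0).
rewrite -(opprK y) iter_smoothstepN normrN.
have yy : 0 <= - y <= 1 by rewrite oppr_ge0 (ltW y0)/= -(ltr0_norm y0).
have /andP[h1 h2] := iter_smoothstep_01 n yy; rewrite ger0_norm//.
by rewrite (le_trans _ h1)// oppr_ge0 ltW.
Qed.

Lemma iter_smoothstep_cvg y : 0 < y <= 1 -> iter n smoothstep y @[n --> \oo] --> (1 : R).
Proof.
move=> /andP[y0 y1].
have y01 : 0 <= y <= 1 by rewrite (ltW y0).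
(* One iteration multiplies [1 - z] by [(1 - z) * (2 + z) / 2], which is at most [1 - z / 2]; every
   iterate is at least [y], so [1 - y / 2] bounds all factors. *)
have rate n : 1 - iter n smoothstep y <= (1 - y / 2) ^+ n.
  elim: n => [|n ih]; first by rewrite expr0 lerBlDr lerDl ltW.
  have /andP[h1 h2] := iter_smoothstep_01 n y01.
  rewrite /= exprS; set z := iter n smoothstep y in ih h1 h2 *.
  have -> : 1 - smoothstep z = (1 - z) * (2 + z) / 2 * (1 - z) by rewrite /smoothstep; field.
  have z0 : 0 < z by exact: lt_le_trans h1.
  apply: ler_pM => //.
  - by rewrite divr_ge0// mulr_ge0 ?subr_ge0// addr_ge0// ltW.
  - by rewrite subr_ge0.
  have h : 0 <= z * z by rewrite mulr_ge0// ltW.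
  rewrite ler_pdivrMr// (_ : (1 - z) * (2 + z) = 2 - z - z * z); last by ring.
  lra.
have l0 : (1 - y / 2) ^+ n @[n --> \oo] --> (0 : R).
  by apply: cvg_expr; rewrite ger0_norm; lra.
have l1 : 1 - iter n smoothstep y @[n --> \oo] --> (0 : R).
  apply: (@squeeze_cvgr _ _ _ _ (cst 0) _ _ _ _ _ l0); last exact: cvg_cst.
  apply: nearW => n; rewrite rate andbT subr_ge0.
  by have /andP[] := iter_smoothstep_01 n y01.
rewrite -[X in _ --> X](subr0 1) (_ : (fun n => _) = (fun n => 1 - (1 - iter n smoothstep y))).
  by apply: cvgB => //; exact: cvg_cst.
by apply/funext => n; rewrite subKr.
Qed.

(** A quadratic in the iterate that maps the limits -1, 0, 1 to 0, 1, 1, so that the closed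
    half-line, endpoint included, is reached in the limit. *)
Definition step_approx n y : R := 1 - (iter n smoothstep y ^+ 2 - iter n smoothstep y) / 2.

Lemma step_approx_le n y : `|y| <= 1 -> `|step_approx n y| <= 2.
Proof.
move=> /(iter_smoothstep_norm n); rewrite /step_approx; set z := iter _ _ _ => z1.
have z2 : z ^+ 2 <= 1 by rewrite -(real_normK (num_real z)) exprn_ile1.
by have := sqr_ge0 z; move: z1; rewrite !ler_norml => /andP[? ?] ?; apply/andP; split; lra.
Qed.

Lemma step_approx_cvg y : `|y| <= 1 -> step_approx n y @[n --> \oo] --> ((0 <= y)%R%:R : R).
Proof.
move=> y1.
have gen (l : R) : iter n smoothstep y @[n --> \oo] --> l ->
    step_approx n y @[n --> \oo] --> 1 - (l ^+ 2 - l) / 2.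
  move=> h; apply: cvgB; first exact: cvg_cst.
  apply: cvgM; last exact: cvg_cst.
  by apply: cvgB => //; rewrite expr2; under eq_fun do rewrite expr2; apply: cvgM.
have [y0|y0|y0] := ltgtP 0 y.
- have := gen 1; rewrite expr1n subrr mul0r subr0; apply.
  by apply: iter_smoothstep_cvg; rewrite y0 -(gtr0_norm y0).
- have := gen (- 1); rewrite sqrrN expr1n opprK (_ : 1 - (1 + 1) / 2 = 0 :> R); last by field.
  apply; rewrite -(opprK y); under eq_fun do rewrite iter_smoothstepN.
  by apply: cvgN; apply: iter_smoothstep_cvg; rewrite oppr_gt0 y0/= -(ltr0_norm y0).
- have := gen 0; rewrite expr0n/= subrr mul0r subr0; apply.
  rewrite -y0; apply: cvg_near_cst; apply: nearW; elim=> //= n ->.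
  by rewrite /smoothstep expr0n/= mulr0 subrr mul0r.
Qed.

(* Lets [sin] stand for the identity inside a sign. *)
Lemma sin_scaled_sign x : \forall n \near \oo, (0 <= sin (n.+1%:R^-1 * x)) = (0 <= x).
Proof.
exists (Num.truncn (`|x| / pi)) => // n /= hn.
have n0 : 0 < n.+1%:R :> R by rewrite ltr0n.
have xpi : n.+1%:R^-1 * `|x| < pi.
  rewrite ltr_pdivrMl// -ltr_pdivrMr ?pi_gt0// (lt_le_trans (truncnS_gt _))//.
  by rewrite ler_nat ltnS.
have [x0|x0|x0] := ltgtP 0 x.
- by apply/ltW/sin_gt0_pi; rewrite mulr_gt0 ?invr_gt0//= -(gtr0_norm x0).
- apply/negbTE; rewrite -ltNge -(opprK x) mulrN sinN oppr_lt0; apply: sin_gt0_pi.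
  by rewrite mulr_gt0 ?invr_gt0 ?oppr_gt0//= -(ltr0_norm x0).
- by rewrite -x0 mulr0 sin0 lexx.
Qed.

(** With a phase, constants and sines are instances of the single base case, and product-to-sum
    formulas give closure under products. *)
Inductive trigpoly : (R -> R) -> Prop :=
| trig_cos a c ph : trigpoly (fun x => a * cos (c * x + ph))
| trig_add f g : trigpoly f -> trigpoly g -> trigpoly (fun x => f x + g x).

Lemma eq_trigpoly f g : f =1 g -> trigpoly f -> trigpoly g.
Proof. by move=> /funext ->. Qed.

Lemma trig_scale b f : trigpoly f -> trigpoly (fun x => b * f x).
Proof.
elim=> [a c ph|f1 f2 _ h1 _ h2].
  by apply: eq_trigpoly (trig_cos (b * a) c ph) => x; rewrite mulrA.
by apply: eq_trigpoly (trig_add h1 h2) => x; rewrite mulrDr.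
Qed.

Lemma trig_cst b : trigpoly (fun=> b).
Proof. by apply: eq_trigpoly (trig_cos b 0 0) => x; rewrite mul0r addr0 cos0 mulr1. Qed.

Lemma trig_mul f g : trigpoly f -> trigpoly g -> trigpoly (fun x => f x * g x).
Proof.
move=> hf hg; elim: hf => [a c ph|f1 f2 _ h1 _ h2]; last first.
  by apply: eq_trigpoly (trig_add h1 h2) => x; rewrite mulrDl.
elim: hg => [b c' ph'|f1 f2 _ h1 _ h2]; last first.
  by apply: eq_trigpoly (trig_add h1 h2) => x; rewrite mulrDr.
apply: eq_trigpoly (trig_add (trig_cos (a * b / 2) (c + c') (ph + ph')) (trig_cos (a * b / 2) (c -
  c') (ph - ph'))) => x.
have -> : (c + c') * x + (ph + ph') = (c * x + ph) + (c' * x + ph') by ring.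
have -> : (c - c') * x + (ph - ph') = (c * x + ph) - (c' * x + ph') by ring.
by rewrite cosB cosD; field.
Qed.

Lemma trig_smoothstep f : trigpoly f -> trigpoly (fun x => smoothstep (f x)).
Proof.
move=> hf; apply: eq_trigpoly (trig_add (trig_scale (3 / 2) hf) (trig_scale (- 2^-1) (trig_mul hf
  (trig_mul hf hf)))) => x.
by rewrite /smoothstep; field.
Qed.

Lemma trig_step_approx n f : trigpoly f -> trigpoly (fun x => step_approx n (f x)).
Proof.
move=> hf; have h : trigpoly (fun x => iter n smoothstep (f x)).
  by elim: n => //= n ih; exact: trig_smoothstep.
apply: eq_trigpoly (trig_add (trig_cst 1) (trig_add (trig_scale 2^-1 h) (trig_scale (- 2^-1)
  (trig_mul h h)))) => x.
by rewrite /step_approx; field.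
Qed.

Lemma trig_sin c s : trigpoly (fun x => sin (c * (x - s))).
Proof.
apply: eq_trigpoly (trig_cos 1 c (- (c * s) - pi / 2)) => x.
by rewrite mul1r addrA cosBpihalf mulrBr.
Qed.

Lemma trigpoly_bounded f : trigpoly f -> continuous f /\ exists K : R, forall x, `|f x| <= K.
Proof.
elim=> [a c ph|f1 f2 _ [c1 [K1 h1]] _ [c2 [K2 h2]]].
  split; last by exists `|a| => x; rewrite normrM ler_piMr// ler_norml cos_geN1 cos_le1.
  move=> x; apply: cvgM; first exact: cvg_cst.
  exact: (@continuous_affine_comp _ _ c ph (@continuous_cos R)).
split; first by move=> x; apply: cvgD; [exact: c1|exact: c2].
by exists (K1 + K2) => x; rewrite (le_trans (ler_normD _ _))// lerD.
Qed.

End sign_approximation.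

(** * Quadrant probabilities are determined by expectations of cosines *)

Section quadrant_uniqueness.
Context {R : realType}.

Lemma Er_dct d (T : measurableType d) (P : probability T R) (f_ : nat -> T -> R) (f : T ->
  R) (K : R) :
  (forall n, bmf (f_ n)) -> bmf f -> (forall n x, `|f_ n x| <= K) ->
  (forall x, f_ n x @[n --> \oo] --> f x) -> Er P (f_ n) @[n --> \oo] --> Er P f.
Proof.
move=> bf_ bf fK f_f.
have h1 n : measurable_fun [set: T] (EFin \o f_ n) by apply/measurable_EFinP; exact: (bf_ n).1.
have h1' : measurable_fun [set: T] (EFin \o f) by apply/measurable_EFinP; exact: bf.1.
have h2 : {ae P, forall x, setT x -> (fun n => (EFin \o f_ n) x) @ \oo --> (EFin \o f) x}.
  by apply: aeW => x _; apply: cvg_EFin; [exact: nearW|exact: f_f].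
have h3 : P.-integrable setT (EFin \o (fun=> K)) by apply: bmf_integrable; exact: bmf_cst.
have h4 : {ae P, forall x n, setT x -> (`|(EFin \o f_ n) x| <= (EFin \o (fun=> K)) x)%E}.
  by apply: aeW => x n _ /=; rewrite lee_fin.
have [_ _ h] := @dominated_convergence _ _ _ P setT measurableT _ _ _ h1 h1' h2 h3 h4.
apply: fine_cvg; rewrite /Er /Rintegral fineK; first exact: h.
exact/integrable_fin_num/bmf_integrable.
Qed.

Context d1 (T1 : measurableType d1) (P1 : probability T1 R) d2 (T2 : measurableType d2) (P2 :
  probability T2 R)
  (X1 Y1 : T1 -> R) (X2 Y2 : T2 -> R).
Hypotheses (mX1 : measurable_fun [set: T1] X1) (mY1 : measurable_fun [set: T1] Y1)
  (mX2 : measurable_fun [set: T2] X2) (mY2 : measurable_fun [set: T2] Y2)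
  (cosE : forall c e ph : R, Er P1 (fun u => cos (c * X1 u + e * Y1 u + ph)) =
    Er P2 (fun u => cos (c * X2 u + e * Y2 u + ph))).

Lemma bmf_trig d (T : measurableType d) (X : T -> R) f : measurable_fun [set: T] X -> trigpoly f ->
  bmf (fun u => f (X u)).
Proof.
move=> mX /trigpoly_bounded[cf [K fK]]; apply: bmf_comp => //; last by exists K.
exact: continuous_measurable_fun.
Qed.

(** Product-to-sum formulas turn a product of cosines in the two coordinates into cosines of linear
    combinations, where [cosE] applies. *)
Lemma trig_Er f g : trigpoly f -> trigpoly g ->
  Er P1 (fun u => f (X1 u) * g (Y1 u)) = Er P2 (fun u => f (X2 u) * g (Y2 u)).
Proof.
move=> hf hg; elim: hf => [a c ph|f1 f2 t1 h1 t2 h2]; last first.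
  under eq_Er do rewrite mulrDl; under [RHS]eq_Er do rewrite mulrDl.
  by rewrite !ErD ?h1 ?h2//; apply: bmfM; exact: bmf_trig.
elim: hg => [b c' ph'|f1 f2 t1 h1 t2 h2]; last first.
  have t0 := trig_cos a c ph.
  under eq_Er do rewrite mulrDr; under [RHS]eq_Er do rewrite mulrDr.
  have b1 := bmf_trig mX1 t0; have b2 := bmf_trig mX2 t0.
  by rewrite !ErD ?h1 ?h2//; apply: bmfM => //; exact: bmf_trig.
have prodE (x y : R) : a * cos (c * x + ph) * (b * cos (c' * y + ph')) =
    a * b / 2 * (cos (c * x + c' * y + (ph + ph')) + cos (c * x + - c' * y + (ph - ph'))).
  have -> : c * x + c' * y + (ph + ph') = (c * x + ph) + (c' * y + ph') by ring.
  have -> : c * x + - c' * y + (ph - ph') = (c * x + ph) - (c' * y + ph') by ring.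
  by move: (c * x + ph) (c' * y + ph') => A B; rewrite cosB cosD; field.
under eq_Er do rewrite prodE; under [RHS]eq_Er do rewrite prodE.
have bc d (T : measurableType d) (X Y : T -> R) e e' ph0 : measurable_fun [set: T] X ->
  measurable_fun [set: T] Y ->
    bmf (fun u => cos (e * X u + e' * Y u + ph0)).
  move=> mX mY; apply: (@bmf_comp _ _ _ cos).
  - by apply: continuous_measurable_fun; exact: continuous_cos.
  - by exists 1 => y; rewrite ler_norml cos_geN1 cos_le1.
  - apply: measurable_funD; last exact: measurable_cst.
    by apply: measurable_funD; apply: measurable_funM => //; exact: measurable_cst.
rewrite !ErZ ?ErD ?cosE//; try exact: bc; by apply: bmfD; exact: bc.
Qed.

Lemma bmf_ge0 d (T : measurableType d) (X : T -> R) : measurable_fun [set: T] X ->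
  bmf (fun u => (0 <= X u)%R%:R : R).
Proof.
move=> mX; apply: bmf_bool; rewrite -[X in measurable X]setTI.
rewrite (_ : [set x | _] = X @^-1` `[0, +oo[); first exact: mX.
by apply/seteqP; split => x /=; rewrite in_itv/= andbT.
Qed.

Lemma ge0_sin_Er N s t :
  Er P1 (fun u => (0 <= sin (N.+1%:R^-1 * (X1 u - s)))%R%:R * (0 <= sin (N.+1%:R^-1 * (Y1 u -
    t)))%R%:R) =
  Er P2 (fun u => (0 <= sin (N.+1%:R^-1 * (X2 u - s)))%R%:R * (0 <= sin (N.+1%:R^-1 * (Y2 u -
    t)))%R%:R).
Proof.
have tr n r : trigpoly (fun x : R => step_approx n (sin (N.+1%:R^-1 * (x - r)))).
  exact: trig_step_approx (trig_sin _ _).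
have sin1 (y : R) : `|sin y| <= 1 by rewrite ler_norml sin_geN1 sin_le1.
have lim d (T : measurableType d) (P : probability T R) (X Y : T -> R) :
    measurable_fun [set: T] X -> measurable_fun [set: T] Y ->
  Er P (fun u => step_approx n (sin (N.+1%:R^-1 * (X u - s))) * step_approx n (sin (N.+1%:R^-1 * (Y
    u - t))))
    @[n --> \oo] -->
  Er P (fun u => (0 <= sin (N.+1%:R^-1 * (X u - s)))%R%:R * (0 <= sin (N.+1%:R^-1 * (Y u -
    t)))%R%:R).
  move=> mX mY.
  have ms (Z : T -> R) r : measurable_fun [set: T] Z -> measurable_fun [set: T] (fun u =>
    sin (N.+1%:R^-1 * (Z u - r))).
    move=> mZ; have m1 : measurable_fun [set: T] (fun u => N.+1%:R^-1 * (Z u - r)).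
      by apply: measurable_funM; [exact: measurable_cst|apply: measurable_funB => //;
        exact: measurable_cst].
    exact: (measurableT_comp (continuous_measurable_fun (@continuous_sin R)) m1).
  apply: (@Er_dct _ _ _ _ _ (2 * 2)).
  - by move=> n; apply: bmfM; [exact: (bmf_trig mX (tr n s))|exact: (bmf_trig mY (tr n t))].
  - by apply: bmfM; apply: bmf_ge0; exact: ms.
  - by move=> n x; rewrite normrM ler_pM// step_approx_le.
  - by move=> x; apply: cvgM; apply: step_approx_cvg.
have l1 := lim _ _ P1 _ _ mX1 mY1; have l2 := lim _ _ P2 _ _ mX2 mY2.
apply: (cvg_unique (@Rhausdorff R) l1 _); rewrite [X in X @ _](_ : _ = (fun n =>
  Er P2 (fun u => step_approx n (sin (N.+1%:R^-1 * (X2 u - s))) * step_approx n (sin (N.+1%:R^-1 *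
    (Y2 u - t))))))//.
by apply/funext => n; exact: (trig_Er (tr n s) (tr n t)).
Qed.

(** Two nested limits: for fixed [N] the step approximations give the signs of the sines, then [N]
    grows and the sines are replaced by their arguments. Convergence holds at every point, the
    boundary of the quadrant included, so atoms and singular joint laws are covered. *)
Theorem quadrant_eq s t :
  fine (P1 [set u | s <= X1 u /\ t <= Y1 u]) = fine (P2 [set u | s <= X2 u /\ t <= Y2 u]).
Proof.
have lim d (T : measurableType d) (P : probability T R) (X Y : T -> R) :
    measurable_fun [set: T] X -> measurable_fun [set: T] Y ->
  Er P (fun u => (0 <= sin (N.+1%:R^-1 * (X u - s)))%R%:R * (0 <= sin (N.+1%:R^-1 * (Y u -
    t)))%R%:R)
    @[N --> \oo] --> fine (P [set u | s <= X u /\ t <= Y u]).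
  move=> mX mY.
  have ms (Z : T -> R) (c r : R) : measurable_fun [set: T] Z -> measurable_fun [set: T] (fun u =>
    sin (c * (Z u - r))).
    move=> mZ; have m1 : measurable_fun [set: T] (fun u => c * (Z u - r)).
      by apply: measurable_funM; [exact: measurable_cst|apply: measurable_funB => //;
        exact: measurable_cst].
    exact: (measurableT_comp (continuous_measurable_fun (@continuous_sin R)) m1).
  have mB (Z : T -> R) (r : R) : measurable_fun [set: T] Z -> measurable_fun [set: T] (fun u =>
    Z u - r).
    by move=> mZ; apply: measurable_funB => //; exact: measurable_cst.
  have -> : fine (P [set u | s <= X u /\ t <= Y u]) =
      Er P (fun u => (0 <= X u - s)%R%:R * (0 <= Y u - t)%R%:R).
    have mA (Z : T -> R) (r : R) : measurable_fun [set: T] Z -> measurable [set u | r <= Z u].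
      move=> mZ; rewrite -[X in measurable X]setTI (_ : [set u | _] = Z @^-1` `[r, +oo[);
        first exact: mZ.
      by apply/seteqP; split => u /=; rewrite in_itv/= andbT.
    rewrite -Er_indic; last exact: (measurableI _ _ (mA _ s mX) (mA _ t mY)).
    apply: eq_Er => u; rewrite !subr_ge0 -natrM mulnb indicE; congr (nat_of_bool _)%:R.
    by apply/idP/andP => [/set_mem//|h]; rewrite inE.
  apply: (@Er_dct _ _ _ _ _ 1).
  - by move=> n; apply: bmfM; apply: bmf_ge0; exact: ms.
  - by apply: bmfM; apply: bmf_ge0; exact: mB.
  - by move=> n x; rewrite -natrM mulnb; case: (_ && _); rewrite ?normr1 ?normr0.
  - move=> x; apply: cvg_near_cst.
    have h1 := sin_scaled_sign (X x - s); have h2 := sin_scaled_sign (Y x - t).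
    by apply: filterS2 h1 h2 => n -> ->.
have l1 := lim _ _ P1 _ _ mX1 mY1; have l2 := lim _ _ P2 _ _ mX2 mY2.
apply: (cvg_unique (@Rhausdorff R) l1 _); rewrite [X in X @ _](_ : _ = (fun N =>
  Er P2 (fun u => (0 <= sin (N.+1%:R^-1 * (X2 u - s)))%R%:R * (0 <= sin (N.+1%:R^-1 * (Y2 u -
    t)))%R%:R)))//.
by apply/funext => N; exact: ge0_sin_Er.
Qed.

End quadrant_uniqueness.

(** * Quadrant probabilities of Gaussian pairs *)

Section gaussian_pairs.
Context {R : realType}.
Local Notation mu := (@lebesgue_measure R).
Local Notation mR := (measurableTypeR R).

Lemma Er_pushforward d (T : measurableType d) (P : probability T R) d' (E : measurableType d')
    (Q : probability E R) (X : T -> E) (f : E -> R) : measurable_fun [set: T] X ->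
  (forall A, measurable A -> P (X @^-1` A) = Q A) -> bmf f -> Er P (fun u => f (X u)) = Er Q f.
Proof.
move=> mX XQ bf; rewrite /Er /Rintegral; congr fine.
have bfX : bmf (fun u => f (X u)).
  have [mf [K fK]] := bf.
  by split; [exact: measurableT_comp|exists K => x].
have h := @integral_pushforward _ _ _ _ _ _ mX P setT (EFin \o f).
transitivity (\int[pushforward P X]_(y in setT) (EFin \o f) y)%E; last first.
  apply: eq_measure_integral => A mA _; exact: XQ.
rewrite h//.
  by apply/measurable_EFinP; exact: bf.1.
exact: bmf_integrable.
Qed.

(** The law is absolutely continuous, and its Radon-Nikodym derivative agrees almost everywhere with
    [normal_pdf]. *)
Lemma Er_normal_prob (s : R) (f : mR -> R) : bmf f ->
  Er (normal_prob 0 s) f = \int[mu]_x (f x * normal_pdf 0 s x).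
Proof.
move=> bf; rewrite /Er /Rintegral; congr fine.
have dom := @normal_prob_dominates R 0 s.
rewrite -(Radon_Nikodym_change_of_variables dom)//=; last exact: (bmf_integrable _ bf).
have mf : measurable_fun [set: measurableTypeR R] (EFin \o f) by apply/measurable_EFinP;
  exact: bf.1.
apply: ae_eq_integral => //.
- by apply: emeasurable_funM => //; apply: (measurable_int mu).
- under eq_fun do rewrite EFinM.
  apply: emeasurable_funM => //=; apply/measurable_EFinP.
  exact: measurable_normal_pdf.
- under [X in ae_eq _ _ _ X]eq_fun do rewrite EFinM.
  apply: ae_eqe_mul2l => /=.
  apply: integral_ae_eq => //=.
  + apply: Radon_Nikodym_integrable; exact: dom.
  + by apply/measurable_EFinP; exact: measurable_normal_pdf.
  + by move=> E _ mE; rewrite -Radon_Nikodym_integral//; exact: dom.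
Qed.

Lemma bmf_cos_affine d (T : measurableType d) (X : T -> R) (c ph : R) : measurable_fun [set: T] X ->
  bmf (fun u => cos (c * X u + ph)).
Proof.
move=> mX; apply: (@bmf_comp _ _ _ cos).
- by apply: continuous_measurable_fun; exact: continuous_cos.
- by exists 1 => y; rewrite norm_cos_le1.
- apply: measurable_funD; last exact: measurable_cst.
  by apply: measurable_funM => //; exact: measurable_cst.
Qed.

Lemma Er_cos_normal (s c ph : R) : 0 < s ->
  Er (normal_prob 0 s) (fun x => cos (c * x + ph)) = expR (- (c ^+ 2 * s ^+ 2 / 2)) * cos ph.
Proof.
move=> s0; rewrite Er_normal_prob; first exact: (cos_transformE s0 ph c).
exact: (@bmf_cos_affine _ mR idfun).
Qed.

Lemma Er_cos_centered_normal d (T : measurableType d) (P : probability T R) (X : T ->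
  R) (v ph : R) :
  0 <= v -> measurable_fun [set: T] X -> has_law P X (centered_normal v) ->
  Er P (fun u => cos (X u + ph)) = expR (- (v / 2)) * cos ph.
Proof.
move=> v0 mX; rewrite /centered_normal; have [-> XP|vn0 XP] := eqVneq v 0.
  rewrite mul0r oppr0 expR0 mul1r.
  rewrite (@Er_pushforward _ _ _ _ _ (\d_(0 : R)) X (fun x => cos (x + ph)))//; last first.
    by under eq_fun do rewrite -[_ + ph](mul1r) mulrDr !mul1r;
      have := @bmf_cos_affine _ _ idfun 1 ph (@measurable_id _ _ _); under eq_fun do rewrite mul1r.
  rewrite /Er /Rintegral integral_dirac//.
    by rewrite diracT mul1e/= add0r.
  apply/measurable_EFinP.
  have := @bmf_cos_affine _ _ idfun 1 ph (@measurable_id _ R setT).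
  by under eq_fun do rewrite mul1r; case.
have v0' : 0 < v by rewrite lt0r vn0.
have s0 : 0 < Num.sqrt v by rewrite sqrtr_gt0.
transitivity (Er P (fun u => cos (1 * X u + ph))); first by apply: eq_Er => u; rewrite mul1r.
rewrite (@Er_pushforward _ _ _ _ _ (normal_prob 0 (Num.sqrt v)) X (fun x => cos (1 * x + ph)))//.
  by rewrite Er_cos_normal// expr1n mul1r sqr_sqrtr.
exact: bmf_cos_affine.
Qed.

Lemma Er_cos_normal_pair (c e ph : R) :
  Er (normal_prob (0 : R) 1 \x normal_prob (0 : R) 1)%E (fun z : mR * mR =>
    cos (c * z.1 + e * z.2 + ph)) =
  expR (- ((c ^+ 2 + e ^+ 2) / 2)) * cos ph.
Proof.
pose f (z : mR * mR) : \bar R := (cos (c * z.1 + e * z.2 + ph))%:E.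
have bf : bmf (fun z : mR * mR => cos (c * z.1 + e * z.2 + ph)).
  apply: (@bmf_comp _ _ _ cos).
  - by apply: continuous_measurable_fun; exact: continuous_cos.
  - by exists 1 => y; rewrite norm_cos_le1.
  - apply: measurable_funD; last exact: measurable_cst.
    by apply: measurable_funD; apply: measurable_funM => //; exact: measurable_cst.
have h := @integral12_prod_meas1 _ _ _ _ _ (normal_prob (0 : R) 1) (normal_prob (0 : R) 1) f
   (bmf_integrable _ bf).
rewrite /Er /Rintegral -[X in fine X]h /fubini_F.
have inner x : (\int[normal_prob 0 1]_y f (x, y))%E = (expR (- (e ^+ 2 / 2)) * cos (c * x + ph))%:E.
  have := @Er_cos_normal 1 e (c * x + ph) ltr01; rewrite expr1n mulr1 => <-.
  rewrite /Er /Rintegral fineK.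
    by apply: eq_integral => y _; rewrite /f/=; congr (cos _)%:E; ring.
  by apply/integrable_fin_num => //; apply: bmf_integrable; exact: (@bmf_cos_affine _ mR idfun).
under eq_integral do rewrite inner.
rewrite -/(Rintegral _ _ _) -/(Er _ _) ErZ; last exact: (@bmf_cos_affine _ mR idfun).
by rewrite Er_cos_normal// expr1n mulr1 mulrA -expRD; congr (expR _ * _); field.
Qed.

Lemma quad_form_delta n (S : 'M[R]_n) i j (a b : R) : S^T = S ->
  ((a *: delta_mx 0 i + b *: delta_mx 0 j) *m S *m
   (a *: delta_mx 0 i + b *: delta_mx 0 j)^T) (0 : 'I_1) (0 : 'I_1) =
  a ^+ 2 * S i i + b ^+ 2 * S j j + 2 * a * b * S i j.
Proof.
move=> Ssym; have -> : S i j = S j i by rewrite -{1}Ssym mxE.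
rewrite linearD/= !linearZ/= !trmx_delta !mulmxDl !mulmxDr -!scalemxAl -!scalemxAr.
rewrite -!rowE -!colE !mxE.
have -> : S i j = S j i by rewrite -{1}Ssym mxE.
ring.
Qed.

Context d (T : measurableType d) (P : probability T R) (n : nat) (S : 'M[R]_n) (X : 'I_n -> T -> R).
Hypotheses (gX : gaussian_vector P S X) (mX : forall i, measurable_fun [set: T] (X i))
  (S0 : forall i, 0 < S i i).

Lemma corr_mx_normE i j : corr_mx S i j = S i j / (Num.sqrt (S i i) * Num.sqrt (S j j)).
Proof. by rewrite mxE sqrtrM// ltW. Qed.

Lemma gaussian_pair_var i j (c e : R) :
  let a := c / Num.sqrt (S i i) in let b := e / Num.sqrt (S j j) in
  a ^+ 2 * S i i + b ^+ 2 * S j j + 2 * a * b * S i j = c ^+ 2 + e ^+ 2 + 2 * c * e * corr_mx S i j.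
Proof.
move=> a b; rewrite /a /b corr_mx_normE; have si : 0 < Num.sqrt (S i i) by rewrite sqrtr_gt0.
have sj : 0 < Num.sqrt (S j j) by rewrite sqrtr_gt0.
have := sqr_sqrtr (ltW (S0 i)); have := sqr_sqrtr (ltW (S0 j)).
move: (Num.sqrt (S i i)) (Num.sqrt (S j j)) si sj => x y x0 y0 <- <-.
by field; rewrite !gt_eqF.
Qed.

Lemma gaussian_pair_var_ge0 i j (c e : R) : 0 <= c ^+ 2 + e ^+ 2 + 2 * c * e * corr_mx S i j.
Proof.
have [Ssym Spos _] := gX.
rewrite -gaussian_pair_var -quad_form_delta//; exact: Spos.
Qed.

(** The variance of the combination with coefficients [- r] and 1 is exactly [1 - r ^+ 2]. *)
Lemma corr_mx_sqr_le1 i j : 0 <= 1 - corr_mx S i j ^+ 2.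
Proof. by have := gaussian_pair_var_ge0 i j (- corr_mx S i j) 1; move: (corr_mx S i j) => r;
  nra. Qed.

Lemma gaussian_pair_cos i j (c e ph : R) :
  Er P (fun u => cos (c * (X i u / Num.sqrt (S i i)) + e * (X j u / Num.sqrt (S j j)) + ph)) =
  expR (- ((c ^+ 2 + e ^+ 2 + 2 * c * e * corr_mx S i j) / 2)) * cos ph.
Proof.
have [Ssym Spos Xlaw] := gX.
pose v : 'rV[R]_n := (c / Num.sqrt (S i i)) *: delta_mx 0 i + (e / Num.sqrt (S j j)) *: delta_mx 0
  j.
have vE u : \sum_k v 0 k * X k u = c * (X i u / Num.sqrt (S i i)) + e * (X j u / Num.sqrt (S j j)).
  under eq_bigr do rewrite !mxE !eqxx/= mulrDl.
  rewrite big_split/= (bigD1 i)//= eqxx big1 => [|k ki]; last by rewrite (negbTE ki) mulr0 mul0r.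
  rewrite (bigD1 j)//= eqxx big1 => [|k ki]; last by rewrite (negbTE ki) mulr0 mul0r.
  by rewrite !mulr1 !addr0 !mulrA ![_ / _ * _]mulrAC.
rewrite -gaussian_pair_var -quad_form_delta// -/v.
rewrite -(Er_cos_centered_normal ph (Spos v) _ (Xlaw v)); last first.
  by apply: measurable_sum => k; apply: measurable_funM => //; exact: measurable_cst.
by apply: eq_Er => u; rewrite vE.
Qed.

(** Both pairs have the same expectations of cosines, since
    [(c + e * r) ^+ 2 + e ^+ 2 * (1 - r ^+ 2)] equals [c ^+ 2 + e ^+ 2 + 2 * c * e * r]; a
    correlation of absolute value 1 is included. *)
Lemma gaussian_pair_quadrant i j (s t : R) :
  fine (P [set u | s <= X i u / Num.sqrt (S i i) /\ t <= X j u / Num.sqrt (S j j)]) =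
  fine (bivariate_normal (corr_mx S i j) [set z : R * R | s <= z.1 /\ t <= z.2]).
Proof.
set r := corr_mx S i j.
have mD k : measurable_fun [set: T] (fun u => X k u / Num.sqrt (S k k)).
  by apply: measurable_funM => //; exact: measurable_cst.
pose Y (z : mR * mR) : R := r * z.1 + Num.sqrt (1 - r ^+ 2) * z.2.
have m1 : measurable_fun [set: mR * mR] (fun z : mR * mR => z.1 : R) by exact: measurable_fst.
have m2 : measurable_fun [set: mR * mR] (fun z : mR * mR => z.2 : R) by exact: measurable_snd.
have mY : measurable_fun [set: mR * mR] Y.
  by apply: measurable_funD; apply: measurable_funM => //; exact: measurable_cst.
have h := @quadrant_eq R _ T P _ _ (normal_prob (0 : R) 1 \x normal_prob (0 : R) 1)%E
  (fun u => X i u / Num.sqrt (S i i)) (fun u => X j u / Num.sqrt (S j j)) (fun z => z.1) Y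
  (mD i) (mD j) m1 mY _ s t.
rewrite h// => c e ph; rewrite gaussian_pair_cos.
transitivity (Er (normal_prob (0 : R) 1 \x normal_prob (0 : R) 1)%E
   (fun z : mR * mR => cos ((c + e * r) * z.1 + (e * Num.sqrt (1 - r ^+ 2)) * z.2 + ph)));
     last first.
  by apply: eq_Er => z; rewrite /Y; congr cos; ring.
rewrite Er_cos_normal_pair exprMn sqr_sqrtr; last exact: corr_mx_sqr_le1.
by congr (expR _ * _); rewrite -/r; field.
Qed.

End gaussian_pairs.

(** * Variance of mixing sums *)

Lemma sum_near_far (R : realType) (al : nat -> R) (c : R) l m :
  \sum_(1 <= k < m.+1) ((k <= l)%N%:R * c + (l < k)%N%:R * (4 * al k)) =
  (minn m l)%:R * c + 4 * \sum_(l.+1 <= k < m.+1) al k.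
Proof.
elim: m => [|m ih]; first by rewrite min0n !big_geq// mul0r mulr0 addr0.
rewrite big_nat_recr//= ih; have [ml|ml] := leqP m.+1 l.
  rewrite !big_geq//; last exact: ltnW.
  rewrite (minn_idPl (ltnW ml)) mulr0 mul0r !addr0 mul1r -[in RHS]natr1 mulrDl mul1r //.
rewrite [in RHS]big_nat_recr//= (_ : minn m l = l); last exact/minn_idPr.
by rewrite mulrDr mul0r mul1r add0r addrA.
Qed.

Section mixing_variance.
Context d (T : measurableType d) (R : realType) (P : probability T R).

Local Notation bmf := (@bmf _ T R).
Local Notation Er := (Er P).
Local Notation cov := (cov P).

Lemma cov_shift f g (a b : R) : bmf f -> bmf g -> cov (fun u => f u - a) (fun u =>
  g u - b) = cov f g.
Proof.
move=> bf bg; have bc (c : R) : bmf (fun=> c) by exact: bmf_cst.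
by rewrite covBl ?cov_cstl ?subr0 1?covC ?covBl ?cov_cstl ?subr0 1?covC//; exact: bmfB.
Qed.

Lemma Er_centered_mul f g : bmf f -> bmf g ->
  Er (fun u => (f u - Er f) * (g u - Er g)) = cov f g.
Proof.
move=> bf bg; have bc (c : R) : bmf (fun=> c) by exact: bmf_cst.
rewrite -(cov_shift (Er f) (Er g))// /cov (ErB P bf)// (ErB P bg)// !Er_cst.
by rewrite !subrr mulr0 subr0.
Qed.

Lemma norm_cov_le_Er f g v : bmf f -> bmf g -> (forall u, `|f u| <= 1) -> Er (fun u =>
  `|g u|) <= v ->
  `|cov f g| <= 2 * v.
Proof.
move=> bf bg f1 gv; have bn := bmf_norm bg.
rewrite /cov (le_trans (ler_normB _ _))// (_ : 2 * v = v + v); last by rewrite mulr2n mulrDl mul1r.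
apply: lerD.
  apply: le_trans (norm_Er_norm P (bmfM bf bg)) _; apply: le_trans gv; apply: le_Er => //.
    exact/bmf_norm/bmfM.
  by move=> u; rewrite normrM ler_piMl.
rewrite normrM; apply: le_trans gv; rewrite (le_trans _ (norm_Er_norm P bg))// ler_piMl//.
exact: norm_Er_le.
Qed.

(* Lags up to [l] are controlled by the first moment [v], larger ones by mixing; a small [v] makes
   the increments of the empirical process small. *)
Lemma mixing_sum_variance (x : nat -> T -> R) al (v t : R) l m :
  (forall i, bmf (x i)) -> (forall i u, `|x i u| <= 1) -> row_mixing P x al ->
  (forall i, Er (fun u => `|x i u|) <= v) -> (forall k, 0 <= al k) ->
  (forall N, \sum_(l.+1 <= k < N) al k <= t) ->
  Er (fun u => (\sum_(0 <= j < m) (x j u - Er (x j))) ^+ 2) <= m%:R * ((4 * l%:R + 2) * v + 8 * t).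
Proof.
move=> bx x1 mix xv al0 alt.
have v0 : 0 <= v by rewrite (le_trans _ (xv 0))//; apply: Er_ge0.
have by_ j : bmf (fun u => x j u - Er (x j)) by apply: bmfB => //; exact: bmf_cst.
elim: m => [|m ih].
  by under eq_Er do rewrite big_geq// expr0n; rewrite Er_cst mul0r.
set S := fun u => \sum_(0 <= j < m) (x j u - Er (x j)).
have bS : bmf S by exact: bmf_sum.
set y := fun u => x m u - Er (x m).
have bym : bmf y by exact: by_.
rewrite (_ : Er _ = Er (fun u => S u ^+ 2) + 2 * Er (fun u => S u * y u) + Er (fun u =>
  y u * y u)); last first.
  rewrite -ErZ; last exact: bmfM.
  rewrite -ErD; [|exact: bmfX|by apply: bmfZ; exact: bmfM].
  rewrite -ErD; [|by apply: bmfD; [exact: bmfX|apply: bmfZ; exact: bmfM]|exact: bmfM].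
  by apply: eq_Er => u; rewrite big_nat_recr//= -/(S u) -/(y u); ring.
have h1 : Er (fun u => y u * y u) <= 2 * v.
  by rewrite Er_centered_mul// (le_trans (ler_norm _))// norm_cov_le_Er.
have h2 : Er (fun u => S u * y u) <= 2 * l%:R * v + 4 * t.
  under eq_Er do rewrite /S mulr_suml.
  rewrite Er_sum; last by move=> j; exact: bmfM.
  under eq_bigr do rewrite Er_centered_mul//.
  (* Bounds the covariance at lag [k]: first moments up to lag [l], mixing beyond. Twice its sum and
     the diagonal term [2 * v] give the increment [(4 * l%:R + 2) * v + 8 * t]. *)
  pose g k : R := (k <= l)%N%:R * (2 * v) + (l < k)%N%:R * (4 * al k).
  apply: (@le_trans _ _ (\sum_(0 <= j < m) g (m - j)%N)).
    rewrite big_nat [leRHS]big_nat; apply: ler_sum => j /andP[_ jm].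
    apply: (le_trans (ler_norm _)); rewrite /g; have [kl|kl] := leqP (m - j) l.
      by rewrite mul0r addr0 mul1r norm_cov_le_Er.
    rewrite mul0r add0r mul1r; have -> : 4 * al (m - j)%N = 4 * 1 * 1 * al (m - j)%N
      by rewrite !mulr1.
    apply: (@mixing_cov _ _ _ _ _ _ bx mix j.+1) => //.
      by apply: (@sm_coord _ _ _ _ _ _ x _ j id); [rewrite /=|exact: measurable_id].
    by apply: (@sm_coord _ _ _ _ _ _ x _ m id); [rewrite /= addSn subnKC//
      ltnW|exact: measurable_id].
  have -> : \sum_(0 <= j < m) g (m - j)%N = \sum_(1 <= k < m.+1) g k.
    rewrite big_add1/= big_nat_rev/= big_nat [RHS]big_nat; apply: eq_bigr => j /andP[_ jm].
    by congr g; rewrite add0n subKn.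
  rewrite sum_near_far lerD ?ler_pM2l// mulrCA mulrA ler_wpM2r// ler_wpM2l// ler_nat.
  exact: geq_minr.
rewrite -[m.+1%:R]natr1 [leRHS]mulrDl mul1r; rewrite (_ : (4 * l%:R + 2) * v + 8 * t = 2 * (2 *
  l%:R * v + 4 * t) + 2 * v) in ih *; last by ring.
by rewrite -addrA lerD// lerD// ler_pM2l.
Qed.

End mixing_variance.

(** Termwise comparison: [Q - 2 >= 1], and since [al k <= 1] and the exponent is at most 1, [al k]
    is below its power. *)
Lemma mixing_rate_summable (R : realType) (al : nat -> R) (Q : nat) (g : R) :
  (forall n, 0 <= al n <= 1) -> ~~ odd Q -> (2 < Q)%N -> 0 < g ->
  (\sum_(1 <= n <oo) (n%:R ^+ (Q - 2) * al n `^ (g / (Q%:R + g)))%:E < +oo)%E ->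
  cvgn (series (fun k => k%:R * al k)).
Proof.
move=> al01 oQ Q2 g0 fin.
have Q4 : (1 <= Q - 2)%N by lia.
have e0 : 0 < g / (Q%:R + g) by rewrite divr_gt0// addr_gt0// ltr0n; lia.
have e1 : g / (Q%:R + g) <= 1 by rewrite ler_pdivrMr ?mul1r ?lerDr// addr_gt0// ltr0n; lia.
set u := fun n => (n%:R ^+ (Q - 2) * al n `^ (g / (Q%:R + g)))%:E in fin.
have u0 n : (0 <= u n)%E by rewrite lee_fin mulr_ge0// powR_ge0.
have le_u k : (1 <= k)%N -> ((k%:R * al k)%:E <= u k)%E.
  move=> k1; have /andP[a0 a1] := al01 k; rewrite lee_fin; apply: ler_pM => //.
    by rewrite -[leLHS]expr1 ler_weXn2l// ler1n.
  have [->|an0] := eqVneq (al k) 0; first exact: powR_ge0.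
  rewrite -[leLHS]powRr1//; apply: ger_powR => //.
  by rewrite lt0r an0 a0.
apply: nondecreasing_is_cvgn.
  by apply: nondecreasing_series => n _ _; rewrite mulr_ge0//; case/andP: (al01 n).
exists (fine (\sum_(1 <= n <oo) u n)%E) => _ [n _ <-].
rewrite -lee_fin fineK; last first.
  by rewrite ge0_fin_numE//; apply: nneseries_ge0 => k _ _.
apply: (le_trans _ (nneseries_lim_ge n (fun k _ _ => u0 k))).
rewrite /series/= -sumEFin; case: n => [|n]; first by rewrite !big_geq.
rewrite [leLHS]big_ltn// mulr0n mul0r add0r big_nat [leRHS]big_nat; apply: lee_sum => k /andP[k1 _].
exact: le_u.
Qed.

(** * The factor model *)

Section normal_tail.
Context {R : realType}.
Implicit Types x y t s : R.

Lemma Phibar_le x y : (Phibar x%:E <= Phibar y%:E) = (y <= x).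
Proof. by rewrite /Phibar lerD2l lerN2 Phi_le. Qed.

Lemma Phibar_gt0 x : 0 < Phibar x%:E.
Proof. by rewrite subr_gt0 Phi_lt1. Qed.

Lemma Phibar_surj t : 0 < t < 1 -> exists x, Phibar x%:E = t.
Proof.
move=> /andP[t0 t1].
have [n1 h1] := Phi_large t0.
have t1' : 0 < 1 - t by rewrite subr_gt0.
have [n2 h2] := Phi_large t1'.
pose n := maxn n1 n2.
have [ha _] := h1 n (leq_maxl _ _); have [_ hb] := h2 n (leq_maxr _ _).
have ab : - n%:R <= n%:R :> R by rewrite (@le_trans _ _ 0)// oppr_le0.
have [|c _ hc] := @IVT R (fun x => Phi x%:E) (- n%:R) n%:R (1 - t) ab (continuous_subspaceT
  (@continuous_Phi R)).
  by rewrite ge_min hb le_max ha orbT.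
by exists c; rewrite /Phibar hc subKr.
Qed.

Lemma Phibar_invK x : Phibar_inv (Phibar x%:E) = x%:E.
Proof.
rewrite /Phibar_inv (_ : [set _ | _ in _] = [set y%:E | y in [set y | x <= y]]); last first.
  by congr image; apply/seteqP; split => y /=; rewrite Phibar_le.
apply/eqP; rewrite eq_le; apply/andP; split.
  by apply: ereal_inf_lbound; exists x => //=.
by apply: le_ereal_inf_tmp => _ [y /= xy <-]; rewrite lee_fin.
Qed.

Lemma Phibar_invE t : 0 < t < 1 -> exists2 x, Phibar_inv t = x%:E & Phibar x%:E = t.
Proof. by move=> /Phibar_surj[x <-]; exists x => //; exact: Phibar_invK. Qed.

Lemma normal_prob_pinfty s x : 0 < s -> normal_prob 0 s `[x, +oo[ = (Phibar (x / s)%:E)%:E.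
Proof.
move=> s0.
have h := @normal_prob_itv _ s x s0.
have hx : normal_prob 0 s [set x] = 0%E.
  by rewrite /normal_prob integral_set1.
have -> : `[x, +oo[%classic = (~` `]-oo, x]) `|` [set x] :> set R.
  apply/seteqP; split => y /=; rewrite !in_itv/= ?andbT.
    by rewrite le_eqVlt => /predU1P[->|xy]; [right|left; apply/negP; rewrite -ltNge].
  by case=> [/negP|->//]; rewrite -ltNge => /ltW.
rewrite measureU//=.
- rewrite [X in (_ + X)%E]hx adde0 probability_setC// [X in (_ - X)%E]h //.
- exact: measurableC.
- by apply/seteqP; split => y //= -[] /[swap] -> []; rewrite /= in_itv/=.
Qed.

Lemma norm_Phibar_sub x y : `|Phibar x%:E - Phibar y%:E| <= normal_peak 1 * `|x - y|.
Proof.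
rewrite /Phibar (_ : 1 - _ - _ = Phi y%:E - Phi x%:E); last by ring.
rewrite distrC [`|x - y|]distrC [`|_ - Phi _|]distrC.
apply: (@mvt_boundT _ (fun x => Phi x%:E) (normal_pdf 0 1)) => z; first exact: is_derive_Phi.
rewrite (ger0_norm (ltW (phi_gt0 z))) phiE.
by rewrite ler_piMr ?normal_peak_ge0// -expR0 ler_expR oppr_le0 divr_ge0// sqr_ge0.
Qed.

(** On [[- A, A]] the normal density is smallest at [A]; this makes [Phibar_inv] Lipschitz away from
    0 and 1. *)
Lemma norm_Phibar_sub_ge (A : R) x y : `|x| <= A -> `|y| <= A ->
  normal_pdf 0 1 A * `|x - y| <= `|Phibar x%:E - Phibar y%:E|.
Proof.
wlog xy : x y / x <= y => [H|] xA yA.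
  by have [/H|/ltW/H h] := leP x y; [exact|rewrite distrC [leRHS]distrC h].
move: xy; rewrite le_eqVlt => /predU1P[->|xy]; first by rewrite !subrr normr0 mulr0.
have [c cxy h] : exists2 c, c \in `]x, y[%R & Phi y%:E - Phi x%:E = normal_pdf 0 1 c * (y - x).
  apply: (@MVT R (fun x => Phi x%:E) (normal_pdf 0 1) x y xy) => [z _|]; first exact: is_derive_Phi.
  exact: continuous_subspaceT (@continuous_Phi R).
rewrite /Phibar (_ : 1 - _ - _ = Phi y%:E - Phi x%:E); last by ring.
rewrite h normrM distrC ler_wpM2r// (ger0_norm (ltW (phi_gt0 c))).
rewrite !phiE ler_wpM2l ?normal_peak_ge0// ler_expR lerN2 ler_pM2r ?invr_gt0//.
have A0 : 0 <= A by rewrite (le_trans _ xA).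
rewrite -[leLHS]real_normK ?num_real// ler_sqr ?nnegrE//.
move: cxy xA yA; rewrite in_itv/= !ler_norml => /andP[c1 c2] /andP[x1 x2] /andP[y1 y2].
by rewrite (le_trans x1 (ltW c1)) (le_trans (ltW c2)).
Qed.

(** The constant is the peak of the density over a lower bound for it at the quantiles of levels in
    [[a, b]]; it depends neither on the shift nor on the scale, so it serves all hypotheses of all
    rows. *)
Lemma Phibar_affine_lipschitz a b : 0 < a -> a < b -> b < 1 -> exists2 K : R, 0 < K &
  forall (c sig : R) s t, 0 < sig -> a <= s <= b -> a <= t <= b ->
  `|Phibar ((Phibar_inv s - c%:E) * (sig^-1)%:E)%E - Phibar ((Phibar_inv t - c%:E) * (sig^-1)%:E)%E|
   <= K / sig * `|s - t|.
Proof.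
move=> a0 ab b1.
have a01 : 0 < a < 1 by rewrite a0 (lt_trans ab).
have b01 : 0 < b < 1 by rewrite b1 (lt_trans a0).
have [za _ zaE] := Phibar_invE a01; have [zb _ zbE] := Phibar_invE b01.
pose A := Num.max `|za| `|zb|; have pA := phi_gt0 A.
exists (normal_peak 1 / normal_pdf 0 1 A); first by rewrite divr_gt0// normal_peak_gt0// oner_neq0.
have inA s : a <= s <= b -> exists x, [/\ Phibar_inv s = x%:E, Phibar x%:E = s & `|x| <= A].
  move=> /andP[as_ sb]; have s01 : 0 < s < 1 by rewrite (lt_le_trans a0)// (le_lt_trans sb).
  have [x e1 e2] := Phibar_invE s01; exists x; split => //.
  have xza : x <= za by rewrite -Phibar_le e2 zaE.
  have zbx : zb <= x by rewrite -Phibar_le e2 zbE.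
  rewrite ler_norml /A lerNl !le_max (le_trans xza (ler_norm _))/= andbT -(normrN zb).
  by rewrite (le_trans _ (ler_norm (- zb))) ?orbT// lerN2.
move=> c sig s t sig0 /inA[x [-> xs xA]] /inA[y [-> yt yA]].
rewrite -!EFinB -!EFinM (le_trans (norm_Phibar_sub _ _))//.
rewrite (_ : (x - c) / sig - (y - c) / sig = (x - y) / sig); last by ring.
have si : 0 <= sig^-1 by rewrite invr_ge0 ltW.
rewrite normrM (ger0_norm si).
rewrite (_ : normal_peak 1 / normal_pdf 0 1 A / sig * `|s - t| =
  normal_peak 1 * ((normal_pdf 0 1 A)^-1 * `|s - t| / sig)); last by ring.
rewrite ler_wpM2l ?normal_peak_ge0// ler_wpM2r//.
by rewrite ler_pdivlMl// -xs -yt norm_Phibar_sub_ge.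
Qed.

End normal_tail.

Section model.
Context d (T : measurableType d) (R : realType) (P : probability T R) (k : nat).
Context (M : factor_model P k) (w : 'rV[R]_k).

Local Notation bmf := (@bmf _ T R).
Local Notation Er := (Er P).
Local Notation cov := (cov P).

Lemma sigma_of_preimage d' (E : measurableType d') (I : Type) (J : set I) (X : I -> T -> E) i Y :
  J i -> measurable Y -> sigma_of J X (X i @^-1` Y).
Proof.
move=> Ji mY; apply: sub_sigma_algebra; exists i => //; exists Y => //; exact: setTI.
Qed.

Lemma sigma_ofI d' (E : measurableType d') (I : Type) (J : set I) (X : I -> T -> E) A B :
  sigma_of J X A -> sigma_of J X B -> sigma_of J X (A `&` B).
Proof. exact: (@measurableI _ (g_sigma_algebraType (\bigcup_(i in J) preimage_set_system setT (X i)
  measurable))). Qed.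

Lemma nonnull_noise_indep m A B : sigma_of setT (@nonnull _ _ _ _ _ M m) A ->
  sigma_of setT (@noise _ _ _ _ _ M m) B -> P (A `&` B) = (P A * P B)%E.
Proof.
(* Blocks 0 and 1 of the triple are the nonnull indicators and the noise. *)
move=> sA sB; pose b1 : 'I_3 := Ordinal (isT : (1 < 3)%N).
have := @blocks_indep _ _ _ _ _ M m [set ord0; b1]%SET (fun b => if b == ord0 then A else B).
rewrite big_setU1 ?inE//= big_set1/= => <-; last first.
  by move=> i; rewrite !inE => /orP[]/eqP ->.
congr (P _); apply/seteqP; split => x /=.
  by move=> [Ax Bx] i _; case: ifP.
move=> h; split; first by have := h ord0; rewrite /= !inE eqxx; exact.
by have := h b1; rewrite /= !inE eqxx orbT; exact.
Qed.

Lemma group_prob01 m r : (0 < m)%N -> 0 < group_prob M m r < 1.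
Proof.
move=> /(nonnull_prob01 M) /andP[p0 p1]; rewrite /group_prob; case: r; first by rewrite p0.
by rewrite subr_gt0 p1 ltrBlDr ltrDl.
Qed.

Lemma nonnull_prob_eq m (i : 'I_m) r : P [set u | nonnull M i u == r] = (group_prob M m r)%:E.
Proof.
have m0 : (0 < m)%N by exact: leq_ltn_trans (leq0n i) (ltn_ord i).
have /andP[p0 p1] := nonnull_prob01 M m0.
rewrite (_ : [set u | _] = nonnull M i @^-1` [set r]); last first.
  by apply/seteqP; split => u /= /eqP.
rewrite nonnull_law// bernoulli_probE ?(ltW p0) ?(ltW p1)// !diracE /group_prob.
case: r.
  by rewrite mem_set// memNset// mule1 mule0 adde0.
by rewrite memNset// mem_set// mule1 mule0 add0e.
Qed.

Lemma nonnull_pair_prob m (i j : 'I_m) r s : i != j ->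
  P ([set u | nonnull M i u == r] `&` [set u | nonnull M j u == s]) =
  (group_prob M m r * group_prob M m s)%:E.
Proof.
move=> ij.
have := @nonnull_indep _ _ _ _ _ M m [set i; j]%SET
  (fun l => if l == i then [set u | nonnull M i u == r] else [set u | nonnull M j u == s]).
rewrite big_setU1 ?inE//= big_set1/= eqxx [j == i]eq_sym (negbTE ij) !nonnull_prob_eq EFinM => <-;
  last first.
  move=> l; rewrite !inE => /orP[]/eqP ->; rewrite ?eqxx.
    rewrite (_ : [set u | _] = nonnull M i @^-1` [set r]); first exact: sigma_of_preimage.
    by apply/seteqP; split => u /= /eqP.
  rewrite [j == i]eq_sym (negbTE ij) (_ : [set u | _] = nonnull M j @^-1` [set s]);
    first exact: sigma_of_preimage.
  by apply/seteqP; split => u /= /eqP.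
congr (P _); apply/seteqP; split => x /=.
  by move=> [Ax Bx] l _; case: ifP.
move=> h; split; first by have := h i; rewrite /= !inE eqxx; exact.
by have := h j; rewrite /= !inE eqxx orbT [j == i]eq_sym (negbTE ij); exact.
Qed.

Definition noise_sd m (i : 'I_m) := Num.sqrt (noise_cov M m i i).

Lemma noise_sd_gt0 m (i : 'I_m) : 0 < noise_sd i.
Proof. by rewrite sqrtr_gt0 noise_var_gt0. Qed.

Lemma noise_sdE m (i : 'I_m) : Num.sqrt (1 - sqnorm2 (loading M i)) = noise_sd i.
Proof. by rewrite -(unit_variance M i) addrAC subrr add0r. Qed.

(** The standardized noise level from which on the p-value is at most [t]; [fine] loses nothing for
    [0 < t < 1], where [Phibar_inv t] is finite. *)
Definition cutoff m (i : 'I_m) (r : bool) (t : R) : R :=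
  (fine (Phibar_inv t) - (effect M * r%:R + dotv (loading M i) w)) / noise_sd i.

Lemma gammaE m (i : 'I_m) r t : 0 < t < 1 -> gamma M w i r t = Phibar (cutoff i r t)%:E.
Proof. by move=> /Phibar_invE[x xE _]; rewrite /gamma /cutoff xE noise_sdE. Qed.

Lemma pvalue_le m (i : 'I_m) t u : 0 < t < 1 ->
  (pvalue M w i u <= t) = (cutoff i (nonnull M i u) t <= noise M i u / noise_sd i).
Proof.
move=> /Phibar_invE[x xE <-]; rewrite /pvalue Phibar_le /cutoff Phibar_invK/=.
by rewrite ler_pM2r ?invr_gt0 ?noise_sd_gt0// lerBlDl.
Qed.

Definition count1 m (i : 'I_m) (r : bool) (t : R) (u : T) : R :=
  ((nonnull M i u == r) && (pvalue M w i u <= t))%:R.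

Lemma count1E m (i : 'I_m) r t u : 0 < t < 1 ->
  count1 i r t u = ((nonnull M i u == r) && (cutoff i r t <= noise M i u / noise_sd i))%:R.
Proof. by move=> t01; rewrite /count1 pvalue_le//; case: eqP => // ->. Qed.

Lemma count1_sq m (i : 'I_m) r s t u : count1 i r t u * count1 i s t u = (r == s)%:R * count1 i r t
  u.
Proof.
rewrite /count1 -!natrM !mulnb; congr (nat_of_bool _)%:R.
by case: (nonnull M i u); case: r; case: s; case: (_ <= _).
Qed.

Lemma measurable_noise_ge m (i : 'I_m) x : measurable [set u | x <= noise M i u / noise_sd i].
Proof.
rewrite -[X in measurable X]setTI (_ : [set u | _] = (fun u =>
  noise M i u / noise_sd i) @^-1` `[x, +oo[).
  have mf : measurable_fun [set: T] (fun u => noise M i u / noise_sd i).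
    by apply: measurable_funM; [exact: measurable_funPT|exact: measurable_cst].
  exact: mf.
by apply/seteqP; split => u /=; rewrite in_itv/= andbT.
Qed.

Lemma sigma_noise_ge m (i : 'I_m) x : sigma_of setT (@noise _ _ _ _ _ M m) [set u | x <= noise M i
  u / noise_sd i].
Proof.
rewrite (_ : [set u | _] = noise M i @^-1` `[x * noise_sd i, +oo[); first exact: sigma_of_preimage.
by apply/seteqP; split => u /=; rewrite in_itv/= andbT ler_pdivlMr// noise_sd_gt0.
Qed.

Lemma measurable_nonnull_eq m (i : 'I_m) r : measurable [set u | nonnull M i u == r].
Proof.
rewrite -[X in measurable X]setTI (_ : [set u | _] = nonnull M i @^-1` [set r]).
  have mf := @measurable_funPT _ _ _ _ (nonnull M i); exact: mf.
by apply/seteqP; split => u /= /eqP.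
Qed.

Lemma sigma_nonnull_eq m (i : 'I_m) r : sigma_of setT (@nonnull _ _ _ _ _ M m) [set u | nonnull M i
  u == r].
Proof.
rewrite (_ : [set u | _] = nonnull M i @^-1` [set r]); first exact: sigma_of_preimage.
by apply/seteqP; split => u /= /eqP.
Qed.

Lemma noise_ge_prob m (i : 'I_m) x :
  P [set u | x <= noise M i u / noise_sd i] = (Phibar x%:E)%:E.
Proof.
have [_ _ law] := noise_law M m.
have := law (delta_mx 0 i) `[x * noise_sd i, +oo[%classic.
have -> : (delta_mx 0 i *m noise_cov M m *m (delta_mx 0 i)^T) (0 : 'I_1) (0 : 'I_1) = noise_cov M m
  i i.
  by rewrite trmx_delta -rowE -colE !mxE.
rewrite /centered_normal gt_eqF ?noise_var_gt0// -/(noise_sd i).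
rewrite normal_prob_pinfty ?noise_sd_gt0// mulfK ?gt_eqF ?noise_sd_gt0// => <-;
  last exact: measurable_itv.
congr (P _); apply/seteqP; split => u /=; rewrite in_itv/= andbT (bigD1 i)//= mxE !eqxx mul1r big1
  ?addr0.
- by rewrite ler_pdivlMr ?noise_sd_gt0.
- by move=> l li; rewrite mxE (negbTE li) andbF mul0r.
- by rewrite ler_pdivlMr ?noise_sd_gt0.
- by move=> l li; rewrite mxE (negbTE li) andbF mul0r.
Qed.

Lemma bmf_count1 m (i : 'I_m) r t : 0 < t < 1 -> bmf (count1 i r t).
Proof.
move=> t01; rewrite (_ : count1 i r t = fun u =>
  ((nonnull M i u == r) && (cutoff i r t <= noise M i u / noise_sd i))%:R).
  apply: bmf_bool; rewrite (_ : [set x | _] = [set u | nonnull M i u == r] `&` [set u | cutoff i r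
    t <= noise M i u / noise_sd i]).
    apply: measurableI; [exact: measurable_nonnull_eq|exact: measurable_noise_ge].
  by apply/seteqP; split => u /= /andP.
by apply/funext => u; exact: count1E.
Qed.

Lemma Er_count1 m (i : 'I_m) r t : 0 < t < 1 ->
  Er (count1 i r t) = group_prob M m r * gamma M w i r t.
Proof.
move=> t01; under eq_Er do rewrite count1E//.
have e : [set u | (nonnull M i u == r) && (cutoff i r t <= noise M i u / noise_sd i)] =
   [set u | nonnull M i u == r] `&` [set u | cutoff i r t <= noise M i u / noise_sd i].
  by apply/seteqP; split => u /= /andP.
rewrite Er_bool e.
  rewrite (@nonnull_noise_indep m) ?nonnull_prob_eq ?noise_ge_prob ?gammaE//.
  - exact: sigma_nonnull_eq.
  - exact: sigma_noise_ge.
apply: measurableI; [exact: measurable_nonnull_eq|exact: measurable_noise_ge].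
Qed.

(** The indicators of different hypotheses are independent of each other and of the noise, so only
    the correlation of the two noise variables enters, through a quadrant probability. *)
Lemma Er_count1_pair m (i j : 'I_m) r s t : 0 < t < 1 -> i != j ->
  Er (fun u => count1 i r t u * count1 j s t u) = group_prob M m r * group_prob M m s *
   (rho_tilde (gamma M w i r t) (gamma M w j s t) (corr_mx (noise_cov M m) i j)
     + gamma M w i r t * gamma M w j s t).
Proof.
move=> t01 ij; under eq_Er do rewrite !count1E// -natrM mulnb.
set x := cutoff i r t; set y := cutoff j s t.
pose N i x := [set u | x <= noise M (i : 'I_m) u / noise_sd i].
pose H i r := [set u | nonnull M (i : 'I_m) u == r].
have e : [set u | (nonnull M i u == r) && (x <= noise M i u / noise_sd i) &&
  ((nonnull M j u == s) && (y <= noise M j u / noise_sd j))] = (H i r `&` H j s) `&` (N i x `&` N j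
    y).
  apply/seteqP; split => u /=.
    by move=> /andP[/andP[h1 h2] /andP[h3 h4]].
  by move=> [[h1 h2] [h3 h4]]; apply/andP; split; apply/andP.
rewrite Er_bool e.
  rewrite (@nonnull_noise_indep m) ?nonnull_pair_prob//.
  - rewrite /N fineM//; last first.
      by rewrite fin_num_measure//; apply: measurableI; exact: measurable_noise_ge.
    congr (_ * _); rewrite /rho_tilde subrK !gammaE// !Phibar_invK.
    have mX l : measurable_fun [set: T] (noise M (l : 'I_m)) by exact: measurable_funPT.
    have h := gaussian_pair_quadrant (noise_law M m) mX (@noise_var_gt0 _ _ _ _ _ M m) i j x y.
    exact: h.
  - by apply: sigma_ofI; exact: sigma_nonnull_eq.
  - by apply: sigma_ofI; exact: sigma_noise_ge.
by apply: measurableI; apply: measurableI; (exact: measurable_nonnull_eq || exact: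
  measurable_noise_ge).
Qed.

End model.

(** * Rows of the model as mixing sequences *)

Section model_rows.
Context d (T : measurableType d) (R : realType) (P : probability T R) (k : nat).
Context (M : factor_model P k).

Local Notation bmf := (@bmf _ T R).
Local Notation Er := (Er P).
Local Notation cov := (cov P).

(** A [sup] of reals is meaningful for nonempty sets bounded above; the empty row [m = 0] supplies
    the element. *)
Lemma alpha_set_bound dist : let S := [set x | exists n m (A0 A1 : set T),
    [/\ (0 < n)%N,
        sigma_of [set i : 'I_m | (i.+1 <= n)%N] (@mix_pair _ _ _ _ _ M m) A0,
        sigma_of [set i : 'I_m | (n + dist <= i.+1)%N] (@mix_pair _ _ _ _ _ M m) A1 &
        x = `|fine (P (A0 `&` A1)) - fine (P A0) * fine (P A1)| ]] in
  S !=set0 /\ ubound S 1.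
Proof.
have s0 (J : set 'I_0) : sigma_of J (@mix_pair _ _ _ _ _ M 0) set0.
  exact: (@measurable0 _ (g_sigma_algebraType (\bigcup_(i in J) preimage_set_system setT (@mix_pair
    _ _ _ _ _ M 0 i) measurable))).
split; first by exists `|fine (P (set0 `&` set0)) - fine (P set0) * fine (P set0)|, 1%N, 0%N, set0,
  set0.
have mm m : forall i, measurable_fun [set: T] (@mix_pair _ _ _ _ _ M m i).
  by move=> i; apply: measurable_fun_pair; exact: measurable_funPT.
have ms m (J : set 'I_m) A : sigma_of J (@mix_pair _ _ _ _ _ M m) A -> measurable A.
  apply: smallest_sub; first exact: sigma_algebra_measurable.
  by move=> _ [i Ji [B mB <-]]; exact: mm.
have p01 A : measurable A -> 0 <= fine (P A) <= 1.
  move=> mA; rewrite fine_ge0//= -lee_fin fineK ?probability_le1//.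
  exact: fin_num_measure.
move=> _ [n [m [A0 [A1 [_ /ms mA0 /ms mA1 ->]]]]].
have /andP[h1 h2] := p01 _ mA0; have /andP[h3 h4] := p01 _ mA1.
have /andP[h5 h6] := p01 _ (measurableI _ _ mA0 mA1).
have h7 : 0 <= fine (P A0) * fine (P A1) <= 1 by rewrite mulr_ge0//= mulr_ile1.
by move: h7 => /andP[h7 h8]; rewrite ler_norml; apply/andP; split; lra.
Qed.

Lemma alpha_ge n dist m A0 A1 : (0 < n)%N ->
  sigma_of [set i : 'I_m | (i.+1 <= n)%N] (@mix_pair _ _ _ _ _ M m) A0 ->
  sigma_of [set i : 'I_m | (n + dist <= i.+1)%N] (@mix_pair _ _ _ _ _ M m) A1 ->
  `|fine (P (A0 `&` A1)) - fine (P A0) * fine (P A1)| <= alpha M dist.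
Proof.
move=> n0 s0 s1; have [_ ub] := alpha_set_bound dist.
by apply: ub_le_sup; [exists 1|exists n, m, A0, A1].
Qed.

Lemma alpha01 dist : 0 <= alpha M dist <= 1.
Proof.
have [ne hb] := alpha_set_bound dist; apply/andP; split; last exact: ge_sup.
have [x xS] := ne; apply: le_trans (ub_le_sup _ xS); last by exists 1.
by move: xS => [n [m [A0 [A1 [_ _ _ ->]]]]].
Qed.

(* Extended by 0 because [row_mixing] is about sequences. *)
Definition model_row m (h : 'I_m -> R * bool -> R) (j : nat) (u : T) : R :=
  if insub j is Some i then h i (mix_pair M i u) else 0.

Lemma row_sum m (h : 'I_m -> R * bool -> R) u :
  \sum_(0 <= j < m) model_row h j u = \sum_(i < m) h i (mix_pair M i u).
Proof. by rewrite big_mkord; apply: eq_bigr => i _; rewrite /model_row valK. Qed.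

Lemma measurable_mix_pair m (i : 'I_m) : measurable_fun [set: T] (mix_pair M i).
Proof. by apply: measurable_fun_pair; exact: measurable_funPT. Qed.

(** Events of the row are events of the pairs, and the extension by 0 beyond [m] generates only
    trivial events. *)
Lemma row_mixing_row m (h : 'I_m -> R * bool -> R) :
  (forall i, measurable_fun [set: R * bool] (h i)) -> row_mixing P (model_row h) (alpha M).
Proof.
move=> mh n dist A B n0 sA sB.
have sub (J : set nat) (J' : set 'I_m) A' : (forall i : 'I_m, J i -> J' i) ->
    sigma_of J (model_row h) A' -> sigma_of J' (@mix_pair _ _ _ _ _ M m) A'.
  move=> JJ; apply: smallest_sub; first exact: smallest_sigma_algebra.
  move=> _ [j Jj [Y mY <-]]; rewrite setTI /model_row; case: insubP => [i _ ij|_].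
    apply: (@sigma_of_preimage _ _ _ _ _ _ _ i (h i @^-1` Y)); first by apply: JJ; rewrite /= ij.
    by rewrite -[X in measurable X]setTI; exact: mh.
  have mc : measurable_fun [set: gen_by J' (@mix_pair _ _ _ _ _ M m)]
     ((fun=> 0) : gen_by J' (@mix_pair _ _ _ _ _ M m) -> R) by exact: measurable_cst.
  by have := mc measurableT Y mY; rewrite setTI; exact.
by apply: (@alpha_ge n) => //; [apply: sub sA|apply: sub sB].
Qed.

Lemma bmf_row m (h : 'I_m -> R * bool -> R) (K : R) :
  (forall i, measurable_fun [set: R * bool] (h i)) -> (forall i x, `|h i x| <= K) ->
  forall j, bmf (model_row h j).
Proof.
move=> mh hK j; rewrite /model_row; case: insubP => [i _ _|_]; last exact: bmf_cst.
split; last by exists K.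
exact: measurableT_comp (mh i) (measurable_mix_pair i).
Qed.

Context (w : 'rV[R]_k).

(** For [0 < t < 1] this is [count1] as a function of the pair of noise and indicator, the form in
    which the mixing coefficients apply. *)
Definition count_of m (r : bool) (t : R) (i : 'I_m) (x : R * bool) : R :=
  ((x.2 == r) && (cutoff M w i r t <= x.1 / noise_sd M i))%:R.

Lemma measurable_count_of m r t (i : 'I_m) : measurable_fun [set: R * bool] (count_of r t i).
Proof.
rewrite (_ : count_of r t i = \1_([set x | x.2 == r] `&` [set x | cutoff M w i r t <= x.1 /
  noise_sd M i])).
  apply: measurable_indic; apply: measurableI.
    rewrite -[X in measurable X]setTI (_ : [set x | _] = snd @^-1` [set r]).
      exact: measurable_snd.
    by apply/seteqP; split => u /= /eqP.
  rewrite -[X in measurable X]setTI (_ : [set x | _] = fst @^-1` `[cutoff M w i r t * noise_sd M i,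
    +oo[).
    exact: measurable_fst.
  by apply/seteqP; split => u /=; rewrite in_itv/= andbT ler_pdivlMr// noise_sd_gt0.
apply/funext => x; rewrite indicE /count_of; congr (nat_of_bool _)%:R.
by apply/andP/idP => [h|/set_mem//]; rewrite inE.
Qed.

Lemma count_of_01 m r t (i : 'I_m) x : 0 <= count_of r t i x <= 1.
Proof. by rewrite /count_of ler0n lern1 leq_b1. Qed.

Lemma count1_mix_pair m r t (i : 'I_m) u : 0 < t < 1 ->
  count1 M w i r t u = count_of r t i (mix_pair M i u).
Proof. by move=> t01; rewrite count1E. Qed.

Lemma subdistE m r t : 0 < t < 1 ->
  subdist M w m r t = m%:R^-1 * \sum_(i < m) Er (count1 M w i r t).
Proof.
move=> t01; rewrite /subdist; under [in RHS]eq_bigr do rewrite Er_count1//.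
by rewrite -mulr_sumr mulrCA mulrA.
Qed.

Lemma emp_processE m r t u : 0 < t < 1 -> emp_process M w m r t u =
  (Num.sqrt m%:R)^-1 * \sum_(i < m) (count1 M w i r t u - Er (count1 M w i r t)).
Proof.
move=> t01; rewrite /emp_process subdistE// -mulrBr sumrB mulrA; congr (_ * _).
case: m => [|m]; first by rewrite sqrtr0 mul0r invr0.
have s0 : Num.sqrt m.+1%:R != 0 :> R by rewrite gt_eqF// sqrtr_gt0.
by rewrite -[X in _ / X]sqr_sqrtr// expr2 invfM mulrA divff// mul1r.
Qed.

Lemma bmf_emp_process m r t : 0 < t < 1 -> bmf (emp_process M w m r t).
Proof.
move=> t01; rewrite (_ : emp_process _ _ _ _ _ = fun u =>
  (Num.sqrt m%:R)^-1 * \sum_(i < m) (count1 M w i r t u - Er (count1 M w i r t))).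
  apply: bmfZ; apply: bmf_sum => i; apply: bmfB; [exact: bmf_count1|exact: bmf_cst].
by apply/funext => u; rewrite emp_processE.
Qed.

Lemma Er_emp_process m r t : 0 < t < 1 -> Er (emp_process M w m r t) = 0.
Proof.
move=> t01; have bd (i : 'I_m) : bmf (fun u => count1 M w i r t u - Er (count1 M w i r t)).
  by apply: bmfB; [exact: bmf_count1|exact: bmf_cst].
under eq_Er do rewrite emp_processE//.
rewrite ErZ; last exact: bmf_sum.
rewrite Er_sum// big1 ?mulr0// => i _; rewrite ErB ?Er_cst ?subrr//;
  [exact: bmf_count1|exact: bmf_cst].
Qed.

Lemma emp_covE m r0 r1 t : 0 < t < 1 ->
  emp_cov M w m r0 r1 t t = Er (fun u => emp_process M w m r0 t u * emp_process M w m r1 t u).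
Proof.
move=> t01; rewrite /emp_cov covarianceE_cov; [|exact: bmf_emp_process..].
by rewrite /cov/= !Er_emp_process// mulr0 subr0.
Qed.

(** On the diagonal the two groups exclude each other, which leaves a mean minus a product; off the
    diagonal only the noise correlation survives. The three terms are those whose limits the theorem
    assumes. *)
Lemma emp_cov_decomp m r0 r1 t : 0 < t < 1 ->
  emp_cov M w m r0 r1 t t = (r0 == r1)%:R * subdist M w m r0 t -
    group_prob M m r0 * group_prob M m r1 / m%:R *
      (\sum_(i < m) gamma M w i r0 t * gamma M w i r1 t) +
    group_prob M m r0 * group_prob M m r1 / m%:R * (\sum_(i < m) \sum_(j < m | i != j)
           rho_tilde (gamma M w i r0 t) (gamma M w j r1 t) (corr_mx (noise_cov M m) i j)).
Proof.
move=> t01; rewrite emp_covE//.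
under eq_Er do rewrite !emp_processE// mulrACA -invfM -expr2 sqr_sqrtr// mulr_suml.
have bd r (i : 'I_m) : bmf (fun u => count1 M w i r t u - Er (count1 M w i r t)).
  by apply: bmfB; [exact: bmf_count1|exact: bmf_cst].
rewrite ErZ; last by apply: bmf_sum => i; apply: bmfM => //; exact: bmf_sum.
rewrite Er_sum; last by move=> i; apply: bmfM => //; exact: bmf_sum.
have inner (i : 'I_m) : Er (fun u => (count1 M w i r0 t u - Er (count1 M w i r0 t)) *
    \sum_(j < m) (count1 M w j r1 t u - Er (count1 M w j r1 t))) =
  (r0 == r1)%:R * Er (count1 M w i r0 t) - group_prob M m r0 * group_prob M m r1 *
     (gamma M w i r0 t * gamma M w i r1 t) +
   group_prob M m r0 * group_prob M m r1 * \sum_(j < m | i != j)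
           rho_tilde (gamma M w i r0 t) (gamma M w j r1 t) (corr_mx (noise_cov M m) i j).
  under eq_Er do rewrite mulr_sumr.
  rewrite Er_sum; last by move=> j; exact: bmfM.
  rewrite (bigD1 i)//=; congr (_ + _).
    rewrite Er_centered_mul; [|exact: bmf_count1..].
    rewrite /cov; under eq_Er do rewrite count1_sq.
    rewrite ErZ; last exact: bmf_count1.
    by rewrite !Er_count1// mulrACA.
  rewrite mulr_sumr; apply: eq_big => [j|j ji]; first by rewrite eq_sym.
  rewrite Er_centered_mul; [|exact: bmf_count1..].
  have ij : i != j by rewrite eq_sym.
  by rewrite /cov (Er_count1_pair M w r0 r1 t01 ij) !Er_count1// mulrDr [X in _ - X]mulrACA addrK.
under eq_bigr do rewrite inner.
rewrite big_split/= sumrB -!mulr_sumr mulrDr mulrBr subdistE//.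
congr (_ - _ + _); first by rewrite mulrCA.
  by rewrite mulrA [m%:R^-1 * _]mulrC.
by rewrite mulrA [m%:R^-1 * _]mulrC.
Qed.

End model_rows.

(** * The step-up threshold *)

Section step_up.
Context d (T : measurableType d) (R : realType) (P : probability T R) (k : nat).
Context (M : factor_model P k) (w : 'rV[R]_k) (q : R) (m : nat).
Hypotheses (q0 : 0 < q) (m0 : (0 < m)%N).

Local Notation pv := (pvalue M w).
Local Notation spv := (sorted_pvalue M w).
Local Notation tau u := (bh_threshold M w q m u).
Local Notation emp := (emp_subdist M w m).

Let mR0 : 0 < m%:R :> R. Proof. by rewrite ltr0n. Qed.

Lemma pvalue_gt0 (i : 'I_m) u : 0 < pv i u.
Proof. exact: Phibar_gt0. Qed.

Let values u := sort <=%R [seq pv i u | i : 'I_m <- enum 'I_m].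

Lemma sorted_values u : sorted <=%R (values u).
Proof. exact: sort_sorted (@le_total _ R) _. Qed.

Lemma size_values u : size (values u) = m.
Proof. by rewrite size_sort size_map size_enum_ord. Qed.

Lemma mem_values (i : 'I_m) u : pv i u \in values u.
Proof. by rewrite mem_sort; apply/mapP; exists i; rewrite ?mem_enum. Qed.

Lemma count_values t u : (count (<= t)%O (values u))%:R = \sum_(i < m) (pv i u <= t)%R%:R :> R.
Proof.
rewrite (permP (permEl (perm_sort _ _))) count_map -sum1_count natr_sum big_enum_cond/=.
by rewrite big_mkcond/=; apply: eq_bigr => i _; case: (_ <= _).
Qed.

Lemma emp_total t u : emp false t u + emp true t u = m%:R^-1 * (count (<= t)%O (values u))%:R.
Proof.
rewrite /emp_subdist -mulrDr -big_split/= count_values; congr (_ * _).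
by apply: eq_bigr => i _; case: (nonnull M i u); rewrite ?addr0 ?add0r.
Qed.

Lemma crossing_count t u : (t / q <= emp false t u + emp true t u) =
  (t <= (count (<= t)%O (values u))%:R * q / m%:R).
Proof. by rewrite emp_total ler_pdivrMr// [m%:R^-1 * _]mulrC mulrAC. Qed.

Lemma bh_count_cond u : (bh_count M w q m u <= m)%N /\
  spv m u (bh_count M w q m u) <= (bh_count M w q m u)%:R * q / m%:R.
Proof.
have := @eq_bigmax_cond _ [pred j : 'I_m.+1 | spv m u j <= j%:R * q / m%:R] (fun j => j : nat).
case=> [|j]; first by apply/card_gt0P; exists ord0; rewrite inE /sorted_pvalue/= !mul0r.
by rewrite inE => jP e; rewrite /bh_count e; split => //; rewrite -ltnS.
Qed.

Lemma spv_count j u : (0 < j <= m)%N -> spv m u j \in values u.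
Proof. by case: j => // j /= jm; rewrite /sorted_pvalue/= mem_nth// size_values. Qed.

Lemma bh_threshold_cases u : tau u = 0 \/ exists i : 'I_m, tau u = pv i u.
Proof.
have [bm _] := bh_count_cond u; rewrite /bh_threshold.
move: bm; case: (bh_count M w q m u) => [|j] jm; first by left.
right; have : spv m u j.+1 \in values u by exact: spv_count.
by rewrite mem_sort => /mapP[i _ ->]; exists i.
Qed.

(** At least as many p-values as the rank lie at or below the order statistic of that rank, ties
    included, so the step-up inequality passes to the empirical distribution. *)
Lemma bh_threshold_crossing u : tau u / q <= emp false (tau u) u + emp true (tau u) u.
Proof.
rewrite crossing_count; have [bm] := bh_count_cond u; rewrite /bh_threshold.
move: bm; case: (bh_count M w q m u) => [|j] jm h.
  by rewrite (le_trans h)// !mul0r mulr_ge0 ?invr_ge0 ?mulr_ge0// ltW.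
apply: le_trans h _; rewrite ler_pM2r ?invr_gt0// ler_pM2r// ler_nat.
have [//|cj] := leqP j.+1 (count (<= spv m u j.+1)%O (values u)).
have := @nth_count_gt _ _ (spv m u j.+1) 0 (values u) j (sorted_values u).
by rewrite size_values -ltnS cj jm /sorted_pvalue/= ltxx => /(_ isT).
Qed.

Lemma bh_threshold_range u : 0 <= tau u <= q.
Proof.
apply/andP; split.
  by have [->//|[i ->]] := bh_threshold_cases u; exact/ltW/pvalue_gt0.
have [bm h] := bh_count_cond u; apply: le_trans h _.
by rewrite mulrAC (ler_piMl (ltW q0))// ler_pdivrMr// mul1r ler_nat.
Qed.

(** The number [c] of p-values at most [t] satisfies the step-up condition, hence is at most the
    rejection count. The point [t] may itself exceed the threshold, in a gap between p-values. *)
Lemma le_bh_threshold t u (i : 'I_m) : t / q <= emp false t u + emp true t u -> pv i u <= t ->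
  pv i u <= tau u.
Proof.
rewrite crossing_count => ht it.
set c := count (<= t)%O (values u) in ht.
have c0 : (0 < c)%N by rewrite -has_count; apply/hasP; exists (pv i u) => //; exact: mem_values.
have cm : (c <= m)%N by rewrite -(size_values u) count_size.
have cP : spv m u c <= c%:R * q / m%:R.
  apply: le_trans ht; rewrite -(prednK c0) /sorted_pvalue/=.
  by apply: nth_count_le; [exact: sorted_values|rewrite prednK].
have cJ : (c <= bh_count M w q m u)%N.
  exact: (@leq_bigmax_cond _ [pred j : 'I_m.+1 | spv m u j <= j%:R * q / m%:R] (fun j =>
    j : nat) (Ordinal (cm : c < m.+1)%N)).
have [Jm _] := bh_count_cond u.
pose l := index (pv i u) (values u).
have lm : (l < m)%N by rewrite -(size_values u) index_mem mem_values.
have lE : nth 0 (values u) l = pv i u by rewrite nth_index// mem_values.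
have lc : (l < c)%N.
  rewrite ltnNge; apply/negP => cl.
  have := @nth_count_gt _ _ t 0 (values u) l (sorted_values u).
  by rewrite cl size_values lm lE => /(_ isT); rewrite ltNge it.
have J0 : (0 < bh_count M w q m u)%N by exact: leq_trans cJ.
rewrite -lE /bh_threshold -(prednK J0) /sorted_pvalue/= -/(values u).
apply: (le_sorted_leq_nth 0 (sorted_values u)); rewrite ?inE ?size_values//;
  first by rewrite prednK.
by rewrite -ltnS prednK// (leq_trans lc).
Qed.

(** In terms of counts the threshold acts as the largest crossing point; this is the form of
    maximality that the sandwich uses. *)
Lemma emp_le_bh_threshold r t u : t / q <= emp false t u + emp true t u ->
  emp r t u <= emp r (tau u) u.
Proof.
move=> ht; rewrite /emp_subdist ler_pM2l ?invr_gt0//; apply: ler_sum => i _; rewrite ler_nat.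
by case: (_ == _) => //=; case: leP => // /(le_bh_threshold ht) ->.
Qed.

Lemma false_discoveriesE u : (false_discoveries M w q m u)%:R / m%:R = emp false (tau u) u.
Proof.
rewrite /false_discoveries /emp_subdist mulrC; congr (_ * _).
rewrite -sum1_card natr_sum big_mkcond/=; apply: eq_bigr => i _.
set A := [set _ | _]; have -> : (i \in in_set A) = (pv i u <= tau u) && ~~ nonnull M i u.
  by apply/idP/idP => [/set_mem//|h]; exact: mem_set.
by rewrite andbC eqbF_neg; case: (_ && _).
Qed.

Lemma measurable_pvalue (i : 'I_m) : measurable_fun [set: T] (pv i).
Proof.
apply: measurable_funB; first exact: measurable_cst.
apply: (measurableT_comp (continuous_measurable_fun (@continuous_Phi R))).
apply: measurable_funD; last exact: measurable_funPT.
apply: measurable_funD; last exact: measurable_cst.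
apply: measurable_funM; first exact: measurable_cst.
rewrite (_ : (fun _ => _) = (fun u => (nonnull M i u == true)%:R)).
  exact: (bmf_bool R (measurable_nonnull_eq M i true)).1.
by apply/funext => u; case: (nonnull M i u).
Qed.

Lemma measurable_emp_at r (i : 'I_m) : measurable_fun [set: T] (fun u => emp r (pv i u) u).
Proof.
apply: measurable_funM; first exact: measurable_cst.
apply: measurable_sum => j; apply: (bmf_bool R _).1.
rewrite (_ : [set x | _] = [set u | nonnull M j u == r] `&` (setT `&` [set u | pv j u <= pv i u])).
  apply: measurableI; first exact: measurable_nonnull_eq.
  by apply: measurable_fun_le => //; exact: measurable_pvalue.
by rewrite setTI; apply/seteqP; split => u /= /andP.
Qed.

(* The ratio is the largest empirical null subdistribution at a p-value satisfying the crossing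
   condition. *)
Lemma measurable_false_discoveries :
  measurable_fun [set: T] (fun u => (false_discoveries M w q m u)%:R / m%:R : R).
Proof.
pose F (i : 'I_m) u : R := (pv i u / q <= emp false (pv i u) u + emp true (pv i u) u)%R%:R * emp
  false (pv i u) u.
rewrite (_ : (fun u => _) = fun u => \big[Num.max/0]_(i < m) F i u); last first.
  apply/funext => u; rewrite false_discoveriesE; apply/eqP; rewrite eq_le; apply/andP; split.
    have [t0|[i ti]] := bh_threshold_cases u.
      rewrite (_ : emp false _ u = 0); first exact: bigmax_ge_id.
      rewrite /emp_subdist big1 ?mulr0// => i _.
      by rewrite t0 leNgt pvalue_gt0 andbF.
    have := @le_bigmax _ _ _ 0 (F ^~ u) i; rewrite /F -ti bh_threshold_crossing mul1r; exact.
  apply: bigmax_le => [|i _].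
    by rewrite mulr_ge0 ?invr_ge0// sumr_ge0.
  rewrite /F; case: (boolP (pv i u / q <= _)) => [h|_]; first by rewrite mul1r emp_le_bh_threshold.
  by rewrite mul0r mulr_ge0 ?invr_ge0// sumr_ge0.
have mF i : measurable_fun [set: T] (F i).
  apply: measurable_funM; last exact: measurable_emp_at.
  apply: (bmf_bool R _).1; rewrite -[X in measurable X]setTI.
  apply: measurable_fun_le => //.
    by apply: measurable_funM; [exact: measurable_pvalue|exact: measurable_cst].
  by apply: measurable_funD; exact: measurable_emp_at.
elim: (index_enum _) => [|i s ih].
  by under eq_fun do rewrite big_nil; exact: measurable_cst.
by under eq_fun do rewrite big_cons; exact: measurable_maxr.
Qed.

End step_up.

(** * Limits of the empirical processes *)

Section empirical_processes.
Context d (T : measurableType d) (R : realType) (P : probability T R) (k : nat).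
Context (M : factor_model P k) (w : 'rV[R]_k).

Local Notation bmf := (@bmf _ T R).
Local Notation Er := (Er P).
Local Notation W := (emp_process M w).
Local Notation F := (lim_subdist M w).

Lemma row_variance m (h : 'I_m -> R * bool -> R) (v t : R) l :
  (forall i, measurable_fun [set: R * bool] (h i)) -> (forall i x, `|h i x| <= 1) -> 0 <= v ->
  (forall i, Er (fun u => `|h i (mix_pair M i u)|) <= v) ->
  (forall N, \sum_(l.+1 <= j < N) alpha M j <= t) -> (0 < m)%N ->
  Er (fun u => ((Num.sqrt m%:R)^-1 * \sum_(i < m) (h i (mix_pair M i u) -
    Er (fun u => h i (mix_pair M i u)))) ^+ 2) <= (4 * l%:R + 2) * v + 8 * t.
Proof.
move=> mh h1 v0 hv ht m0.
have brow := bmf_row M mh h1.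
have hrow (i : 'I_m) : model_row M h i = (fun u => h i (mix_pair M i u)).
  by apply/funext => u; rewrite /model_row valK.
have row0 j : ~~ (j < m)%N -> model_row M h j = fun=> 0.
  by move=> jm; apply/funext => u; rewrite /model_row insubN.
have al0 n : 0 <= alpha M n by case/andP: (alpha01 M n).
have row1 j u : `|model_row M h j u| <= 1 by rewrite /model_row; case: insub => [i|];
  rewrite ?normr0.
have rowv j : Er (fun u => `|model_row M h j u|) <= v.
  have [jm|/row0 ->] := boolP (j < m)%N; first by have := hrow (Ordinal jm) => /= ->.
  by under eq_Er do rewrite normr0; rewrite Er_cst.
have := mixing_sum_variance m brow row1 (@row_mixing_row _ _ _ _ _ M _ _ mh) rowv al0 ht.
set V := _ + _ => le_mV.
under eq_Er do rewrite exprMn exprVn sqr_sqrtr//.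
rewrite ErZ; last first.
  apply: bmfX; apply: bmf_sum => i; apply: bmfB; last exact: bmf_cst.
  by rewrite -hrow.
rewrite ler_pdivrMl ?ltr0n//; apply: le_trans le_mV; rewrite le_eqVlt; apply/orP; left; apply/eqP.
by apply: eq_Er => u; rewrite big_mkord; congr (_ ^+ 2); apply: eq_bigr => i _; rewrite hrow.
Qed.

Lemma emp_process_count m r t u : 0 < t < 1 -> W m r t u = (Num.sqrt m%:R)^-1 *
  \sum_(i < m) (count_of M w r t i (mix_pair M i u) - Er (fun u =>
    count_of M w r t i (mix_pair M i u))).
Proof.
move=> t01; rewrite emp_processE//; congr (_ * _); apply: eq_bigr => i _.
by rewrite count1_mix_pair//; congr (_ - _); apply: eq_Er => v; rewrite count1_mix_pair.
Qed.

Lemma bmf_count_of m r t (i : 'I_m) : bmf (fun u => count_of M w r t i (mix_pair M i u)).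
Proof.
split; first exact: measurableT_comp (measurable_count_of M w r t i) (measurable_mix_pair M i).
by exists 1 => u; have /andP[h0 h1] := count_of_01 M w r t i (mix_pair M i u); rewrite ger0_norm.
Qed.

Hypothesis hal : cvgn (series (fun n => n%:R * alpha M n)).

Let alpha_ge0 n : 0 <= alpha M n. Proof. by case/andP: (alpha01 M n). Qed.

Lemma alpha_tail (e : R) : 0 < e -> exists l : nat, forall N, \sum_(l.+1 <= j < N) alpha M j <= e.
Proof.
move=> /(al_tail hal)[l hl]; exists l => N.
exact: le_trans (al_le_kal alpha_ge0 l N) (hl N).
Qed.

(** Uniform in the row, the group and the point, as Chebyshev's inequality on a grid that moves with
    [m] requires. *)
Lemma emp_process_variance_bounded : exists2 C : R, 0 < C & forall m r t, (0 < m)%N -> 0 < t < 1 ->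
  Er (fun u => W m r t u ^+ 2) <= C.
Proof.
have [l hl] := alpha_tail ltr01.
exists ((4 * l%:R + 2) * 1 + 8 * 1); first by rewrite !mulr1 addr_gt0// ltr_wpDl// mulr_ge0.
move=> m r t m0 t01; under eq_Er do rewrite emp_process_count//.
apply: row_variance => //.
- by move=> i; exact: measurable_count_of.
- by move=> i x; have /andP[h0 h1] := count_of_01 M w r t i x; rewrite ger0_norm.
- move=> i; rewrite -[leRHS](Er_cst P); apply: le_Er.
  + exact/bmf_norm/bmf_count_of.
  + exact: bmf_cst.
  + by move=> u; have /andP[h0 h1] := count_of_01 M w r t i (mix_pair M i u); rewrite ger0_norm.
Qed.

Variables (a b : R).
Hypotheses (a0 : 0 < a) (ab : a < b) (b1 : b < 1)
  (hload : sup [set x | exists m (i : 'I_m), x = sqnorm2 (loading M i)] < 1).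

Let in01 t : a <= t <= b -> 0 < t < 1.
Proof. by move=> /andP[h1 h2]; rewrite (lt_le_trans a0 h1) (le_lt_trans h2 b1). Qed.

(** The bound on the loadings keeps the noise standard deviations away from 0, so the slope is
    uniform over the array. *)
Lemma gamma_lipschitz : exists2 K : R, 0 < K & forall m (i : 'I_m) r s t, a <= s <= b ->
  a <= t <= b ->
  `|gamma M w i r s - gamma M w i r t| <= K * `|s - t|.
Proof.
have [K0 K0gt0 hK0] := Phibar_affine_lipschitz a0 ab b1.
have hL := hload; set L := sup _ in hL.
have sL : 0 < Num.sqrt (1 - L) by rewrite sqrtr_gt0 subr_gt0.
exists (K0 / Num.sqrt (1 - L)); first by rewrite divr_gt0.
move=> m i r s t sab tab; rewrite /gamma noise_sdE.
apply: le_trans (hK0 _ _ _ _ (noise_sd_gt0 M i) sab tab) _.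
rewrite ler_wpM2r// ler_pM2l// lef_pV2 ?posrE ?noise_sd_gt0// -noise_sdE ler_wsqrtr// lerD2l lerN2.
apply: ub_le_sup; last by exists m, i.
(* The set under [sup] is bounded because loading and noise together have unit variance. *)
exists 1 => _ [m' [j ->]]; rewrite -(unit_variance M j) lerDl ltW//; exact: noise_var_gt0.
Qed.

Lemma subdist_lipschitz : exists2 K : R, 0 < K & forall m r s t, (0 < m)%N ->
  a <= s <= b -> a <= t <= b -> `|subdist M w m r s - subdist M w m r t| <= K * `|s - t|.
Proof.
have [K K0 hK] := gamma_lipschitz; exists K => // m r s t m0 sab tab.
have m0' : 0 < m%:R :> R by rewrite ltr0n.
have /andP[p0 p1] := group_prob01 M r m0.
rewrite /subdist -mulrBr -sumrB normrM.
apply: (@le_trans _ _ (m%:R^-1 * (m%:R * (K * `|s - t|)))); last by rewrite mulKf// gt_eqF.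
apply: ler_pM => //.
  rewrite ger0_norm; last by rewrite divr_ge0// ltW.
  by rewrite ler_piMl ?invr_ge0// ltW.
apply: le_trans (ler_norm_sum _ _ _) _; rewrite -[m in leRHS]card_ord -sum1_card natr_sum mulr_suml.
by apply: ler_sum => i _; rewrite mul1r hK.
Qed.

Lemma count_of_le m r s t (i : 'I_m) x : a <= s <= b -> a <= t <= b -> s <= t ->
  count_of M w r s i x <= count_of M w r t i x.
Proof.
move=> /in01 s01 /in01 t01 st; rewrite /count_of ler_nat; case: (_ == _) => //=.
have [y yE ys] := Phibar_invE s01; have [z zE zt] := Phibar_invE t01.
have zy : z <= y by rewrite -Phibar_le ys zt.
have cc : cutoff M w i r t <= cutoff M w i r s.
  by rewrite /cutoff yE zE/= ler_pM2r ?invr_gt0 ?noise_sd_gt0// lerD2r.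
by case: leP => // /(le_trans cc) ->.
Qed.

(** The difference of two counts is an indicator with mean at most [K * |s - t|]: the lag [l] makes
    the far-lag part half of [e], and then [del] makes the near-lag part the other half. *)
Lemma emp_process_continuity (e : R) : 0 < e -> exists2 del : R, 0 < del &
  forall m r s t, (0 < m)%N -> a <= s <= b -> a <= t <= b -> `|s - t| <= del ->
  Er (fun u => (W m r s u - W m r t u) ^+ 2) <= e.
Proof.
move=> e0; have e16 : 0 < e / 16 by rewrite divr_gt0.
have [l hl] := alpha_tail e16.
have [K K0 hK] := gamma_lipschitz.
have l0 : 0 < (4 * l%:R + 2 : R) by rewrite ltr_wpDl// mulr_ge0.
exists (e / 2 / ((4 * l%:R + 2) * K)); first by rewrite !divr_gt0// mulr_gt0.
move=> m r s t m0 sab tab.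
(* Ordering the points makes the difference of counts nonnegative, so its absolute first moment is a
   difference of means. *)
wlog ts : s t sab tab / t <= s => [H|] st.
  have [/H|/ltW/H h] := leP t s; first exact.
  by under eq_Er do rewrite -sqrrN opprB; apply: h => //; rewrite distrC.
have s01 := in01 sab; have t01 := in01 tab.
pose h i x := count_of M w r s i x - count_of M w r t (i : 'I_m) x.
have h01 i x : 0 <= h i x <= 1.
  have /andP[h1 h2] := count_of_01 M w r s i x; have /andP[h3 h4] := count_of_01 M w r t i x.
  rewrite subr_ge0 count_of_le//= lerBlDr (le_trans h2)// lerDl//.
have hn i x : `|h i x| = h i x by rewrite ger0_norm//; case/andP: (h01 i x).
rewrite (_ : e = (4 * l%:R + 2) * (e / 2 / (4 * l%:R + 2)) + 8 * (e / 16)); last by field;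
  rewrite gt_eqF.
rewrite (_ : Er _ = Er (fun u => ((Num.sqrt m%:R)^-1 * \sum_(i < m) (h i (mix_pair M i u) -
    Er (fun u => h i (mix_pair M i u)))) ^+ 2)); last first.
  apply: eq_Er => u; rewrite !emp_process_count// -mulrBr -sumrB; congr ((_ * _) ^+ 2).
  apply: eq_bigr => i _; rewrite /h ErB; [|exact: bmf_count_of..].
  by move: (Er _) (Er _) => x y; ring.
apply: row_variance => //.
- by move=> i; apply: measurable_funB; exact: measurable_count_of.
- by move=> i x; rewrite hn; case/andP: (h01 i x).
- by rewrite !divr_ge0// ltW.
- move=> i; under eq_Er do rewrite hn.
  rewrite ErB; [|exact: bmf_count_of..].
  under eq_Er do rewrite -count1_mix_pair//.
  under [X in _ - X]eq_Er do rewrite -count1_mix_pair//.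
  rewrite !Er_count1// -mulrBr.
  have /andP[p0 p1] := group_prob01 M r m0.
  apply: (@le_trans _ _ (1 * (K * `|s - t|))).
    rewrite (le_trans (ler_norm _))// normrM ler_pM//; last exact: hK.
    by rewrite ger0_norm ltW.
  rewrite mul1r -ler_pdivlMl// (le_trans st)// le_eqVlt; apply/orP; left; apply/eqP.
  by field; rewrite !gt_eqF.
Qed.

Hypothesis hlim : forall (r : bool) (t : R), 0 <= t <= 1 -> cvgn (fun m => subdist M w m r t).

Lemma subdist_cvg r t : a <= t <= b -> subdist M w m r t @[m --> \oo] --> F r t.
Proof. by move=> /in01/andP[h1 h2]; apply: hlim; rewrite !ltW. Qed.

Lemma lim_subdist_lipschitz : exists2 K : R, 0 < K & forall r s t,
  a <= s <= b -> a <= t <= b -> `|F r s - F r t| <= K * `|s - t|.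
Proof.
have [K K0 hK] := subdist_lipschitz; exists K => // r s t sab tab.
have c : `|subdist M w m r s - subdist M w m r t| @[m --> \oo] --> `|F r s - F r t|.
  by apply: cvg_norm; apply: cvgB; exact: subdist_cvg.
rewrite -(cvg_lim (@Rhausdorff R) c); apply: limr_le; first by apply/cvg_ex;
  exists `|F r s - F r t|.
by exists 1%N => // m /= m0; exact: hK.
Qed.

Lemma lim_subdist_le r s t : a <= s <= b -> a <= t <= b -> s <= t -> F r s <= F r t.
Proof.
move=> sab tab st; have cs := @subdist_cvg r _ sab; have ct := @subdist_cvg r _ tab.
rewrite -(cvg_lim (@Rhausdorff R) cs) -(cvg_lim (@Rhausdorff R) ct).
apply: ler_lim; [by apply/cvg_ex; eexists; exact: cs|by apply/cvg_ex; eexists; exact: ct|].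
exists 1%N => // m /= m0.
have s01 := in01 sab; have t01 := in01 tab.
rewrite !subdistE// ler_pM2l ?invr_gt0 ?ltr0n//; apply: ler_sum => i _.
apply: le_Er; [exact: bmf_count1..|] => u; rewrite !count1_mix_pair//; exact: count_of_le.
Qed.

End empirical_processes.

(** * The crossing at the Simes point *)

Section crossing_drift.
Context {R : realType}.
Implicit Types (f G : R -> R) (x t : R).

Lemma derive1_expansion f x e : derivable (f : R -> R^o) x 1 -> 0 < e ->
  exists2 del : R, 0 < del & forall h, `|h| <= del ->
    `|f (x + h) - f x - derive1 (f : R -> R^o) x * h| <= e * `|h|.
Proof.
move=> df e0; have : (fun h : R => h^-1 *: ((f (h *: 1 + x) : R^o) - f x))
  @ 0^' --> ('D_1 (f : R -> R^o) x : R^o).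
  exact: df.
move=> /cvgrPdist_le /(_ e e0)[r /= r0 hr].
exists (r / 2); first by rewrite divr_gt0.
move=> h hh; have [->|h0] := eqVneq h 0; first by rewrite addr0 subrr mulr0 subrr normr0 mulr0.
have : `|'D_1 (f : R -> R^o) x - h^-1 * (f (h * 1 + x) - f x)| <= e.
  apply: hr => //=; rewrite /ball/= sub0r normrN (le_lt_trans hh)// ltr_pdivrMr// ltr_pMr//
    ltr1n //.
rewrite derive1E mulr1 [h + x]addrC => hle.
rewrite -ler_pdivrMr ?normr_gt0// -normfV -normrM mulrBl mulfK// distrC mulrC.
exact: hle.
Qed.

Context (G : R -> R) (q tau b g : R).
Hypotheses (tb : tau < b) (Gtau : G tau = tau / q) (Glt : forall t, tau < t <= b -> G t < t / q)
  (dG : derivable (G : R -> R^o) tau 1) (gE : derive1 (G : R -> R^o) tau = g)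
  (gn : q^-1 - g != 0).

(** [G] touches the line [t / q] at [tau] and is below it on the right, so its slope is at most
    [q^-1]; the assumption [gn] excludes equality. *)
Lemma crossing_slope_gt0 : 0 < q^-1 - g.
Proof.
rewrite lt0r gn/= leNgt; apply/negP => k0.
have e0 : 0 < - (q^-1 - g) / 2 by rewrite divr_gt0// oppr_gt0.
have [del d0 hd] := derive1_expansion dG e0.
pose h := Num.min del (b - tau).
have h0 : 0 < h by rewrite lt_min d0 subr_gt0.
have := hd h; rewrite (ger0_norm (ltW h0)) ge_min lexx => /(_ isT).
have : G (tau + h) < (tau + h) / q.
  by apply: Glt; rewrite ltrDl h0 -lerBrDl ge_min lexx orbT.
rewrite gE Gtau mulrDl ler_norml => h1 /andP[h2 _].
have : - (- (q^-1 - g) / 2 * h) < h * q^-1 - g * h by lra.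
nra.
Qed.

Hypothesis Glip : exists2 K : R, 0 < K & forall s t, tau <= s <= b -> tau <= t <= b ->
  `|G s - G t| <= K * `|s - t|.

(** Close to [tau] the derivative gives the slope [kap / 2]; on the compact rest the continuous gap
    [D] has a negative maximum, and dividing it by [b - tau] gives a slope again. *)
Lemma crossing_drift : exists2 c : R, 0 < c & forall t, tau <= t <= b ->
  G t - t / q <= - (c * (t - tau)).
Proof.
have k0 := crossing_slope_gt0; set kap := q^-1 - g in k0.
have e0 : 0 < kap / 2 by rewrite divr_gt0.
have [del d0 hd] := derive1_expansion dG e0.
pose t1 := Num.min (tau + del) b.
have t1b : t1 <= b by rewrite ge_min lexx orbT.
have t1tau : tau < t1 by rewrite lt_min tb ltrDl d0.
pose D t := G t - t / q.
have cD : {within `[t1, b], continuous D}.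
  have [K K0 hK] := Glip.
  apply/subspace_continuousP => x /=; rewrite in_itv/= => /andP[x1 x2].
  apply/cvgrPdist_le => /= e ee.
  have c0 : 0 < K + `|q^-1| by rewrite ltr_pwDl.
  near=> y.
  have yab : t1 <= y <= b.
    have : `[t1, b]%classic y by near: y; exact: withinT.
    by rewrite /= in_itv.
  change (`|D x - D y| <= e); rewrite /D (_ : _ - _ = (G x - G y) - (x - y) * q^-1); last by ring.
  rewrite (le_trans (ler_normB _ _))// normrM.
  apply: (@le_trans _ _ ((K + `|q^-1|) * `|x - y|)).
    rewrite mulrDl [`|q^-1| * _]mulrC lerD2r hK ?x2 ?(le_trans (ltW t1tau))//.
    by case/andP: yab.
    by case/andP: yab.
  rewrite -ler_pdivlMl// mulrC.
  near: y; apply: cvg_within; exists (e / (K + `|q^-1|)) => /=; first by rewrite divr_gt0.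
  by move=> z /= /ltW.
have [c0 c0ab hc0] := EVT_max t1b cD.
have D0 : D c0 < 0.
  move: c0ab; rewrite in_itv/= => /andP[h1 h2]; rewrite subr_lt0 Glt// h2 andbT.
  exact: lt_le_trans h1.
exists (Num.min (kap / 2) (- D c0 / (b - tau))).
  by rewrite lt_min e0 divr_gt0// ?oppr_gt0// subr_gt0.
move=> t /andP[t0 tb']; have [tt1|tt1] := leP t t1.
  have hh : `|t - tau| <= del.
    by rewrite ger0_norm ?subr_ge0// lerBlDl (le_trans tt1)// ge_min lexx.
  have ht0 : 0 <= t - tau by rewrite subr_ge0.
  have := hd _ hh; rewrite (addrC tau) subrK gE Gtau (ger0_norm ht0) ler_norml => /andP[_ h].
  apply: (@le_trans _ _ (- (kap / 2 * (t - tau)))).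
    by move: h; rewrite /kap; move: (G t) => y; lra.
  by rewrite lerN2 ler_wpM2r ?subr_ge0// ge_min lexx.
apply: (@le_trans _ _ (D c0)).
  by apply: hc0; rewrite in_itv/= tb' ltW.
rewrite lerNr; apply: (@le_trans _ _ (- D c0 / (b - tau) * (t - tau))).
  by rewrite ler_wpM2r ?subr_ge0// ge_min lexx orbT.
have Dc0 : 0 <= - D c0 by rewrite oppr_ge0 ltW.
by rewrite -mulrA ler_piMr// mulrC ler_pdivrMr ?subr_gt0// mul1r lerD2r.
Unshelve. all: end_near. Qed.

End crossing_drift.

(** Telescoping, from [(x + 1) ^- 2 <= x^-1 - (x + 1)^-1]. *)
Lemma inv_sq_sum_le (R : realType) (J N : nat) : (0 < J)%N ->
  \sum_(J.+1 <= i < N) (i%:R ^+ 2)^-1 <= J%:R^-1 :> R.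
Proof.
move=> J0; have J0' : 0 < J%:R :> R by rewrite ltr0n.
have step (x : R) : 0 < x -> ((x + 1) ^+ 2)^-1 <= x^-1 - (x + 1)^-1.
  move=> x0; have x1 : 0 < x + 1 by rewrite addr_gt0.
  rewrite (_ : x^-1 - (x + 1)^-1 = (x * (x + 1))^-1); last by field; rewrite !gt_eqF.
  by rewrite lef_pV2 ?posrE ?exprn_gt0 ?mulr_gt0// expr2 ler_pM2r// lerDl.
have [NJ|/ltnW/subnKC <-] := leqP N J.+1; first by rewrite big_geq// invr_ge0 ltW.
suff : \sum_(J.+1 <= i < J.+1 + (N - J.+1)) (i%:R ^+ 2)^-1 <= J%:R^-1 - (J + (N - J.+1))%:R^-1 :> R.
  by move/le_trans; apply; rewrite gerBl invr_ge0.
elim: (N - J.+1)%N => [|n ih]; first by rewrite !addn0 big_geq// subrr.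
rewrite addnS big_nat_recr/= ?leq_addr// addSn addnS.
have := step (J + n)%:R; rewrite ltr0n addn_gt0 J0 natr1 => /(_ isT) h.
by apply: (le_trans (lerD ih h)); rewrite addrA subrK.
Qed.

Lemma grid_exists (R : realType) (B eta : R) : 0 < eta -> 0 <= B ->
  exists s : seq R, forall y, `|y| <= B -> exists2 x, x \in s & y <= x <= y + eta.
Proof.
(* The largest index used is the truncated quotient plus 1, hence [.+2] points counted from 0. *)
move=> e0 B0; exists [seq i%:R * eta - B | i <- iota 0 (Num.truncn (2 * B / eta)).+2] => y.
rewrite ler_norml => /andP[y1 y2].
have h0 : 0 <= (y + B) / eta by rewrite divr_ge0 ?(ltW e0)// -lerBlDr sub0r.
have /andP[h1 h2] := truncn_itv h0.
exists ((Num.truncn ((y + B) / eta)).+1%:R * eta - B).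
  apply/mapP; exists (Num.truncn ((y + B) / eta)).+1 => //; rewrite mem_iota add0n ltnS.
  rewrite ltnS; apply: le_truncn; rewrite ler_pM2r ?invr_gt0//; lra.
move: h1 h2; rewrite ler_pdivlMr// ltr_pdivrMr// -natr1 => h1 h2.
by apply/andP; split; lra.
Qed.

(* [D0] and [D1] stand for [x |-> sqrt m (emp (tau + x / sqrt m) - F_r tau)], [g0] and [g1] for the
   slopes [F_r' tau], and [xs] for the rescaled threshold. *)
Lemma crossing_sandwich (R : realType) (D0 D1 : R -> R) (W0 W1 g0 g1 q eta K' J B xs : R) (s : seq
  R) :
  let kap := q^-1 - (g0 + g1) in let S := W0 + W1 in
  {homo D0 : x y / x <= y} -> {homo D1 : x y / x <= y} ->
  0 < q -> 0 < eta -> 0 < kap -> 0 <= g0 -> 0 <= J -> `|S| <= K' ->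
  (K' + (2 + q^-1) * eta) / kap + eta + J <= B ->
  (forall y, `|y| <= B -> exists2 x, x \in s & y <= x <= y + eta) ->
  (forall x, x \in s -> `|D0 x - W0 - g0 * x| <= eta /\ `|D1 x - W1 - g1 * x| <= eta) ->
  xs / q <= D0 xs + D1 xs -> xs < J -> (forall x, x / q <= D0 x + D1 x -> D0 x <= D0 xs) ->
  `|D0 xs - (W0 + g0 / kap * S)| <= eta * (g0 * (2 + q^-1) / kap + g0 + 1).
Proof.
move=> kap S mD0 mD1 q0 eta0 k0 g00 J0 SK hB grid approx xsP xsJ xsmax.
have qi : 0 < q^-1 by rewrite invr_gt0.
have ik : 0 < kap^-1 by rewrite invr_gt0.
have kn : kap != 0 by rewrite gt_eqF.
move: SK; rewrite ler_norml => /andP[S1 S2].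
have K0 : 0 <= K' by lra.
have h2q : 0 < (2 + q^-1) * eta by rewrite mulr_gt0// addr_gt0.
(* An upper estimate of the crossing: [2 * eta] pays for the two expansions and [q^-1 * eta] for
   rounding to the grid. *)
set Y := (S + (2 + q^-1) * eta) / kap.
have YB : `|Y| <= (K' + (2 + q^-1) * eta) / kap.
  rewrite normrM (ger0_norm (ltW ik)) ler_pM2r// ler_norml; apply/andP; split; lra.
rewrite ler_norml; apply/andP; split.
  (* Lower bound: a grid point this far to the left satisfies the crossing condition, so its [D0] is
     dominated by that of [xs]. *)
  have [|x xin /andP[x1 x2]] := grid ((S - 2 * eta) / kap - eta).
    apply: le_trans hB; rewrite (le_trans (ler_normB _ _))// (ger0_norm (ltW eta0)).
    apply: (@le_trans _ _ ((K' + (2 + q^-1) * eta) / kap + eta)); last by rewrite lerDl.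
    rewrite lerD2r normrM (ger0_norm (ltW ik)) ler_pM2r//.
    have qe : 0 < q^-1 * eta by rewrite mulr_gt0.
    by rewrite ler_norml; apply/andP; split; lra.
  have [a0 a1] := approx x xin; move: a0 a1; rewrite !ler_norml => /andP[a0 a0'] /andP[a1 a1'].
  have xk : kap * x <= S - 2 * eta.
    by rewrite mulrC -ler_pdivlMr//; lra.
  have xc : x / q <= D0 x + D1 x by move: xk; rewrite /kap /S; lra.
  have := xsmax x xc => h.
  have g0x : g0 * ((S - 2 * eta) / kap - eta) <= g0 * x by rewrite ler_wpM2l.
  have e1 : g0 * ((S - 2 * eta) / kap - eta) = g0 / kap * S - eta * (2 * g0 / kap + g0) by ring.
  have e2 : eta * (g0 * (2 + q^-1) / kap + g0 + 1) = eta * (2 * g0 / kap + g0) + eta + eta * (g0 *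
    (q^-1 / kap)) by ring.
  have e3 : 0 <= eta * (g0 * (q^-1 / kap)) by rewrite mulr_ge0 ?mulr_ge0// ltW.
  rewrite e2; lra.
have xsY : xs <= Y.
  (* A crossing left of the grid is already below [Y]; otherwise monotonicity compares [xs] with the
     next grid point. *)
  have [xsB|xsB] := leP (- B) xs; last first.
    move: YB; rewrite ler_norml => /andP[h _]; lra.
  have [|x xin /andP[x1 x2]] := grid xs.
    rewrite ler_norml xsB/=; apply: le_trans (ltW xsJ) _; apply: le_trans hB.
    by rewrite lerDr addr_ge0 ?ltW// divr_gt0// ltr_wpDl.
  have [a0 a1] := approx x xin; move: a0 a1; rewrite !ler_norml => /andP[a0 a0'] /andP[a1 a1'].
  apply: (le_trans x1); rewrite ler_pdivlMr//.
  have m0 := mD0 _ _ x1; have m1 := mD1 _ _ x1.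
  have xq : (x - eta) / q <= xs / q by rewrite ler_pM2r// lerBlDr.
  rewrite /kap /S; lra.
have [|x xin /andP[x1 x2]] := grid Y.
  apply: le_trans YB _; apply: le_trans hB; lra.
have [a0 a1] := approx x xin; move: a0; rewrite ler_norml => /andP[a0 a0'].
have m0 := mD0 _ _ (le_trans xsY x1).
have g0x : g0 * x <= g0 * (Y + eta) by rewrite ler_wpM2l.
have e1 : g0 * (Y + eta) = g0 / kap * S + eta * (g0 * (2 + q^-1) / kap + g0) by rewrite /Y; ring.
lra.
Qed.

Section union_bounds.
Context d (T : measurableType d) (R : realType) (P : probability T R).

Lemma fine_prob_setU (A B : set T) : measurable A -> measurable B ->
  fine (P (A `|` B)) <= fine (P A) + fine (P B).
Proof.
move=> mA mB; have fA := fin_num_measure P _ mA; have fB := fin_num_measure P _ mB.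
rewrite -lee_fin EFinD !fineK//; first exact: measureU2.
exact/fin_num_measure/measurableU.
Qed.

Lemma union_bound (I : eqType) (s : seq I) (A : I -> set T) (c : I -> R) :
  (forall i, i \in s -> measurable (A i) /\ fine (P (A i)) <= c i) ->
  exists B, [/\ measurable B, fine (P B) <= \sum_(i <- s) c i &
    forall u, ~ B u -> forall i, i \in s -> ~ A i u].
Proof.
elim: s => [|i s ih] H.
  by exists set0; split => //; rewrite ?big_nil ?measure0.
have [|B [mB PB hB]] := ih; first by move=> j js; apply: H; rewrite inE js orbT.
have [mA PA] := H i (mem_head _ _).
exists (A i `|` B); split; first exact: measurableU.
- by rewrite big_cons (le_trans (fine_prob_setU mA mB))// lerD.
- move=> u /not_orP[nA nB] j; rewrite inE => /predU1P[->//|]; exact: hB.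
Qed.

End union_bounds.

Section arithmetic.
Context {R : realType}.
Implicit Types x y z s t c : R.

Lemma norm_sub_shift x x' y y' : `|x - y| <= `|x' - y'| + `|x - x'| + `|y - y'|.
Proof.
rewrite (_ : x - y = (x' - y') + (x - x') - (y - y')); last by ring.
by rewrite (le_trans (ler_normB _ _))// lerD// (le_trans (ler_normD _ _)).
Qed.

Lemma norm_addB x x' y y' : `|x + y - (x' + y')| <= `|x - x'| + `|y - y'|.
Proof. by rewrite opprD addrACA ler_normD. Qed.

Lemma le_add_double x y c : x <= c -> y <= c -> 2 * x + 2 * y <= 4 * c.
Proof. lra. Qed.

Lemma sqr_add_le x y : (x + y) ^+ 2 <= 2 * x ^+ 2 + 2 * y ^+ 2.
Proof. by have := sqr_ge0 (x - y); nra. Qed.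

Lemma derive1_add (f g h : R -> R^o) x : (forall t, h t = f t + g t) ->
  derivable f x 1 -> derivable g x 1 -> derivable h x 1 /\ derive1 h x = derive1 f x + derive1 g x.
Proof.
move=> hE df dg; have -> : h = f + g by apply/funext => t; exact: hE.
split; first exact: derivableD.
by rewrite !derive1E; exact: deriveD.
Qed.

(** The drift [- (c * n)] is set against a fluctuation below [c / 2 * n]; the slack is 2 for the two
    subdistributions and [q^-1] for moving [t] to the next grid point. *)
Lemma late_crossing_arith q tau s ti t (Gi Gm Wi Ei : R) c (n : R) :
  0 < q -> 0 < s -> s * (ti - tau) = n -> ti <= t + s^-1 -> Gi - ti / q <= - (c * (ti - tau)) ->
  s * (Gm - Gi) <= 2 -> Wi < c / 2 * n -> s * Ei = Wi + s * Gm -> t / q <= Ei ->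
  c / 2 * n < 2 + q^-1.
Proof.
move=> q0 s0 sn tit Gic close Wic EE tE.
have qi : 0 < q^-1 by rewrite invr_gt0.
have h1 : s * (ti / q) <= s * (t / q) + q^-1.
  have : s * (ti / q) <= s * ((t + s^-1) / q) by rewrite ler_pM2l// ler_pM2r.
  by rewrite [(t + _) / q]mulrDl mulrDr [s * (s^-1 / q)]mulrA divff ?mul1r// gt_eqF.
have h2 : s * (t / q) <= s * Ei by rewrite ler_pM2l.
have h3 : s * (Gi - ti / q) <= s * - (c * (ti - tau)) by rewrite ler_pM2l.
have h4 : s * - (c * (ti - tau)) = - (c * n) by rewrite -sn; ring.
have h5 : s * (Gi - ti / q) = s * Gi - s * (ti / q) by rewrite mulrBr.
have h6 : s * (Gm - Gi) = s * Gm - s * Gi by rewrite mulrBr.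
lra.
Qed.

Lemma half_lt_absurd c (n z : R) : 0 < c -> 2 * z / c <= n -> z <= c / 2 * n.
Proof. by move=> c0; rewrite ler_pdivrMr//; lra. Qed.

Lemma chebyshev_const (C c n : R) : 0 < c -> 0 < n -> 4 * C / (c / 2 * n) ^+ 2 = 16 * C / c ^+ 2 *
  (n ^+ 2)^-1.
Proof. by move=> c0 n0; field; rewrite !gt_eqF. Qed.

Lemma expansion_arith s x (E Wt Wtau Fm Ft Ftau g eta : R) : 0 < s -> 0 < eta ->
  s * E = Wt + s * Fm -> `|Wt - Wtau| < eta / 3 -> `|s * (Fm - Ft)| <= eta / 3 ->
  `|Ft - Ftau - g * (x / s)| <= eta / 3 / (`|x| + 1) * `|x / s| ->
  `|s * (E - Ftau) - Wtau - g * x| <= eta.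
Proof.
move=> s0 e0 EE h1 h2 h3.
have x1 : 0 < `|x| + 1 by rewrite ltr_wpDl.
have h4 : `|s * (Ft - Ftau - g * (x / s))| <= eta / 3.
  rewrite normrM (ger0_norm (ltW s0)).
  apply: (@le_trans _ _ (s * (eta / 3 / (`|x| + 1) * `|x / s|))); first by rewrite ler_pM2l.
  rewrite normrM normfV (ger0_norm (ltW s0)).
  rewrite (_ : s * _ = eta / 3 * (`|x| / (`|x| + 1))); last by field; rewrite !gt_eqF.
  by rewrite ler_piMr ?divr_ge0 ?(ltW e0)// ler_pdivrMr// mul1r lerDl.
rewrite (_ : s * (E - Ftau) - Wtau - g * x = (Wt - Wtau) + s * (Fm - Ft) + s * (Ft - Ftau - g * (x
  / s))).
  rewrite (_ : eta = eta / 3 + eta / 3 + eta / 3); last by field.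
  by rewrite (le_trans (ler_normD _ _))// lerD// (le_trans (ler_normD _ _))// lerD// ltW.
rewrite mulrBr EE; field; by rewrite gt_eqF.
Qed.

Lemma slutsky_linear_arith (W0 W1 g0 k : R) : (1 + g0 / k) * W0 + g0 / k * W1 = W0 + g0 / k * (W0 +
  W1).
Proof. ring. Qed.

End arithmetic.

(** * Linearization of the false positive ratio *)

Section linearization.
Context d (T : measurableType d) (R : realType) (P : probability T R) (k : nat).
Context (M : factor_model P k) (w : 'rV[R]_k) (q a b tau : R).

Local Notation bmf := (@bmf _ T R).
Local Notation Er := (Er P).
Local Notation W := (emp_process M w).
Local Notation F := (lim_subdist M w).
Local Notation G := (lim_dist M w).
Local Notation emp := (emp_subdist M w).

Hypotheses (q0 : 0 < q) (a0 : 0 < a) (atau : a < tau) (taub : tau < b) (qb : q < b) (b1 : b < 1)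
  (hload : sup [set x | exists m (i : 'I_m), x = sqnorm2 (loading M i)] < 1)
  (hal : cvgn (series (fun n => n%:R * alpha M n)))
  (hlim : forall (r : bool) (t : R), 0 <= t <= 1 -> cvgn (fun m => subdist M w m r t))
  (Gtau : G tau = tau / q) (Glt : forall t, tau < t <= b -> G t < t / q)
  (hdiff : forall r : bool, derivable (F r : R -> R^o) tau 1)
  (hslope : q^-1 - derive1 (G : R -> R^o) tau != 0)
  (hunif : forall r : bool,
       sup [set `|Num.sqrt m%:R * (subdist M w m r t - F r t)|
             | t in `[a, b]%classic] @[m --> \oo] --> (0 : R)).

Let ab : a < b. Proof. exact: lt_trans atau taub. Qed.
Let tauab : a <= tau <= b. Proof. by rewrite !ltW. Qed.
Let in01 t : a <= t <= b -> 0 < t < 1.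
Proof. by move=> /andP[h1 h2]; rewrite (lt_le_trans a0 h1) (le_lt_trans h2 b1). Qed.

Lemma lim_dist_derive : derivable (G : R -> R^o) tau 1 /\
  derive1 (G : R -> R^o) tau = derive1 (F false : R -> R^o) tau + derive1 (F true : R -> R^o) tau.
Proof.
have h := @derive1_add R (F false) (F true) G tau (fun t => erefl) (@hdiff false) (@hdiff true).
exact: h.
Qed.

(** Pointwise bounds can be read off a [sup] when its set is bounded; the Lipschitz bounds provide
    this for every positive [m]. *)
Lemma subdist_unif (e : R) : 0 < e -> \forall m \near \oo, forall r t, a <= t <= b ->
  `|Num.sqrt m%:R * (subdist M w m r t - F r t)| <= e.
Proof.
move=> e0.
have [K1 K10 hK1] := subdist_lipschitz w a0 ab b1 hload.
have [K2 K20 hK2] := lim_subdist_lipschitz a0 ab b1 hload hlim.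
have one r : \forall m \near \oo, forall t, a <= t <= b ->
    `|Num.sqrt m%:R * (subdist M w m r t - F r t)| <= e.
  have /cvgrPdist_le /(_ e e0) n1 := @hunif r.
  have n2 : \forall m \near \oo, (0 < m)%N by exists 1%N.
  apply: filterS2 n1 n2 => m; rewrite sub0r normrN => hm m0 t tab.
  apply: le_trans hm; apply: le_trans (ler_norm _); apply: ub_le_sup; last first.
    by exists t => //=; rewrite in_itv.
  exists (Num.sqrt m%:R * (`|subdist M w m r tau - F r tau| + K1 * (b - a) + K2 * (b - a))).
  move=> _ /= [s + <-]; rewrite in_itv/= => sab.
  rewrite normrM ger0_norm ?sqrtr_ge0// ler_wpM2l ?sqrtr_ge0//.
  have d1 := hK1 m r s tau m0 sab tauab; have d2 := hK2 r s tau sab tauab.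
  have st : `|s - tau| <= b - a.
    move: sab tauab => /andP[? ?] /andP[? ?]; rewrite ler_norml; apply/andP; split; lra.
  have d1' := le_trans d1 (ler_wpM2l (ltW K10) st); have d2' := le_trans d2 (ler_wpM2l (ltW K20)
    st).
  apply: le_trans (norm_sub_shift _ (subdist M w m r tau) _ (F r tau)) _.
  by apply: lerD => //; apply: lerD.
by apply: filterS2 (one false) (one true) => m h1 h2 [].
Qed.

Lemma sqrt_large (K : R) : \forall m \near \oo, (0 < m)%N /\ K <= Num.sqrt m%:R.
Proof.
exists (Num.truncn (K ^+ 2)).+1 => // m /= hm; split; first exact: leq_trans hm.
have [K0|K0] := leP K 0; first exact: le_trans K0 (sqrtr_ge0 _).
rewrite -(ger0_norm (ltW K0)) -sqrtr_sqr ler_wsqrtr//.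
by rewrite (le_trans (ltW (truncnS_gt _)))// ler_nat.
Qed.

Lemma emp_le m r s t u : s <= t -> emp m r s u <= emp m r t u.
Proof.
move=> st; rewrite /emp_subdist ler_wpM2l ?invr_ge0//; apply: ler_sum => i _; rewrite ler_nat.
by case: (_ == _) => //=; case: leP => // /le_trans -> .
Qed.

Lemma emp_process_sum_sq_le (C : R) m t : (forall r, Er (fun u =>
  W m r t u ^+ 2) <= C) -> 0 < t < 1 ->
  Er (fun u => (W m false t u + W m true t u) ^+ 2) <= 4 * C.
Proof.
move=> hC t01; have bW r := bmf_emp_process M w m r t01.
have bq r : bmf (fun u => 2 * W m r t u ^+ 2) by apply: bmfZ; exact: bmfX.
apply: (@le_trans _ _ (Er (fun u => 2 * W m false t u ^+ 2 + 2 * W m true t u ^+ 2))).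
  apply: le_Er; [by apply: bmfX; exact: bmfD|exact: bmfD|] => u.
  exact: sqr_add_le.
rewrite ErD// !ErZ; [|exact: bmfX..].
exact: le_add_double.
Qed.

Lemma chebyshev_sum (C c : R) m t : (forall r, Er (fun u => W m r t u ^+ 2) <= C) -> 0 < t < 1 ->
  0 < c ->
  measurable [set u | c <= `|W m false t u + W m true t u|] /\
  fine (P [set u | c <= `|W m false t u + W m true t u|]) <= 4 * C / c ^+ 2.
Proof.
move=> hC t01 c0.
have bW : bmf (fun u => W m false t u + W m true t u) by apply: bmfD; exact: bmf_emp_process.
split.
  have [mn _] := bmf_norm bW.
  rewrite -[X in measurable X]setTI (_ : [set u | _] =
    (fun u => `|W m false t u + W m true t u|) @^-1` `[c, +oo[); first exact: mn.
  by apply/seteqP; split => u /=; rewrite in_itv/= andbT.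
apply: le_trans (chebyshev_Er _ bW c0) _; rewrite ler_pM2r ?invr_gt0 ?exprn_gt0//.
exact: emp_process_sum_sq_le.
Qed.

Lemma sqrt_emp m r t u :
  Num.sqrt m%:R * emp m r t u = W m r t u + Num.sqrt m%:R * subdist M w m r t.
Proof. by rewrite /emp_process mulrBr subrK. Qed.

(* The probability that [W_0 + W_1] exceeds [c i / 2] at [tau + i / sqrt m] is [O (i^-2)]; between
   two grid points the empirical distribution is monotone. *)
Lemma no_late_crossing (e : R) : 0 < e -> exists2 J : nat, (0 < J)%N & \forall m \near \oo,
  exists A : set T, [/\ measurable A, fine (P A) <= e & forall u, ~ A u -> forall t, t <= q ->
    t / q <= emp m false t u + emp m true t u -> t < tau + J%:R / Num.sqrt m%:R].
Proof.
move=> e0.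
have [C C0 hC] := emp_process_variance_bounded w hal.
have [c c0 hc] : exists2 c : R, 0 < c & forall t, tau <= t <= b -> G t - t / q <= - (c * (t - tau)).
  have [dG gE] := lim_dist_derive.
  have [K K0 hK] := lim_subdist_lipschitz a0 ab b1 hload hlim.
  apply: (crossing_drift taub Gtau Glt dG (erefl _) hslope).
  exists (K + K) => [|s t /andP[s1 s2] /andP[t1 t2]]; first exact: addr_gt0.
  by rewrite (le_trans (norm_addB _ _ _ _))// mulrDl lerD// hK ?s2 ?t2 ?(le_trans (ltW atau)).
have qi : 0 < q^-1 by rewrite invr_gt0.
have cC : 0 < 16 * C / c ^+ 2 by rewrite divr_gt0 ?mulr_gt0 ?exprn_gt0.
(* The first entry contradicts a crossing at an index beyond [J], through [c / 2 * i >= 2 + q^-1];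
   the second brings the union bound, at most [16 * C / c ^+ 2 / J], under [e]. *)
pose B := Num.max (2 * (2 + q^-1) / c) (16 * C / c ^+ 2 / e).
pose J := (Num.truncn B).+1.
have BJ : B < J%:R by exact: truncnS_gt.
exists J => //.
(* A square root of [m] above [(b - q)^-1] leaves room to round [t <= q] up to a grid point that is
   still at most [b]. *)
have n1 := subdist_unif ltr01; have n2 := sqrt_large ((b - q)^-1).
apply: filterS2 n1 n2 => m unif [m0 sm].
set s := Num.sqrt m%:R in sm *.
have s0 : 0 < s by rewrite sqrtr_gt0 ltr0n.
pose t_ (i : nat) : R := tau + i%:R / s.
have t_tau i : s * (t_ i - tau) = i%:R by rewrite /t_ addrAC subrr add0r mulrC divfK// gt_eqF.
pose A (i : nat) : set T := if t_ i <= b then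
   [set u | c / 2 * i%:R <= `|W m false (t_ i) u + W m true (t_ i) u|] else set0.
pose N := (Num.truncn (s * (b - tau))).+1.
have tab i : t_ i <= b -> a <= t_ i <= b.
  by move=> ->; rewrite andbT (le_trans (ltW atau))// lerDl divr_ge0// ltW.
have [|B0 [mB PB hB]] := @union_bound _ _ _ P nat (index_iota J.+1 N.+1) A (fun i =>
  16 * C / c ^+ 2 * (i%:R ^+ 2)^-1).
  move=> i; rewrite mem_index_iota => /andP[Ji _]; rewrite /A; case: ifP => [tib|_]; last first.
    by split => //; rewrite measure0/= mulr_ge0 ?invr_ge0 ?sqr_ge0// ltW.
  have i0 : 0 < i%:R :> R by rewrite ltr0n (leq_ltn_trans _ Ji).
  have ci : 0 < c / 2 * i%:R by rewrite mulr_gt0// divr_gt0.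
  have t01 := in01 (tab _ tib).
  have [h1 h2] := @chebyshev_sum C _ m (t_ i) (fun r => hC m r _ m0 t01) t01 ci.
  by split => //; apply: le_trans h2 _; rewrite chebyshev_const.
exists B0; split => //.
  apply: le_trans PB _; rewrite -mulr_sumr.
  apply: (@le_trans _ _ (16 * C / c ^+ 2 * J%:R^-1)).
    rewrite ler_wpM2l ?inv_sq_sum_le//; exact: ltW.
  rewrite ler_pdivrMr ?ltr0n// -ler_pdivrMl// mulrC.
  by apply: ltW; apply: le_lt_trans BJ; rewrite le_max lexx orbT.
move=> u nBu t tq cross; rewrite ltNge; apply/negP => tJ.
have x0 : 0 <= s * (t - tau).
  apply: mulr_ge0; first exact: ltW.
  by rewrite subr_ge0; apply: le_trans tJ; rewrite lerDl divr_ge0//; exact: ltW.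
have /andP[x1 x2] := truncn_itv x0.
(* The grid index just after [t], so that [t <= t_ i <= t + s^-1]. *)
pose i := (Num.truncn (s * (t - tau))).+1.
have Ji : (J < i)%N.
  rewrite ltnS truncn_ge_nat//.
  by move: tJ; rewrite -lerBrDl -[leLHS]mul1r mulrA ler_pdivrMr// mul1r mulrC.
have tit : t_ i <= t + s^-1.
  rewrite /t_ -natr1 mulrDl mul1r addrA lerD2r -lerBrDl ler_pdivrMr// [leRHS]mulrC; exact: x1.
have ti : t <= t_ i.
  by rewrite /t_ -lerBlDl ler_pdivlMr// mulrC ltW.
have tib : t_ i <= b.
  apply: le_trans tit _; rewrite -lerBrDl.
  apply: (@le_trans _ _ (b - q)); last by rewrite lerB.
  by rewrite -[leRHS]invrK lef_pV2// ?posrE ?invr_gt0 ?subr_gt0.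
have iN : (i < N.+1)%N.
  have sb0 : 0 <= s * (b - tau) by rewrite mulr_ge0 ?subr_ge0 ?ltW.
  by rewrite ltnS /N ltnW// ltnS truncn_ge_nat// -(t_tau i) ler_pM2l// lerD2r.
have nA := hB u nBu i; rewrite mem_index_iota Ji iN in nA; have := nA isT.
rewrite /A tib /= => /negP; rewrite -ltNge => Wlt.
have titau : tau <= t_ i <= b by rewrite tib lerDl divr_ge0// ltW.
have := @late_crossing_arith _ q tau s (t_ i) t (G (t_ i)) (subdist M w m false (t_ i) + subdist M
  w m true (t_ i))
  (W m false (t_ i) u + W m true (t_ i) u) (emp m false (t_ i) u + emp m true (t_ i) u) c i%:R q0 s0
  (t_tau i) tit (hc _ titau).
have cl : s * (subdist M w m false (t_ i) + subdist M w m true (t_ i) - G (t_ i)) <= 2.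
  rewrite /lim_dist opprD addrACA mulrDr (_ : 2 = 1 + 1); last by ring.
  by rewrite lerD// (le_trans (ler_norm _))// unif// tab.
have EE : s * (emp m false (t_ i) u + emp m true (t_ i) u) = W m false (t_ i) u + W m true (t_ i) u
  +
    s * (subdist M w m false (t_ i) + subdist M w m true (t_ i)).
  by rewrite mulrDr !sqrt_emp -/s mulrDr addrACA.
have cr : t / q <= emp m false (t_ i) u + emp m true (t_ i) u.
  by apply: le_trans cross _; rewrite lerD// emp_le.
move=> /(_ cl (le_lt_trans (ler_norm _) Wlt) EE cr).
apply/negP; rewrite -leNgt.
have h1 : 2 * (2 + q^-1) / c <= i%:R.
  apply: (@le_trans _ _ B); first by rewrite le_max lexx.
  by rewrite (le_trans (ltW BJ))// ler_nat ltnW.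
exact: half_lt_absurd.
Qed.

(** Three errors of size [eta / 3]: the increment of the process between [tau] and the moving point,
    the bias of the subdistribution, and the first-order expansion of its limit. *)
Lemma local_expansion r (x eta e : R) : 0 < eta -> 0 < e -> \forall m \near \oo,
  exists A : set T, [/\ measurable A, fine (P A) <= e & forall u, ~ A u ->
    `|Num.sqrt m%:R * (emp m r (tau + x / Num.sqrt m%:R) u - F r tau) - W m r tau u
      - derive1 (F r : R -> R^o) tau * x| <= eta].
Proof.
move=> eta0 e0.
have x1 : 0 < `|x| + 1 by rewrite ltr_wpDl.
have eta3 : 0 < eta / 3 by rewrite divr_gt0.
have [del1 d10 hd1] := derive1_expansion (@hdiff r) (divr_gt0 eta3 x1).
have [del2 d20 hd2] := emp_process_continuity w hal a0 ab b1 hload (mulr_gt0 e0 (exprn_gt0 2 eta3)).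
pose del := Num.min (Num.min del1 del2) (Num.min (tau - a) (b - tau)).
have del0 : 0 < del by rewrite !lt_min d10 d20 !subr_gt0 atau taub.
have n1 := subdist_unif eta3; have n2 := sqrt_large (`|x| / del).
apply: filterS2 n1 n2 => m unif [m0].
set s := Num.sqrt m%:R => sm.
have s0 : 0 < s by rewrite sqrtr_gt0 ltr0n.
have hx : `|x / s| <= del.
  by rewrite normrM normfV (ger0_norm (ltW s0)) ler_pdivrMr// mulrC -ler_pdivrMr.
move: hx; rewrite !le_min => /andP[/andP[hx1 hx2] /andP[hx3 hx4]].
have tab : a <= tau + x / s <= b.
  move: hx3 hx4; rewrite !ler_norml => /andP[h1 _] /andP[_ h2].
  by rewrite -lerBlDl -opprB h1 -lerBrDl.
have bW : bmf (fun u => W m r (tau + x / s) u - W m r tau u).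
  by apply: bmfB; apply: bmf_emp_process; exact: in01.
exists [set u | eta / 3 <= `|W m r (tau + x / s) u - W m r tau u|]; split.
- have [mn _] := bmf_norm bW.
  rewrite -[X in measurable X]setTI (_ : [set u | _] =
    (fun u => `|W m r (tau + x / s) u - W m r tau u|) @^-1` `[eta / 3, +oo[); first exact: mn.
  by apply/seteqP; split => u /=; rewrite in_itv/= andbT.
- apply: le_trans (chebyshev_Er _ bW eta3) _; rewrite ler_pdivrMr ?exprn_gt0//.
  apply: hd2 => //; by rewrite addrAC subrr add0r.
- move=> u /= /negP; rewrite -ltNge => Wlt.
  apply: (expansion_arith s0 eta0 (sqrt_emp m r _ u) Wlt); first exact: unif.
  exact: hd1.
Qed.

Lemma grid_expansion (gr : seq R) (eta e : R) : 0 < eta -> 0 < e -> \forall m \near \oo,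
  exists A : set T, [/\ measurable A, fine (P A) <= e & forall u, ~ A u ->
    forall x, x \in gr -> forall r,
    `|Num.sqrt m%:R * (emp m r (tau + x / Num.sqrt m%:R) u - F r tau) - W m r tau u
      - derive1 (F r : R -> R^o) tau * x| <= eta].
Proof.
move=> eta0; elim: gr e => [|x gr ih] e e0.
  by apply: nearW => m; exists set0; split => //; rewrite measure0/= ltW.
have e4 : 0 < e / 4 by rewrite divr_gt0.
have e2 : 0 < e / 2 by rewrite divr_gt0.
have n1 := local_expansion false x eta0 e4; have n2 := local_expansion true x eta0 e4.
apply: filterS3 n1 n2 (ih _ e2) => m [A1 [m1 p1 h1]] [A2 [m2 p2 h2]] [A3 [m3 p3 h3]].
have m12 := measurableU _ _ m1 m2.
exists (A1 `|` A2 `|` A3); split; first exact: measurableU.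
  rewrite (_ : e = e / 4 + e / 4 + e / 2); last by field.
  rewrite (le_trans (fine_prob_setU _ m12 m3))// lerD// (le_trans (fine_prob_setU _ m1 m2))//
    lerD//.
move=> u /not_orP[/not_orP[n1 n2] n3] y; rewrite inE => /predU1P[->|yg] r; last exact: h3.
by case: r; [exact: h2|exact: h1].
Qed.

Let g (r : bool) : R := derive1 (F r : R -> R^o) tau.
Let kap : R := q^-1 - derive1 (G : R -> R^o) tau.

Lemma lim_subdist_slope_ge0 r : 0 <= g r.
Proof.
rewrite leNgt; apply/negP => g0.
have e0 : 0 < - g r / 2 by rewrite divr_gt0// oppr_gt0.
have [del d0 hd] := derive1_expansion (@hdiff r) e0.
pose h := Num.min del (b - tau).
have h0 : 0 < h by rewrite lt_min d0 subr_gt0.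
have := hd h; rewrite (ger0_norm (ltW h0)) ge_min lexx => /(_ isT).
have thb : a <= tau + h <= b.
  by rewrite (le_trans (ltW atau)) ?lerDl ?(ltW h0)//= -lerBrDl ge_min lexx orbT.
have := lim_subdist_le a0 b1 hlim r tauab thb; rewrite lerDl => /(_ (ltW h0)) hF.
rewrite ler_norml -/(g r) => /andP[_].
have gh : g r * h < 0 by rewrite pmulr_llt0.
have : - g r / 2 * h = - (g r * h) / 2 by ring.
move: (g r * h) (F r (tau + h)) (F r tau) hF gh => y Fh Ft; move=> h1 h2 ->; lra.
Qed.

(** Three exceptional events of probability at most [e / 3] each: a late crossing, a failed
    expansion on the grid, and a large sum of the two processes at [tau]. Off them the argument is
    deterministic. *)
Lemma linearization (e : R) : 0 < e -> \forall m \near \oo, exists A : set T,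
  [/\ measurable A, fine (P A) <= e & forall u, ~ A u ->
   `|((1 + g false / kap) * W m false tau u + g false / kap * W m true tau u) -
     Num.sqrt m%:R * ((false_discoveries M w q m u)%:R / m%:R - F false tau)| <= e].
Proof.
move=> e0; have [dG gE] := lim_dist_derive.
have k0 : 0 < kap by exact: (crossing_slope_gt0 taub Gtau Glt dG (erefl _) hslope).
have kE : q^-1 - (g false + g true) = kap by rewrite /kap gE.
have g00 := lim_subdist_slope_ge0 false.
have qi : 0 < q^-1 by rewrite invr_gt0.
have q2 : 0 <= 2 + q^-1 by rewrite addr_ge0// ltW.
(* The factor of [eta] in the conclusion of [crossing_sandwich]. *)
pose Cst : R := g false * (2 + q^-1) / kap + g false + 1.
have Cst0 : 0 < Cst.
  by rewrite /Cst ltr_wpDl// addr_ge0// divr_ge0 ?(ltW k0)// mulr_ge0.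
pose eta : R := e / Cst.
have eta0 : 0 < eta by rewrite divr_gt0.
have e3 : 0 < e / 3 by rewrite divr_gt0.
have [J J0 nearJ] := no_late_crossing e3.
have [C C0 hC] := emp_process_variance_bounded w hal.
(* As [K' >= 1], Chebyshev's bound [4 * C / K' ^+ 2] is at most [4 * C / K'], hence at most
   [e / 3]. *)
pose K' := 4 * C / (e / 3) + 1.
have K'1 : 1 <= K' by rewrite lerDr divr_ge0 ?(ltW e3)// mulr_ge0// ltW.
have K'0 : 0 < K' by exact: lt_le_trans K'1.
pose B := (K' + (2 + q^-1) * eta) / kap + eta + J%:R.
have B0 : 0 <= B.
  by rewrite !addr_ge0// ?(ltW eta0)// divr_ge0 ?(ltW k0)// addr_ge0 ?(ltW K'0)//
    mulr_ge0 ?(ltW eta0).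
have [gr hgr] := grid_exists eta0 B0.
have n1 := grid_expansion gr eta0 e3; have n2 := sqrt_large 0.
apply: filterS3 nearJ n1 n2 => m [A1 [m1 p1 h1]] [A2 [m2 p2 h2]] [m0 _].
have s0 : 0 < Num.sqrt m%:R :> R by rewrite sqrtr_gt0 ltr0n.
have t01 := in01 tauab.
have [m3 p3] := @chebyshev_sum C K' m tau (fun r => hC m r _ m0 t01) t01 K'0.
set A3 := [set u | _] in m3 p3.
have m12 := measurableU _ _ m1 m2.
exists (A1 `|` A2 `|` A3); split; first exact: measurableU.
  rewrite (_ : e = e / 3 + e / 3 + e / 3); last by field.
  rewrite (le_trans (fine_prob_setU _ m12 m3))// lerD//.
    by rewrite (le_trans (fine_prob_setU _ m1 m2))// lerD.
  apply: le_trans p3 _; rewrite ler_pdivrMr ?exprn_gt0// [leRHS]mulrC -ler_pdivrMr//.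
  apply: (@le_trans _ _ K'); first by rewrite lerDl.
  by rewrite expr2 ler_peMl// ltW.
move=> u /not_orP[/not_orP[nA1 nA2] /negP]; rewrite -ltNge => WK.
pose s := Num.sqrt m%:R : R.
pose D r x := s * (emp m r (tau + x / s) u - F r tau).
pose th := bh_threshold M w q m u.
pose xs := s * (th - tau).
have thE : tau + xs / s = th by rewrite /xs mulrAC divff ?gt_eqF// mul1r addrC subrK.
have mD r : {homo D r : x y / x <= y}.
  move=> x y xy; rewrite /D ler_pM2l// lerD2r emp_le// lerD2l ler_pM2r ?invr_gt0//.
(* The equality [G tau = tau / q] makes the line of slope [q^-1] pass through the origin of the
   rescaled picture. *)
have Dcross x : (x / q <= D false x + D true x) =
   ((tau + x / s) / q <= emp m false (tau + x / s) u + emp m true (tau + x / s) u).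
  rewrite /D -mulrDr addrACA -opprD -[F false tau + F true tau]/(G tau) Gtau.
  rewrite -[x in x / q](mulfVK (lt0r_neq0 s0)) [x / s * s]mulrC -mulrA ler_pM2l//.
  by rewrite lerBrDr [(tau + _) / q]mulrDl [tau / q + _]addrC.
have cross : xs / q <= D false xs + D true xs.
  by rewrite Dcross thE; exact: bh_threshold_crossing.
have xsJ : xs < J%:R.
  have /andP[_ thq] := bh_threshold_range M w q0 m0 u.
  have := h1 u nA1 th thq (bh_threshold_crossing M w q0 m0 u).
  by rewrite -ltrBlDl ltr_pdivlMr// mulrC.
have xsmax x : x / q <= D false x + D true x -> D false x <= D false xs.
  by rewrite Dcross => h; rewrite /D ler_pM2l// lerD2r thE; exact: emp_le_bh_threshold.
have approx x : x \in gr -> `|D false x - W m false tau u - g false * x| <= eta /\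
    `|D true x - W m true tau u - g true * x| <= eta.
  by move=> xg; split; exact: h2.
have k0' := k0; rewrite -kE in k0'.
have hB : (K' + (2 + q^-1) * eta) / (q^-1 - (g false + g true)) + eta + J%:R <= B by rewrite kE.
have := crossing_sandwich (mD false) (mD true) q0 eta0 k0' g00 (ler0n _ J) (ltW WK) hB hgr approx
  cross xsJ xsmax.
rewrite kE -/Cst /eta divfK ?gt_eqF// distrC -slutsky_linear_arith {1}/D thE.
have fE := false_discoveriesE M w q m u.
by rewrite fE; exact.
Qed.

End linearization.

Lemma Er_sqr_combination d (T : measurableType d) (R : realType) (P : probability T R) (X Y : T ->
  R)
    (c e : R) : bmf X -> bmf Y ->
  Er P (fun u => (c * X u + e * Y u) ^+ 2) = c ^+ 2 * Er P (fun u => X u * X u) +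
    e ^+ 2 * Er P (fun u => Y u * Y u) + 2 * e * c * Er P (fun u => Y u * X u).
Proof.
move=> bX bY; have bXX := bmfM bX bX; have bYY := bmfM bY bY; have bYX := bmfM bY bX.
rewrite -!ErZ//.
have b1 := bmfZ (c ^+ 2) bXX; have b2 := bmfZ (e ^+ 2) bYY; have b3 := bmfZ (2 * e * c) bYX.
rewrite -(ErD P b1 b2) -(ErD P (bmfD b1 b2) b3).
by apply: eq_Er => u; ring.
Qed.

(** * Limit law of the linear part *)

Section limit_of_linear_part.
Context d (T : measurableType d) (R : realType) (P : probability T R) (k : nat).
Context (M : factor_model P k) (w : 'rV[R]_k) (tau be c00 c11 c10 : R).

Local Notation bmf := (@bmf _ T R).
Local Notation Er := (Er P).
Local Notation W := (emp_process M w).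

Hypotheses (tau01 : 0 < tau < 1) (hal : cvgn (series (fun n => n%:R * alpha M n)))
  (h00 : emp_cov M w m false false tau tau @[m --> \oo] --> c00)
  (h11 : emp_cov M w m true true tau tau @[m --> \oo] --> c11)
  (h10 : emp_cov M w m true false tau tau @[m --> \oo] --> c10).

Let centered m r (i : 'I_m) (x : R * bool) : R :=
  count_of M w r tau i x - Er (fun u => count_of M w r tau i (mix_pair M i u)).

(** The minus sign fits the argument [a +] sum of [clt_smooth] to the argument [x -] variable from
    which convergence in law is deduced. *)
Let score m (i : 'I_m) (x : R * bool) : R :=
  - ((1 + be) * centered false i x + be * centered true i x).

Let measurable_score m (i : 'I_m) : measurable_fun [set: R * bool] (score i).
Proof.
have mc r : measurable_fun [set: R * bool] (centered r i).
  by apply: measurable_funB; [exact: measurable_count_of|exact: measurable_cst].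
apply: measurable_funN; apply: measurable_funD; apply: measurable_funM => //; exact: measurable_cst.
Qed.

Let norm_centered_le m r (i : 'I_m) x : `|centered r i x| <= 1.
Proof.
have /andP[h1 h2] := count_of_01 M w r tau i x.
have e0 : 0 <= Er (fun u => count_of M w r tau i (mix_pair M i u)).
  by apply: Er_ge0 => u; case/andP: (count_of_01 M w r tau i (mix_pair M i u)).
have e1 : Er (fun u => count_of M w r tau i (mix_pair M i u)) <= 1.
  rewrite -[leRHS](Er_cst P); apply: le_Er; [exact: bmf_count_of|exact: bmf_cst|].
  by move=> u; case/andP: (count_of_01 M w r tau i (mix_pair M i u)).
rewrite /centered; move: (count_of _ _ _ _ _ _) (Er _) h1 h2 e0 e1 => y z *.
by rewrite ler_norml; apply/andP; split; lra.
Qed.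

Let norm_score_le m (i : 'I_m) x : `|score i x| <= `|1 + be| + `|be| + 1.
Proof.
rewrite normrN (le_trans (ler_normD _ _))// -[leLHS]addr0 lerD//.
by rewrite lerD// normrM ler_piMr.
Qed.

Let bmf_centered m r (i : 'I_m) : bmf (fun u => centered r i (mix_pair M i u)).
Proof. by apply: bmfB; [exact: bmf_count_of|exact: bmf_cst]. Qed.

Let Er_centered m r (i : 'I_m) : Er (fun u => centered r i (mix_pair M i u)) = 0.
Proof. by rewrite ErB ?Er_cst ?subrr//; [exact: bmf_count_of|exact: bmf_cst]. Qed.

Lemma score_sum m u : (Num.sqrt m%:R)^-1 * \sum_(0 <= j < m) model_row M (@score m) j u =
  - ((1 + be) * W m false tau u + be * W m true tau u).
Proof.
rewrite row_sum !emp_process_count// /score sumrN big_split/= -!mulr_sumr.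
by rewrite mulrN mulrDr [_^-1 * ((1 + be) * _)]mulrCA [_^-1 * (be * _)]mulrCA.
Qed.

Lemma score_variance m : (0 < m)%N ->
  Er (fun u => (\sum_(0 <= j < m) model_row M (@score m) j u) ^+ 2) / m%:R =
  (1 + be) ^+ 2 * emp_cov M w m false false tau tau + be ^+ 2 * emp_cov M w m true true tau tau
  + 2 * be * (1 + be) * emp_cov M w m true false tau tau.
Proof.
move=> m0; have bS := bmf_row M (@measurable_score m) (@norm_score_le m).
have bW r : bmf (W m r tau) by exact: bmf_emp_process.
transitivity (Er (fun u => ((1 + be) * W m false tau u + be * W m true tau u) ^+ 2)).
  rewrite mulrC -ErZ; last by apply: bmfX; exact: bmf_sum.
  by apply: eq_Er => u; rewrite -[RHS]sqrrN -score_sum exprMn exprVn sqr_sqrtr.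
by rewrite Er_sqr_combination// !emp_covE.
Qed.

Lemma score_variance_cvg :
  Er (fun u => (\sum_(0 <= j < m) model_row M (@score m) j u) ^+ 2) / m%:R
    @[m --> \oo] --> (1 + be) ^+ 2 * c00 + be ^+ 2 * c11 + 2 * be * (1 + be) * c10.
Proof.
have h : (1 + be) ^+ 2 * emp_cov M w m false false tau tau + be ^+ 2 * emp_cov M w m true true tau
  tau
    + 2 * be * (1 + be) * emp_cov M w m true false tau tau
    @[m --> \oo] --> (1 + be) ^+ 2 * c00 + be ^+ 2 * c11 + 2 * be * (1 + be) * c10.
  by apply: cvgD; [apply: cvgD|]; apply: cvgM => //; exact: cvg_cst.
apply: cvg_trans h; apply: near_eq_cvg; exists 1%N => // m /= m0.
by rewrite score_variance.
Qed.

Lemma limit_variance_ge0 : 0 <= (1 + be) ^+ 2 * c00 + be ^+ 2 * c11 + 2 * be * (1 + be) * c10.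
Proof. exact: sig2_ge0 score_variance_cvg. Qed.

Lemma linear_part_smooth (eps x : R) : 0 < eps ->
  Er (fun u => gauss_smooth (eps ^+ 2) (x - ((1 + be) * W m false tau u + be * W m true tau u)))
    @[m --> \oo] --> gauss_smooth (eps ^+ 2 +
      ((1 + be) ^+ 2 * c00 + be ^+ 2 * c11 + 2 * be * (1 + be) * c10)) x.
Proof.
move=> eps0.
have B0 : 0 < `|1 + be| + `|be| + 1 by rewrite ltr_wpDl// addr_ge0.
have al0 n : 0 <= alpha M n by case/andP: (alpha01 M n).
have EX0 m j : Er (model_row M (@score m) j) = 0.
  rewrite /model_row; case: insubP => [i _ _|_]; last exact: Er_cst.
  rewrite ErN ?ErD ?ErZ ?Er_centered ?mulr0 ?addr0 ?oppr0//; try exact: bmf_centered;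
    try (by apply: bmfZ; exact: bmf_centered).
  by apply: bmfD; apply: bmfZ; exact: bmf_centered.
have bX m j : bmf (model_row M (@score m) j) by exact: bmf_row (@measurable_score m)
  (@norm_score_le m) j.
have XB m j u : `|model_row M (@score m) j u| <= `|1 + be| + `|be| + 1.
  by rewrite /model_row; case: insub => [i|]; rewrite ?normr0// ltW.
have mix m : row_mixing P (model_row M (@score m)) (alpha M).
  by apply: row_mixing_row; exact: measurable_score.
have h := @clt_smooth _ _ _ P _ _ _ _ B0 bX XB EX0 al0 mix hal score_variance_cvg eps x eps0.
have E : (fun m => Er (fun u => gauss_smooth (eps ^+ 2) (x + (Num.sqrt m%:R)^-1 *
    \sum_(0 <= j < m) model_row M (@score m) j u))) =
  (fun m => Er (fun u => gauss_smooth (eps ^+ 2)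
    (x - ((1 + be) * W m false tau u + be * W m true tau u)))).
  by apply/funext => m; apply: eq_Er => u; rewrite score_sum.
by rewrite E in h.
Qed.

End limit_of_linear_part.

(** * Existence of the limiting covariances *)

Section limiting_covariance.
Context d (T : measurableType d) (R : realType) (P : probability T R) (k : nat).
Context (M : factor_model P k) (w : 'rV[R]_k) (t : R).
Hypotheses (t01 : 0 < t < 1)
  (hlim : forall r, cvgn (fun m => subdist M w m r t))
  (hcov1 : forall r0 r1 : bool,
       cvgn (fun m : nat => group_prob M m r0 * group_prob M m r1 / m%:R *
         \sum_(i < m) gamma M w i r0 t * gamma M w i r1 t))
  (hcov2 : forall r0 r1 : bool,
       cvgn (fun m : nat => group_prob M m r0 * group_prob M m r1 / m%:R *
         \sum_(i < m) \sum_(j < m | i != j)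
           rho_tilde (gamma M w i r0 t) (gamma M w j r1 t)
                     (corr_mx (noise_cov M m) i j))).

Lemma emp_cov_cvg r0 r1 : emp_cov M w m r0 r1 t t @[m --> \oo] --> lim_cov M w r0 r1 t t.
Proof.
suff : cvgn (fun m => emp_cov M w m r0 r1 t t) by [].
rewrite (_ : (fun m => _) = (fun m => (r0 == r1)%:R * subdist M w m r0 t -
    group_prob M m r0 * group_prob M m r1 / m%:R *
      (\sum_(i < m) gamma M w i r0 t * gamma M w i r1 t) +
    group_prob M m r0 * group_prob M m r1 / m%:R * (\sum_(i < m) \sum_(j < m | i != j)
           rho_tilde (gamma M w i r0 t) (gamma M w j r1 t) (corr_mx (noise_cov M m) i j)))).
  apply: is_cvgD; [apply: is_cvgB|exact: hcov2]; last exact: hcov1.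
  by apply: is_cvgM; [exact: is_cvg_cst|exact: hlim].
by apply/funext => m; exact: emp_cov_decomp.
Qed.

End limiting_covariance.

Theorem theorem3p2 (disp : measure_display) (T : measurableType disp) (R : realType)
    (P : probability T R) (k : nat) (M : factor_model P k) (w : 'rV[R]_k)
    (q : R) (hq : 0 < q < 1)
    (* (1) *)
    (hload : sup [set x | exists m (i : 'I_m), x = sqnorm2 (loading M i)] < 1)
    (* (2) *)
    (hmix : exists (Q : nat) (g : R),
       [/\ ~~ odd Q, (2 < Q)%N, 0 < g, g / (2 + g) + 2 / Q%:R < 1 &
         (\sum_(1 <= n <oo)
            (n%:R ^+ (Q - 2) * alpha M n `^ (g / (Q%:R + g)))%:E < +oo)%E])
    (* (3) *)
    (hlim : forall (r : bool) (t : R), 0 <= t <= 1 -> cvgn (fun m => subdist M w m r t))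
    (* (4) *)
    (htau_gt0 : 0 < simes_point M w q)
    (htau_sup : simes_point M w q = sup [set t | 0 < t < 1 /\ lim_dist M w t > t / q])
    (htau_isol : ~ limit_point [set t | 0 < t < 1 /\ lim_dist M w t = t / q]
                     (simes_point M w q))
    (* the interval [a, b] *)
    (a b : R) (ha : 0 < a < q) (hb : q < b < 1)
    (hGa : lim_dist M w a > a / q)
    (htau_ab : a < simes_point M w q < b)
    (htau_fix : lim_dist M w (simes_point M w q) = simes_point M w q / q)
    (htau_uniq : forall t, a < t < b -> lim_dist M w t = t / q -> t = simes_point M w q)
    (* (5) *)
    (hcov1 : forall (s t : R) (r0 r1 : bool), a <= s <= b -> a <= t <= b ->
       cvgn (fun m : nat => group_prob M m r0 * group_prob M m r1 / m%:R *
         \sum_(i < m) gamma M w i r0 t * gamma M w i r1 s))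
    (hcov2 : forall (s t : R) (r0 r1 : bool), a <= s <= b -> a <= t <= b ->
       cvgn (fun m : nat => group_prob M m r0 * group_prob M m r1 / m%:R *
         \sum_(i < m) \sum_(j < m | i != j)
           rho_tilde (gamma M w i r0 t) (gamma M w j r1 s)
                     (corr_mx (noise_cov M m) i j)))
    (* (6) *)
    (hdiff : forall r : bool, derivable (lim_subdist M w r : R -> R^o) (simes_point M w q) 1)
    (* makes the quotient [beta_slope] meaningful *)
    (hslope : q^-1 - derive1 (lim_dist M w : R -> R^o) (simes_point M w q) != 0)
    (* (7) *)
    (hunif : forall r : bool,
       sup [set `|Num.sqrt m%:R * (subdist M w m r t - lim_subdist M w r t)|
             | t in `[a, b]%classic] @[m --> \oo] --> (0 : R)) :
  cvg_in_law P
    (fun m u => Num.sqrt m%:R *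
       ((false_discoveries M w q m u)%:R / m%:R - lim_subdist M w false (simes_point M w q)))
    (centered_normal (fp_variance M w q)).
Proof.
have /andP[q0 q1] := hq; have /andP[a0 aq] := ha; have /andP[qb b1] := hb.
have /andP[atau taub] := htau_ab.
set tau := simes_point M w q in htau_gt0 htau_sup htau_isol atau taub htau_fix htau_uniq hdiff
  hslope htau_ab *.
have tau01 : 0 < tau < 1 by rewrite htau_gt0 (lt_trans taub).
have tauab : a <= tau <= b by rewrite !ltW.
have hal : cvgn (series (fun n => n%:R * alpha M n)).
  have [Q [g [oQ Q2 g0 _ fin]]] := hmix.
  exact: mixing_rate_summable (alpha01 M) oQ Q2 g0 fin.
(* [tau] is the supremum of the points where the limit distribution is at least [t / q], so beyond
   it the inequality is strict; [t <= b < 1] keeps [t] in range. *)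
have Glt t : tau < t <= b -> lim_dist M w t < t / q.
  move=> /andP[tt tb]; rewrite ltNge; apply/negP => h.
  have := tt; rewrite ltNge => /negP; apply; apply: ub_le_sup.
    by exists 1 => x [/andP[_ /ltW]].
  by split => //; rewrite (lt_trans htau_gt0 tt) (le_lt_trans tb).
have hl r : cvgn (fun m => subdist M w m r tau) by apply: hlim; case/andP: tau01 => ? ?;
  rewrite !ltW.
have hc r0 r1 : emp_cov M w m r0 r1 tau tau @[m --> \oo] --> lim_cov M w r0 r1 tau tau.
  exact: (emp_cov_cvg tau01 hl (fun r r' => hcov1 tau tau r r' tauab tauab)
    (fun r r' => hcov2 tau tau r r' tauab tauab)).
have bE : beta_slope M w q = derive1 (lim_subdist M w false : R -> R^o) tau /
  (q^-1 - derive1 (lim_dist M w : R -> R^o) tau) by [].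
have vE : fp_variance M w q = (1 + beta_slope M w q) ^+ 2 * lim_cov M w false false tau tau +
  beta_slope M w q ^+ 2 * lim_cov M w true true tau tau
  + 2 * beta_slope M w q * (1 + beta_slope M w q) * lim_cov M w true false tau tau by [].
have smooth := @linear_part_smooth _ _ _ _ _ M w tau (beta_slope M w q) _ _ _ tau01 hal (@hc false
  false) (@hc true true) (@hc true false).
rewrite -vE in smooth.
have v0 : 0 <= fp_variance M w q.
  by rewrite vE; exact: (@limit_variance_ge0 _ _ _ _ _ M w tau (beta_slope M w q) _ _ _ tau01 (@hc
    false false) (@hc true true) (@hc true false)).
have mY m : measurable_fun [set: T] (fun u => (1 + beta_slope M w q) * emp_process M w m false tau
  u +
    beta_slope M w q * emp_process M w m true tau u).
  by apply: (@bmfD _ _ _ _ _ _ _).1; apply: bmfZ; exact: bmf_emp_process.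
have mZ m : measurable_fun [set: T] (fun u => Num.sqrt m%:R *
   ((false_discoveries M w q m u)%:R / m%:R - lim_subdist M w false tau) : R).
  case: m => [|m]; first by under eq_fun do rewrite sqrtr0 mul0r; exact: measurable_cst.
  apply: measurable_funM; first exact: measurable_cst.
  by apply: measurable_funB; [exact: measurable_false_discoveries|exact: measurable_cst].
apply: (smooth_cvg_in_law v0 mZ) => eps x eps0.
(* The limit is known for the linear part, from which the normalized false positive ratio differs by
   a quantity tending to 0 in probability. *)
apply: (smooth_slutsky mY mZ) eps0 => // e e0.
rewrite bE; exact: (linearization q0 a0 atau taub qb b1 hload hal hlim htau_fix Glt hdiff hslope
  hunif e0).
Qed.
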